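(* In the two-stacks model described in the context, the function $$W(x)=2\int_0^{x_1}\tanh^{-1}(g_1(y))\,dy+2\int_0^{x_2}\tanh^{-1}(g_2(y))\,dy,\qquad x=(x_1,x_2)\in[0,1]^2,$$ coincides with the quasi-potential: $W(x)=V(x)$ for all $x\in[0,1]^2$. Moreover, for any $x\in[0,1]^2\setminus\{0\}$ there is one and only one optimal path $(\varphi_t)_{t\le0}$ from $0$ to $x$. The time-reversed path $(\varphi_{-t})_{t\ge0}$ is the unique solution of the reflected differential equation with initial point $x$, i.e. $\varphi_t=\chi^x_{-t}$ for all $t\le0$.
   Context: Notation: $|\cdot|$ is the Euclidean norm, $\langle\cdot,\cdot\rangle$ the Euclidean scalar product. Model. $d=2$, $E=\{1,2\}$, $\mathcal V=\{\pm e_1,\pm e_2\}$ with $(e_1,e_2)$ the canonical basis of $\mathbb R^2$. $P$ is an irreducible stochastic matrix on $E$ with invariant probability $\mu$. For $x=(x_1,x_2)\in[0,1]^2$ and $i\in E$, $p(x,i,e_1)=\frac12\lambda_i[1-g_1(x_1)]$, $p(x,i,-e_1)=\frac12\lambda_i[1+g_1(x_1)]$, $p(x,i,e_2)=\frac12(1-\lambda_i)[1-g_2(x_2)]$, $p(x,i,-e_2)=\frac12(1-\lambda_i)[1+g_2(x_2)]$, where $\lambda_i\in(0,1)$ for $i\in E$ and $g_1,g_2:[0,1]\to[0,1)$ are Lipschitz continuous with $g_j(z)>0$ for $z>0$. Put $\lambda=\lambda_1\mu(1)+\lambda_2\mu(2)$ and $\bar f(x)=-(\lambda g_1(x_1),(1-\lambda)g_2(x_2))$.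 Reflection. For $x\in\partial[0,1]^2$, $\mathcal N(x)=\{v\in\mathbb R^2:|v|=1,\ v_\ell=0\text{ if }x_\ell\in(0,1),\ v_\ell\le0\text{ if }x_\ell=0,\ v_\ell\ge0\text{ if }x_\ell=1\}$. For continuous $w$ with $w_0\in[0,1]^2$ there is a unique continuous pair $(x_t,k_t)\in[0,1]^2\times\mathbb R^2$, $k$ of bounded variation on bounded sets, with $w_t=x_t+k_t$, $k_t=\int_0^tn_s\,d|k|_s$, $|k|_t=\int_0^t\mathbf 1_{\{x_s\in\partial[0,1]^2\}}d|k|_s$, $n_s\in\mathcal N(x_s)$; $\Psi$ denotes the map $w\mapsto x$. For $x\in[0,1]^2$, $(\chi^x_t)_{t\ge0}$ is the unique solution of the reflected differential equation $\chi^x=\Psi(x+\int_0^\cdot\bar f(\chi^x_s)ds)$. Quasi-potential. $H(x,\alpha)$ is the logarithm of the Perron–Frobenius eigenvalue of $\big[P(i,j)\sum_{v\in\mathcal V}e^{\langle\alpha,v\rangle}p(x,i,v)\big]_{i,j\in E}$, and $L(x,v)=\sup_{\alpha\in\mathbb R^2}\{\langle\alpha,v\rangle-H(x,\alpha)\}$. For $T>0$, $\phi\in\mathcal C([0,T];[0,1]^2)$: $J^0_{0,T}(\phi)=\inf\{\int_0^TL(\phi_s,\dot\psi_s)ds:\psi\text{ absolutely continuous},\Psi(\psi)=\phi\}$ if $\phi_0=0$ and such a $\psi$ exists, $\infty$ otherwise. $V(x)=\inf\{J^0_{0,T}(\phi):\phi_0=0,\phi_T=x,T>0\}$. Optimal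 paths. Let $L^{\rm ref}(x,v)=L(x,v)$ for $x\in(0,1)^2$ and, for $x\in\partial[0,1]^2$: $L^{\rm ref}(x,v)=+\infty$ if $\langle v,n\rangle>0$ for some $n\in\mathcal N(x)$; $L^{\rm ref}(x,v)=L(x,v)$ if $\langle v,n\rangle<0$ for all $n\in\mathcal N(x)$; and $L^{\rm ref}(x,v)=\inf\{L(x,v+\beta n):\beta\ge0,\ n\in\mathcal N(x),\ n\perp v\}$ otherwise. For a continuous path $\psi:(-\infty,0]\to[0,1]^2$ with $\lim_{t\to-\infty}\psi_t=0$, $J_{-\infty,0}(\psi)=\int_{-\infty}^0L^{\rm ref}(\psi_t,\dot\psi_t)dt$ ($=\infty$ if $\psi$ is not absolutely continuous). One has $V(x)=\inf\{J_{-\infty,0}(\psi):\lim_{t\to-\infty}\psi_t=0,\psi_0=x\}$; an optimal path from $0$ to $x$ is a path attaining this infimum. *)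

(* Defs.v *)
From HB Require Import structures.
From mathcomp Require Import all_boot all_order all_algebra.
From mathcomp Require Import all_classical all_reals all_analysis.
From mathcomp Require Import complex ring.

Set Implicit Arguments.
Unset Strict Implicit.
Unset Printing Implicit Defensive.

Import Order.TTheory GRing.Theory Num.Theory.
Import numFieldNormedType.Exports.

Local Open Scope classical_set_scope.
Local Open Scope ring_scope.

(* Points of R^2 are row vectors and E = {1, 2} is 'I_2: the index 1 (resp. 2)
   of the mathematical text is 0 (resp. 1) here. The topology of 'rV[R]_2 is
   given by the max-norm, so the Euclidean norm has its own name. *)

Section Euclidean.
Context {R : realType}.
Implicit Types (u v : 'rV[R]_2) (f : R -> 'rV[R]_2).

Definition dotp u v : R := \sum_(l < 2) u 0 l * v 0 l.

Definition enorm u : R := Num.sqrt (dotp u u).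

(* Vector-valued, Euclidean counterpart of total_variation. *)
Definition evariation (a b : R) f (s : seq R) : R :=
  let F := f \o nth b (a :: s) in
  \sum_(0 <= n < size s) enorm (F n.+1 - F n).

Definition etotal_variation (a b : R) f : \bar R :=
  ereal_sup [set (evariation a b f s)%:E | s in itv_partition a b].

(* A finite family of non-overlapping subintervals is listed from left to
   right, as the sequence of the pairs of its end points. *)
Definition abs_continuous (a b : R) f : Prop :=
  forall e : R, 0 < e -> exists2 d : R, 0 < d &
    forall s : seq (R * R),
      (forall p, p \in s -> a <= p.1 /\ p.1 <= p.2 /\ p.2 <= b) ->
      pairwise (fun p q : R * R => p.2 <= q.1) s ->
      \sum_(p <- s) (p.2 - p.1) < d ->
      \sum_(p <- s) enorm (f p.2 - f p.1) < e.

End Euclidean.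

Section Tanh.
Context {R : realType}.

Definition tanh (x : R) : R :=
  (expR x - expR (- x)) / (expR x + expR (- x)).

Definition artanh (y : R) : R := 2^-1 * ln ((1 + y) / (1 - y)).

Lemma artanhK (y : R) : -1 < y < 1 -> tanh (artanh y) = y.
Proof.
move=> /andP[y1 y2]; rewrite /tanh expRN.
have p1 : 0 < 1 + y by rewrite -ltrBlDl sub0r.
have p2 : 0 < 1 - y by rewrite subr_gt0.
set E := expR (artanh y).
have E0 : E != 0 by rewrite gt_eqF// expR_gt0.
have EE : E * E = (1 + y) / (1 - y).
  have h : 2^-1 + 2^-1 = 1 :> R by field.
  by rewrite /E -expRD /artanh -mulrDl h mul1r lnK// posrE divr_gt0.
have q : E * E + 1 != 0 by rewrite gt_eqF// ltr_wpDl// -expr2 sqr_ge0.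
have -> : (E - E^-1) / (E + E^-1) = (E * E - 1) / (E * E + 1).
  by field; rewrite E0 q.
rewrite EE; field.
by rewrite gt_eqF//= -addrA subrKC gt_eqF.
Qed.

End Tanh.

Section Square.
Context {R : realType}.

Definition square : set 'rV[R]_2 := [set x | forall l, 0 <= x 0 l <= 1].

Definition open_square : set 'rV[R]_2 := [set x | forall l, 0 < x 0 l < 1].

Definition bd_square : set 'rV[R]_2 := square `\` open_square.

(* Outward unit normals; only meaningful for x in bd_square. *)
Definition normals (x : 'rV[R]_2) : set 'rV[R]_2 :=
  [set n | enorm n = 1 /\ forall l,
    [/\ 0 < x 0 l < 1 -> n 0 l = 0,
        x 0 l = 0 -> n 0 l <= 0 &
        x 0 l = 1 -> 0 <= n 0 l]].

(* (x, k) is the solution of the Skorokhod problem in the square for the input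
   w on the time set D, which is `[0, T] or `[0, +oo[. The measure m is d|k|,
   characterized by its values on the intervals ]a, b]; the values of n_s for
   x_s in the open square are immaterial as they are not charged by d|k|. *)
Definition skorokhod (D : set R) (w x k : R -> 'rV[R]_2) : Prop :=
  [/\ {within D, continuous x} /\ {within D, continuous k},
      forall t, D t -> square (x t) /\ w t = x t + k t,
      forall t, D t -> (etotal_variation 0 t k < +oo)%E &
      exists (m : {measure set (measurableTypeR R) -> \bar R})
             (n : R -> 'rV[R]_2),
      [/\ forall a b : R, 0 <= a -> a <= b -> D b ->
            m `]a, b]%classic = etotal_variation a b k,
          forall l, measurable_fun D (fun s => n s 0 l),
          forall s, D s -> bd_square (x s) -> normals (x s) (n s),
          forall t, D t -> forall l,
            k t 0 l = \int[m]_(s in `]0, t]) n s 0 l &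
          forall t, D t -> etotal_variation 0 t k =
            (\int[m]_(s in `]0%R, t]) (\1_[set r | bd_square (x r)] s)%:E)%E]].

(* The graph of the reflection map Psi: Psi w = x on D. *)
Definition reflection (D : set R) (w x : R -> 'rV[R]_2) : Prop :=
  exists k, skorokhod D w x k.

End Square.

Section Chain.
Context {R : realType}.

Definition stochastic_mx (P : 'M[R]_2) : Prop :=
  (forall i j, 0 <= P i j) /\ forall i, \sum_j P i j = 1.

Definition irreducible_mx (P : 'M[R]_2) : Prop :=
  forall i j, exists n : nat, 0 < (P ^+ n) i j.

Definition invariant_probability (P : 'M[R]_2) (mu : 'rV[R]_2) : Prop :=
  [/\ forall i, 0 <= mu 0 i, \sum_i mu 0 i = 1 & mu *m P = mu].

(* The real eigenvalue dominating the moduli of all the complex ones (xget 0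
   is only a default for the matrices without such an eigenvalue). *)
Definition perron_frobenius (A : 'M[R]_2) : R :=
  xget 0 [set r | eigenvalue A r /\ forall z : R[i],
    eigenvalue (map_mx (real_complex R) A) z -> `|z| <= real_complex R r].

End Chain.

Section Model.
Context {R : realType}.
Variables (P : 'M[R]_2) (mu : 'rV[R]_2) (lam : 'I_2 -> R) (g : 'I_2 -> R -> R).
Implicit Types (x v alpha : 'rV[R]_2) (phi psi chi : R -> 'rV[R]_2).
Local Notation leb := (@lebesgue_measure R).

(* V = {e_1, -e_1, e_2, -e_2}: the pair (b, l) stands for (-1)^b e_l. *)
Definition step (d : bool * 'I_2) : 'rV[R]_2 := (-1) ^+ d.1 *: delta_mx 0 d.2.

Definition jump x (i : 'I_2) (d : bool * 'I_2) : R :=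
  2^-1 * (if d.2 == 0 then lam i else 1 - lam i) *
  (1 - (-1) ^+ d.1 * g d.2 (x 0 d.2)).

Definition lambda : R := \sum_i lam i * mu 0 i.

Definition fbar x : 'rV[R]_2 :=
  \row_l - ((if l == 0 then lambda else 1 - lambda) * g l (x 0 l)).

Definition reflected_ode x chi : Prop :=
  reflection `[0, +oo[
    (fun t => x + \row_l \int[leb]_(s in `[0, t]) fbar (chi s) 0 l) chi.

Definition tilted_mx x alpha : 'M[R]_2 :=
  \matrix_(i, j) (P i j * \sum_d expR (dotp alpha (step d)) * jump x i d).

Definition hamiltonian x alpha : R := ln (perron_frobenius (tilted_mx x alpha)).

Definition lagrangian x v : \bar R :=
  ereal_sup [set (dotp alpha v - hamiltonian x alpha)%:E | alpha in setT].

(* Absolutely continuous paths have a derivative almost everywhere; derive1 is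
   total, and its values at the other times do not affect the integrals. *)
Definition action0 (T : R) phi : \bar R :=
  ereal_inf [set c | phi 0 = 0 /\ exists psi,
    [/\ abs_continuous 0 T psi, reflection `[0, T] psi phi &
        c = (\int[leb]_(s in `[0%R, T]) lagrangian (phi s) (derive1 psi s))%E]].

Definition quasi_potential x : \bar R :=
  ereal_inf [set c | exists T phi,
    [/\ 0 < T, {within `[0, T], continuous phi},
        forall t, 0 <= t <= T -> square (phi t),
        phi 0 = 0 /\ phi T = x & c = action0 T phi]].

Definition lagrangian_ref x v : \bar R :=
  if `[< open_square x >] then lagrangian x v
  else if `[< exists2 n, normals x n & 0 < dotp v n >] then +oo%E
  else if `[< forall n, normals x n -> dotp v n < 0 >] then lagrangian x v
  else ereal_inf [set c | exists (beta : R) n,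
         [/\ 0 <= beta, normals x n, dotp n v = 0 &
             c = lagrangian x (v + beta *: n)]].

(* A path on ]-oo, 0] is a function on R whose values at positive times are
   irrelevant. *)
Definition path_from0 x phi : Prop :=
  [/\ {within `]-oo, 0], continuous phi},
      forall t, t <= 0 -> square (phi t),
      phi t @[t --> -oo] --> (0 : 'rV[R]_2) & phi 0 = x].

Definition action_ref phi : \bar R :=
  if `[< forall a, a <= 0 -> abs_continuous a 0 phi >] then
    (\int[leb]_(t in `]-oo, 0%R]) lagrangian_ref (phi t) (derive1 phi t))%E
  else +oo%E.

Definition optimal_path x phi : Prop :=
  path_from0 x phi /\
  action_ref phi = ereal_inf [set action_ref psi | psi in path_from0 x].

Definition explicit_potential x : R :=
  2 * (\int[leb]_(y in `[0, x 0 0]) artanh (g 0 y)) +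
  2 * (\int[leb]_(y in `[0, x 0 1]) artanh (g 1 y)).

End Model.

(* Main.v *)
From HB Require Import structures.
Require Import Defs.
From mathcomp Require Import all_boot all_order all_algebra.
From mathcomp Require Import all_classical all_reals all_analysis.
From mathcomp Require Import complex ring lra measurable_realfun.

Set Implicit Arguments.
Unset Strict Implicit.
Unset Printing Implicit Defensive.

Import Order.TTheory GRing.Theory Num.Theory.
Import numFieldNormedType.Exports.

Local Open Scope classical_set_scope.
Local Open Scope ring_scope.

(** Why the theorem is true.

Let kap = (lambda, 1 - lambda), so that the averaged drift along the axis l is
- kap_l g_l, and let slope_l = 2 artanh g_l be the derivative of W in the direction l.
Tilting a step along the axis l by exp (a) multiplies its weight on average by
tilt g_l a = (exp (a) (1 - g_l) + exp (- a) (1 + g_l)) / 2, which is invariant under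
a -> slope_l - a and equal to 1 at a = 0 and at a = slope_l. Hence H (x, alpha) = 0 as soon
as each alpha_l is 0 or slope_l (hamiltonian_slope). In particular W solves the
Hamilton-Jacobi equation H (x, grad W) = 0, and L (x, v) is at least the derivative
of W along v. By convexity of H, equality forces v to be the gradient of H at grad W, which
by the symmetry is the reversed drift; lagrangian_ref_ge quantifies this for the reflected
Lagrangian, where the only other case of equality is a coordinate at rest at 0.

Integrated along a path from 0 to x, this gives an action at least W x, with
equality only if almost everywhere each coordinate follows the reversed drift or is at
rest at 0 (action_ref_gap). Such a path is determined by its end point, since two
reversed solutions satisfy a Gronwall inequality (climb_unique), in which the coordinates
held at 0 contribute with the favourable sign. The reversal of the solution of the reflected
equation has these velocities and its action is W x (action_ref_climb), so that it is the
optimal path. The reflected equation decouples into two scalar equations; the reflected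
solution is the positive part of the free one (traj), it tends to 0 as g is positive on
]0, 1], and the push that makes it a solution in the sense of Skorokhod is explicit
(push_reflection).

For the quasi-potential, the lower bound is the same with the momentum slope_l replaced
by 0 where x_l = 0 (action0_ge). For the upper bound, a path going straight from 0 to a
nearby point of the optimal path and then following it has a cost at most W x plus a
multiple of the duration of the first part (quasi_potential_near_optimal).

These arguments need three facts of analysis. An absolutely continuous function is the
integral of its derivative, which exists almost everywhere (rabs_continuous_FTC); it is
derived from the Radon-Nikodym theorem. In a solution of the Skorokhod problem, the
coordinate l of k increases only when x_l = 1 and decreases only when x_l = 0
(skorokhod_coordinate), which makes the reflected path absolutely continuous when the free
path is, and relates their derivatives (reflected_derive). The variation of a path of bounded
velocity is the integral of its speed (etotal_variation_displacement). *)

(** * Absolutely continuous real functions *)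

Section RealAbsoluteContinuity.
Context {R : realType}.
Implicit Types (a b : R) (f F : R -> R) (s : seq (R * R)).
Local Notation leb := (@lebesgue_measure R).

Lemma ae_sub (P Q : R -> Prop) : (forall x, P x -> Q x) ->
  {ae leb, forall x, P x} -> {ae leb, forall x, Q x}.
Proof. by move=> PQ; apply: (@filterS _ _ (ae_filter_ringOfSetsType leb)). Qed.

Lemma ae_and (P Q : R -> Prop) :
  {ae leb, forall x, P x} -> {ae leb, forall x, Q x} ->
  {ae leb, forall x, P x /\ Q x}.
Proof. by move=> aP aQ; apply: (@filterI _ _ (ae_filter_ringOfSetsType leb)). Qed.

Lemma near_itvoo (a b t : R) : a < t < b -> \forall s \near t, a < s < b.
Proof.
move=> atb; near=> s.
have : s \in `]a, b[ by near: s; apply: near_in_itvoo; rewrite in_itv.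
by rewrite in_itv.
Unshelve. all: by end_near. Qed.

Definition nonoverlapping a b s :=
  (forall p, p \in s -> a <= p.1 /\ p.1 <= p.2 /\ p.2 <= b) /\
  pairwise (fun p q : R * R => p.2 <= q.1) s.

(** Absolute continuity of a vector-valued path is that of its coordinates, so that the
theory is developed for real functions. *)
Definition rabs_continuous a b f := forall e : R, 0 < e ->
  exists2 d : R, 0 < d & forall s, nonoverlapping a b s ->
    \sum_(p <- s) (p.2 - p.1) < d -> \sum_(p <- s) `|f p.2 - f p.1| < e.

(** Dyadic subdivisions exhaust an open set by finite families of intervals that do not
overlap and are listed in increasing order, as absolute continuity requires. *)
Definition dyadic a b n k : R := a + (b - a) * (k%:R / (2 ^ n)%:R).

Lemma dyadic_le a b n k l : a <= b -> (k <= l)%N ->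
  dyadic a b n k <= dyadic a b n l.
Proof.
move=> ab kl; rewrite lerD2l ler_wpM2l ?subr_ge0//.
by rewrite ler_wpM2r ?invr_ge0// ler_nat.
Qed.

Lemma dyadic0 a b n : dyadic a b n 0 = a.
Proof. by rewrite /dyadic mul0r mulr0 addr0. Qed.

Lemma dyadic_max a b n : dyadic a b n (2 ^ n) = b.
Proof.
rewrite /dyadic divff ?mulr1; last by rewrite pnatr_eq0 expn_eq0.
by rewrite addrC subrK.
Qed.

Lemma dyadicS a b n k : dyadic a b n.+1 k.*2 = dyadic a b n k.
Proof.
rewrite /dyadic; congr (_ + _ * _).
rewrite -mul2n expnS !natrM invfM mulrACA divff ?mul1r//.
Qed.

Lemma dyadic_step a b n k :
  dyadic a b n k.+1 - dyadic a b n k = (b - a) / (2 ^ n)%:R.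
Proof. by rewrite /dyadic -addn1 natrD; ring. Qed.

Lemma dyadic_cover a b n x : a < x <= b ->
  exists2 k, (k < 2 ^ n)%N & dyadic a b n k < x <= dyadic a b n k.+1.
Proof.
move=> /andP[ax xb].
have [k kx kmin] := @ex_minnP (fun k => x <= dyadic a b n k)
   (ex_intro _ (2 ^ n)%N (eq_ind_r (fun u => x <= u) xb (dyadic_max a b n))).
case: k kx kmin => [|k] kx kmin; first by rewrite dyadic0 leNgt ax in kx.
exists k.
  by apply: kmin; rewrite dyadic_max.
rewrite kx andbT ltNge; apply/negP => /kmin; by rewrite ltnn.
Qed.

Lemma nonoverlapping_dyadic a b n (P : pred nat) : a <= b ->
  nonoverlapping a b
    [seq (dyadic a b n k, dyadic a b n k.+1) | k <- index_iota 0 (2 ^ n) & P k].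
Proof.
move=> ab; split.
  move=> p /mapP[k]; rewrite mem_filter mem_index_iota => /andP[_ /andP[_ kn]] ->/=.
  split; first by rewrite -{1}(dyadic0 a b n) dyadic_le.
  split; first exact: dyadic_le.
  by rewrite -{2}(dyadic_max a b n) dyadic_le.
rewrite pairwise_map.
apply: (@sub_pairwise _ ltn); first by move=> k l /= kl; exact: dyadic_le.
by apply: pairwise_filter; rewrite -sorted_pairwise ?iota_ltn_sorted//; exact: ltn_trans.
Qed.

Lemma trivIset_dyadic a b n : a <= b ->
  trivIset [set: 'I_(2 ^ n)]
    (fun k : 'I_(2 ^ n) => `]dyadic a b n k, dyadic a b n k.+1]%classic).
Proof.
move=> ab k l _ _ [x [/=]]; rewrite !in_itv/= => /andP[kx xk] /andP[lx xl].
apply/val_inj/eqP; rewrite eqn_leq; apply/andP; split; rewrite leqNgt; apply/negP => kl.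
  by have := lt_le_trans kx (le_trans xl (dyadic_le n ab kl)); rewrite ltxx.
by have := lt_le_trans lx (le_trans xk (dyadic_le n ab kl)); rewrite ltxx.
Qed.

Lemma stieltjes_itv (F : cumulative R R) a b : a <= b ->
  lebesgue_stieltjes_measure F `]a, b]%classic = (F b - F a)%:E.
Proof.
move=> ab; rewrite /lebesgue_stieltjes_measure/= /measure_extension measurable_mu_extE.
  exact: (wlength_itv_bnd _ _ _ ab).
exact: is_ocitv.
Qed.

(** A null set has open neighbourhoods U of small Lebesgue measure. The dyadic intervals
of order n contained in U have a union E n that increases to U, and absolute continuity
bounds the sum of the increments of F on them. *)
Lemma rabs_continuous_null (F : cumulative R R) a b (N : set R) : a <= b ->
  rabs_continuous a b F -> measurable N -> leb N = 0%E ->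
  lebesgue_stieltjes_measure F (N `&` `]a, b]%classic) = 0%E.
Proof.
move=> ab acF mN N0; apply/eqP; rewrite eq_le measure_ge0 andbT.
apply/lee_addgt0Pr => e e0; rewrite add0e.
have [d d0 Fd] := acF _ e0.
have [|U [oU NU Ud]] := @lebesgue_regularity_outer R N d mN _ d0; first by rewrite [X in (X < _)%E]N0 ltry.
have mU : measurable U by exact: open_measurable.
have {}Ud : (leb U < d%:E)%E.
  rewrite (_ : U = N `|` (U `\` N)); last by rewrite setDUK.
  rewrite (le_lt_trans (measureU2 _ _ _))//; first exact: measurableD.
  by rewrite [X in (X + _ < _)%E]N0 add0e.
pose I n (k : nat) := `]dyadic a b n k, dyadic a b n k.+1]%classic.
pose E n := \big[setU/set0]_(k < 2 ^ n | `[< I n k `<=` U >]) I n k.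
have EP n x : E n x <-> exists k, [/\ (k < 2 ^ n)%N, I n k `<=` U & I n k x].
  rewrite /E; split.
    elim/big_ind : _ => //= [A B hA hB [/hA|/hB]//|k /asboolP kU kx].
    by exists k.
  move=> [k [kn kU kx]]; rewrite (bigD1 (Ordinal kn))/=; last exact/asboolP.
  by left.
have mI n k : measurable (I n k) by exact: measurable_itv.
have mE n : measurable (E n) by exact: bigsetU_measurable.
have mEE (m : {measure set (measurableTypeR R) -> \bar R}) n :
    m (E n) = (\sum_(k < 2 ^ n | `[< I n k `<=` U >]) m (I n k))%E.
  by apply: (@measure_bigsetU_ord _ _ _ m _ _ (fun k : 'I_(2 ^ n) => I n k)); [move=> k; exact: mI|exact: trivIset_dyadic].
have sF n : (lebesgue_stieltjes_measure F (E n) <= e%:E)%E.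
  rewrite mEE.
  have dle k : dyadic a b n k <= dyadic a b n k.+1 by exact: dyadic_le.
  rewrite (eq_bigr (fun k : 'I_(2 ^ n) => (F (dyadic a b n k.+1) - F (dyadic a b n k))%:E)); last first.
    by move=> k _; exact: stieltjes_itv.
  rewrite sumEFin lee_fin; apply/ltW.
  have := Fd _ (nonoverlapping_dyadic n (fun k => `[< I n k `<=` U >]) ab).
  rewrite !big_map !big_filter !big_mkord/=.
  move=> h; apply: le_lt_trans (h _).
    by apply: ler_sum => k _; exact: ler_norm.
  rewrite -lte_fin; apply: le_lt_trans Ud.
  apply: (@le_trans _ _ (leb (E n))).
    rewrite mEE.
    rewrite -sumEFin; apply: lee_sum => k _.
    by rewrite [leRHS](stieltjes_itv idfun (dle k)).
  by apply: (@le_measure _ _ _ leb); rewrite ?inE;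
    [exact: mE|exact: mU|move=> x /EP[k [_ kU kx]]; exact: kU].
have EU n m x : (n <= m)%N -> E n x -> E m x.
  move=> /subnK <-; elim: (m - n)%N => // j ih /ih{ih}.
  rewrite addSn; move: (j + n)%N => {}n /EP[k [kn kU]].
  rewrite /I/= in_itv/= => /andP[kx xk].
  have axb : a < x <= b.
    apply/andP; split.
      by apply: le_lt_trans kx; rewrite -{1}(dyadic0 a b n) dyadic_le.
    by apply: le_trans xk _; rewrite -{2}(dyadic_max a b n) dyadic_le.
  have [l ln /andP[lx xl]] := dyadic_cover n.+1 axb.
  have kl : (k.*2 <= l)%N.
    rewrite leqNgt; apply/negP => /(dyadic_le n.+1 ab); rewrite dyadicS leNgt.
    by rewrite (lt_le_trans kx xl).
  have lk : (l < k.+1.*2)%N.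
    rewrite ltnNge; apply/negP => /(dyadic_le n.+1 ab); rewrite dyadicS leNgt.
    by rewrite (lt_le_trans lx xk).
  apply/EP; exists l; split=> //; last by rewrite /I; apply/andP.
  apply: subset_trans kU => y; rewrite /I /mkset !in_itv/= => /andP[ly yl].
  apply/andP; split.
    by apply: le_lt_trans ly; rewrite -dyadicS dyadic_le.
  by apply: le_trans yl _; rewrite -(dyadicS _ _ n k.+1) dyadic_le.
have cvE := nondecreasing_cvg_mu (mu := lebesgue_stieltjes_measure F) mE
   (bigcupT_measurable _ mE) (fun n m nm => introT (subsetPset _ _) (fun x => @EU n m x nm)).
apply: (@le_trans _ _ (lebesgue_stieltjes_measure F (\bigcup_n E n))).
  apply: le_measure; rewrite ?inE.
  - by apply: measurableI => //; exact: measurable_itv.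
  - exact: bigcupT_measurable.
  move=> x [Nx]; rewrite /mkset in_itv/= => axb.
  have [r /= r0 rU] : \forall r \near 0^'+, ball x r `<=` U.
    by apply: open_subball => //; exact: NU.
  have [n nr] : exists n, (b - a) / (2 ^ n)%:R < r / 2.
    exists (Num.bound ((b - a) / (r / 2))).
    rewrite ltr_pdivrMr ?ltr0n ?expn_gt0// mulrC -ltr_pdivrMr ?divr_gt0//.
    apply: (lt_le_trans (archi_boundP _)).
      by rewrite divr_ge0 ?subr_ge0// divr_ge0// ltW.
    by rewrite ler_nat ltnW// ltn_expl.
  exists n => //.
  have [k kn /andP[kx xk]] := dyadic_cover n axb.
  apply/EP; exists k; split => //; last by apply/andP.
  move=> y; rewrite /I /mkset in_itv/= => /andP[ky yk]; apply: (rU (r / 2)).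
  - by rewrite /= sub0r normrN gtr0_norm ?divr_gt0// ltr_pdivrMr// ltr_pMr// ltr1n.
  - by rewrite divr_gt0.
  - rewrite /ball/=; apply: le_lt_trans nr; rewrite -(dyadic_step a b n k).
    by rewrite ler_norml; apply/andP; split; lra.
apply: (cvge_le _ cvE); apply: nearW => n; exact: sF.
Qed.

Lemma rabs_continuous_dominated (K a b : R) f u v :
  rabs_continuous a b u -> rabs_continuous a b v ->
  (forall p q, a <= p -> p <= q -> q <= b ->
     `|f q - f p| <= K * (`|u q - u p| + `|v q - v p|)) ->
  rabs_continuous a b f.
Proof.
move=> acu acv fuv e e0.
have K0 : 0 < `|K| + 1 by rewrite ltr_wpDl.
have e'0 : 0 < e / (`|K| + 1) / 2 by rewrite !divr_gt0.
have [d1 d10 ud] := acu _ e'0; have [d2 d20 vd] := acv _ e'0.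
exists (Num.min d1 d2); first by rewrite lt_min d10.
move=> s nos; rewrite lt_min => /andP[sd1 sd2].
apply: (@le_lt_trans _ _ ((`|K| + 1) *
   (\sum_(p <- s) `|u p.2 - u p.1| + \sum_(p <- s) `|v p.2 - v p.1|))).
  rewrite -big_split/= mulr_sumr big_seq [leRHS]big_seq; apply: ler_sum => p ps.
  have [ap [pq qb]] := nos.1 _ ps.
  apply: (le_trans (fuv _ _ ap pq qb)); apply: ler_wpM2r; first by rewrite addr_ge0.
  by rewrite (le_trans (ler_norm _))// lerDl.
rewrite mulrC -ltr_pdivlMr// [ltRHS](splitr (e / (`|K| + 1))).
by apply: ltrD; [exact: ud|exact: vd].
Qed.

Lemma rabs_continuous_id a b : rabs_continuous a b idfun.
Proof.
move=> e e0; exists e => // s nos se.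
rewrite big_seq (eq_bigr (fun p : R * R => p.2 - p.1)) -?big_seq// => p ps.
by rewrite ger0_norm// subr_ge0; have [_ []] := nos.1 _ ps.
Qed.

Lemma rabs_continuous_lipschitz (K a b : R) f :
  (forall p q, a <= p -> p <= q -> q <= b -> `|f q - f p| <= K * (q - p)) ->
  rabs_continuous a b f.
Proof.
move=> flip; apply: (@rabs_continuous_dominated `|K| _ _ _ idfun idfun);
  [exact: rabs_continuous_id|exact: rabs_continuous_id|].
move=> p q ap pq qb; apply: (le_trans (flip _ _ ap pq qb)).
have pq0 : 0 <= q - p by rewrite subr_ge0.
rewrite /= (ger0_norm pq0); apply: (@le_trans _ _ (`|K| * (q - p))).
  by rewrite ler_wpM2r// ler_norm.
by rewrite ler_wpM2l// lerDl.
Qed.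

Lemma rabs_continuousS a b c d f : a <= c -> d <= b ->
  rabs_continuous a b f -> rabs_continuous c d f.
Proof.
move=> ac db acf e e0; have [r r0 fr] := acf _ e0; exists r => // s [sd ps].
apply: fr; split => // p /sd[cp [pq qd]].
by rewrite (le_trans ac cp) (le_trans qd db).
Qed.

Lemma rabs_continuous1 a b f : rabs_continuous a b f -> forall e, 0 < e ->
  exists2 d, 0 < d & forall p q, a <= p -> p <= q -> q <= b -> q - p < d ->
    `|f q - f p| < e.
Proof.
move=> acf e e0; have [d d0 fd] := acf _ e0; exists d => // p q ap pq qb pqd.
have := fd [:: (p, q)]; rewrite !big_seq1/=; apply => //.
by split => // _ /[!inE]/eqP->.
Qed.

Definition clamp a b (t : R) := Num.max a (Num.min t b).

Lemma clamp_itv a b t : a <= b -> a <= clamp a b t <= b.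
Proof. by move=> ab; rewrite /clamp le_max lexx/= ge_max ab ge_min lexx orbT. Qed.

Lemma clamp_id a b t : a <= t <= b -> clamp a b t = t.
Proof. by move=> /andP[a_t tb]; rewrite /clamp min_l// max_r. Qed.

Lemma clamp_le a b (s t : R) : s <= t -> clamp a b s <= clamp a b t.
Proof.
move=> st; rewrite /clamp ge_max le_max lexx/= le_max; apply/orP; right.
by rewrite le_min !ge_min st lexx orbT.
Qed.

Lemma clamp_dist a b (s t : R) : a <= b -> `|clamp a b s - clamp a b t| <= `|s - t|.
Proof.
move=> ab; wlog st : s t / (s <= t)%R => [hw|].
  by have /orP[/hw//|/hw] := le_total s t; rewrite distrC [leRHS]distrC.
rewrite distrC [leRHS]distrC !ger0_norm ?subr_ge0//; last exact: clamp_le.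
rewrite /clamp.
by case: (leP s b) => ?; case: (leP t b) => ?; rewrite ?(max_r ab);
  case: (leP a s) => ?; case: (leP a t) => ?; lra.
Qed.

Lemma rabs_continuous_clamp a b f : a <= b -> rabs_continuous a b f ->
  continuous (f \o clamp a b).
Proof.
move=> ab acf x; apply/cvgrPdist_lt => e e0.
have [d d0 fd] := rabs_continuous1 acf e0.
near=> t.
have xt : `|x - t| < d by near: t; apply/nbhs_ballP; exists d.
have {}xt := le_lt_trans (clamp_dist x t ab) xt.
have /andP[ax xb] := clamp_itv x ab; have /andP[ta tb] := clamp_itv t ab.
rewrite /=; have [xlt|/ltW txl] := leP (clamp a b x) (clamp a b t).
  rewrite distrC; apply: fd => //.
  by rewrite (le_lt_trans _ xt)// distrC ler_norm.
by apply: fd => //; rewrite (le_lt_trans _ xt)// ler_norm.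
Unshelve. all: by end_near. Qed.

Lemma integrable_itv (h : R -> \bar R) (i : interval R) :
  leb.-integrable setT h -> leb.-integrable [set` i] h.
Proof. by move=> ih; apply: integrableS ih => //; exact: measurable_itv. Qed.

Lemma ae_le_Rintegral (D : set R) (h1 h2 : R -> R) :
  measurable (D : set (measurableTypeR R)) ->
  leb.-integrable D (EFin \o h1) -> leb.-integrable D (EFin \o h2) ->
  {ae leb, forall x, D x -> h1 x <= h2 x} ->
  \int[leb]_(x in D) h1 x <= \int[leb]_(x in D) h2 x.
Proof.
move=> mD ih1 ih2 h12; rewrite -subr_ge0 -RintegralB//.
have ih : leb.-integrable D (EFin \o (fun x => h2 x - h1 x)).
  rewrite (_ : EFin \o _ = (EFin \o h2) \- (EFin \o h1))%E; last by [].
  exact: integrableB.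
have mh : measurable_fun D (fun x => h2 x - h1 x).
  by apply/measurable_EFinP; case/integrableP : ih.
rewrite (_ : Rintegral _ _ _ = \int[leb]_(x in D) `|h2 x - h1 x|); last first.
  rewrite /Rintegral; congr fine; apply: ae_eq_integral => //.
  - exact/measurable_EFinP.
  - by apply/measurable_EFinP; exact: measurableT_comp.
  by apply: ae_sub h12 => x h Dx /=; rewrite ger0_norm// subr_ge0 h.
by apply: Rintegral_ge0.
Qed.

(** The Radon-Nikodym theorem for the Stieltjes measure of f, extended by constants
outside [a, b]. *)
Lemma nondecreasing_density a b f : a <= b -> rabs_continuous a b f ->
  (forall p q, a <= p -> p <= q -> q <= b -> f p <= f q) ->
  exists h : R -> R, leb.-integrable setT (EFin \o h) /\
    forall s t : R, a <= s -> s <= t -> t <= b ->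
      f t - f s = \int[leb]_(x in `]s, t]) h x.
Proof.
move=> ab acf ndf; pose F := f \o clamp a b.
have ndF : {homo F : x y / x <= y}.
  move=> x y xy; have /andP[ax xb] := clamp_itv x ab.
  have /andP[ay yb] := clamp_itv y ab.
  by apply: ndf => //; exact: clamp_le.
have rcF : right_continuous F by apply: right_continuousW; exact: rabs_continuous_clamp.
pose G : cumulative R R := HB.pack F (isCumulative.Build R _ R F ndF rcF).
have FE x : a <= x <= b -> F x = f x by move=> xab; rewrite /F/= clamp_id.
have acF : rabs_continuous a b G.
  apply: (rabs_continuous_dominated (K := 1) acf acf) => p q ap pq qb.
  have qab : a <= q <= b by rewrite (le_trans ap pq).
  have pab : a <= p <= b by rewrite ap (le_trans pq qb).
  by rewrite -[G q]/(F q) -[G p]/(F p) (FE _ qab) (FE _ pab) mul1r lerDl.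
pose D := `]a, b]%classic.
have mD : measurable (D : set (measurableTypeR R)) by exact: measurable_itv.
have GD : (lebesgue_stieltjes_measure G D < +oo)%E.
  by rewrite stieltjes_itv// ltry.
pose nu := mfrestr mD GD.
have nuleb : nu `<< leb.
  apply/null_content_dominatesP => A mA A0.
  exact: (rabs_continuous_null ab acF mA A0).
have [h [h0 hfin hint nuh]] := radon_nikodym_sigma_finite nuleb.
exists (fine \o h).
have hE : EFin \o (fine \o h) = h by apply/funext => x /=; rewrite fineK.
split; first by rewrite hE.
move=> s t a_s st tb.
rewrite /Rintegral; under eq_integral do rewrite [(fine _)%:E]fineK//.
rewrite -nuh; last exact: measurable_itv.
have stD : `]s, t]%classic `<=` D.
  move=> x; rewrite /D /mkset !in_itv/= => /andP[sx xt].
  by rewrite (le_lt_trans a_s sx) (le_trans xt tb).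
suff : f t - f s = fine (lebesgue_stieltjes_measure G (`]s, t]%classic `&` D)) by [].
rewrite (setIidl stD).
rewrite -(FE t) -?(FE s) ?a_s ?(le_trans a_s st) ?(le_trans st tb)//.
by rewrite (stieltjes_itv G st).
Qed.

Fixpoint partition_itvs (p : R) (s : seq R) : seq (R * R) :=
  if s is x :: s' then (p, x) :: partition_itvs x s' else [::].

Lemma partition_itvsP p q (t : seq R) : itv_partition p q t ->
  nonoverlapping p q (partition_itvs p t) /\ \sum_(r <- partition_itvs p t) (r.2 - r.1) = q - p.
Proof.
elim: t p => [|x t ih] p.
  by move=> /itv_partition_nil ->; rewrite big_nil subrr; split => //; split.
move=> pt; have xt := itv_partition_cons pt.
have px : p < x by move: pt => -[/= /andP[]].
have xq := itv_partition_le xt.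
have [[h1 h2] h3] := ih _ xt; split; last by rewrite /= big_cons h3/=; lra.
split => [r|/=].
  rewrite inE => /predU1P[->/=|/h1[xr rr]]; first by rewrite lexx ltW.
  by rewrite (le_trans (ltW px) xr).
by rewrite h2 andbT; apply/allP => r /h1[].
Qed.

Lemma variation_itvs p q f (t : seq R) : itv_partition p q t ->
  variation p q f t = \sum_(r <- partition_itvs p t) `|f r.2 - f r.1|.
Proof.
move=> pt; rewrite variation_zip//; elim: t p {pt} => [|x t ih] p.
  by rewrite !big_nil.
by rewrite /= !big_cons ih.
Qed.

Lemma nonoverlapping_cat a b s1 (p : R * R) s2 s :
  nonoverlapping a b (s1 ++ p :: s2) -> nonoverlapping p.1 p.2 s ->
  nonoverlapping a b ((s1 ++ s) ++ s2).
Proof.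
move=> [h1]; rewrite pairwise_cat/= allrel_consr => /andP[/andP[s1p s12]].
move=> /andP[ps1 /andP[ps2 pps2]] [k1 k2].
have [ap [pp pb]] : a <= p.1 /\ p.1 <= p.2 /\ p.2 <= b.
  by apply: h1; rewrite mem_cat inE eqxx orbT.
split.
  move=> r; rewrite !mem_cat -orbA => /or3P[rs1|/k1[pr [rr rp]]|rs2].
  - by apply: h1; rewrite mem_cat rs1.
  - by split; [exact: le_trans pr|split => //; exact: le_trans pb].
  - by apply: h1; rewrite mem_cat inE rs2 !orbT.
rewrite !pairwise_cat ps1 pps2 k2 andbT/= allrel_catl s12/= !andbT.
apply/andP; split.
  apply/allrelP => r r' /k1[pr [rr rp]] r's2; apply: le_trans rp _.
  by have /allP/(_ _ r's2) := ps2.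
apply/allrelP => r r' rs1 /k1[pr [rr rp]]; apply: le_trans pr.
by have /allP/(_ _ rs1) := s1p.
Qed.

(** On an interval shorter than the d associated with e = 1 the variation is at most 1,
and finitely many such intervals cover [a, b]. *)
Lemma rabs_continuous_bounded_variation a b f : a <= b ->
  rabs_continuous a b f -> total_variation a b f \is a fin_num.
Proof.
move=> ab acf; have [d d0 fd] := acf 1 ltr01.
have small p q : a <= p -> p <= q -> q <= b -> q - p < d ->
    total_variation p q f \is a fin_num.
  move=> ap pq qb pqd; rewrite ge0_fin_numE ?total_variation_ge0//.
  apply: (@le_lt_trans _ _ 1%E); last by rewrite ltry.
  apply: ge_ereal_sup => _ [_ [t pt <-] <-]; rewrite lee_fin variation_itvs//.
  have [[h1 h2] h3] := partition_itvsP pt.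
  apply/ltW/fd; last by rewrite h3.
  split=> // r /h1[pr [rr rq]].
  by rewrite (le_trans ap pr) (le_trans rq qb).
suff H n t : a <= t -> t <= b -> t - a <= n%:R * (d / 2) ->
    total_variation a t f \is a fin_num.
  apply: (H (Num.bound ((b - a) / (d / 2)))) => //.
  rewrite -ler_pdivrMr ?divr_gt0//; apply/ltW/archi_boundP.
  by rewrite divr_ge0 ?subr_ge0// divr_ge0// ltW.
elim: n t => [|n ih] t a_t tb.
  rewrite mul0r subr_le0 => ta; have -> : t = a by apply/eqP; rewrite eq_le ta.
  by rewrite total_variationxx.
move=> tan; pose u := Num.max a (t - d / 2).
have au : a <= u by rewrite /u le_max lexx.
have ut : u <= t by rewrite /u ge_max a_t/=; lra.
rewrite (total_variationD _ au ut) fin_numD ih//=; last 2 first.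
  exact: le_trans tb.
  rewrite /u; case: (leP a (t - d / 2)) => _; last by rewrite subrr mulr_ge0// ltW// divr_gt0.
  by move: tan; rewrite -natr1 mulrDl mul1r; lra.
apply: small => //; rewrite /u; case: (leP a (t - d / 2)); lra.
Qed.

(** The intervals of a family are replaced one after the other by partitions on which
the increments of f add up to nearly its variation. The total length is unchanged, so
that absolute continuity of f applies to the refined family. *)
Lemma rabs_continuous_total_variation a b f : a <= b ->
  rabs_continuous a b f ->
  rabs_continuous a b (fun t => fine (total_variation a t f)).
Proof.
move=> ab acf.
have fin p q : a <= p -> p <= q -> q <= b -> total_variation p q f \is a fin_num.
  move=> ap pq qb; apply: rabs_continuous_bounded_variation => //.
  exact: rabs_continuousS acf.
pose V p q := fine (total_variation p q f).
move=> e e0; have [|d d0 fd] := acf (e / 2); first by rewrite divr_gt0.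
suff H s2 s1 : nonoverlapping a b (s1 ++ s2) ->
    \sum_(p <- s1 ++ s2) (p.2 - p.1) < d ->
    \sum_(p <- s1) `|f p.2 - f p.1| + \sum_(p <- s2) V p.1 p.2 <= e / 2.
  exists d => // s nos sd; apply: (@le_lt_trans _ _ (e / 2)); last by lra.
  have := H s [::] nos sd; rewrite big_nil add0r; apply: le_trans.
  rewrite big_seq [leRHS]big_seq; apply: ler_sum => p /(nos.1)[ap [pp pb]].
  rewrite (total_variationD _ ap pp) fineD ?fin//; last by rewrite (le_trans pp).
  by rewrite addrC addKr ger0_norm// fine_ge0// total_variation_ge0.
elim: s2 s1 => [|p s2 ih] s1.
  by rewrite cats0 big_nil addr0 => nos sd; exact/ltW/fd.
move=> nos sd.
have [ap [pp pb]] : a <= p.1 /\ p.1 <= p.2 /\ p.2 <= b.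
  by apply: nos.1; rewrite mem_cat inE eqxx orbT.
rewrite big_cons addrCA -lerBrDr -lee_fin fineK ?fin//.
apply: ge_ereal_sup => _ [_ [t pt <-] <-]; rewrite lee_fin variation_itvs//.
have [nop sp] := partition_itvsP pt.
rewrite lerBrDr addrA [_ + \sum_(_ <- s1) _]addrC -big_cat; apply: ih.
  exact: nonoverlapping_cat nos nop.
by move: sd; rewrite !big_cat big_cons/= sp addrA.
Qed.

(** Jordan decomposition: f is the difference of its variation function and of a
nondecreasing function, and both are absolutely continuous. *)
Lemma rabs_continuous_density a b f : a <= b -> rabs_continuous a b f ->
  exists h : R -> R, leb.-integrable setT (EFin \o h) /\
    forall s t : R, a <= s -> s <= t -> t <= b ->
      f t - f s = \int[leb]_(x in `]s, t]) h x.
Proof.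
move=> ab acf; pose V t := fine (total_variation a t f).
have acV : rabs_continuous a b V by exact: rabs_continuous_total_variation.
have fin p q : a <= p -> p <= q -> q <= b -> total_variation p q f \is a fin_num.
  move=> ap pq qb; apply: rabs_continuous_bounded_variation => //.
  exact: rabs_continuousS acf.
have Vf p q : a <= p -> p <= q -> q <= b -> `|f q - f p| <= V q - V p.
  move=> ap pq qb; rewrite /V (total_variationD _ ap pq).
  rewrite fineD ?fin//; last by rewrite (le_trans pq).
  by rewrite addrAC subrr add0r -lee_fin fineK ?fin// total_variation_ge.
have [h1 [ih1 h1E]] := nondecreasing_density ab acV
  (fun p q ap pq qb => eq_ind _ is_true (le_trans (normr_ge0 _) (Vf p q ap pq qb)) _ (subr_ge0 _ _)).
have acW : rabs_continuous a b (V \- f).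
  apply: (rabs_continuous_dominated (K := 1) acV acf) => p q _ _ _.
  have -> : (V \- f) q - (V \- f) p = (V q - V p) - (f q - f p).
    by rewrite /=; move: (V q) (V p) (f q) (f p) => *; ring.
  by rewrite mul1r; exact: ler_normB.
have [|h2 [ih2 h2E]] := nondecreasing_density ab acW.
  move=> p q ap pq qb; rewrite -subr_ge0/=.
  by have := Vf _ _ ap pq qb; have := ler_norm (f q - f p); lra.
exists (fun x => h1 x - h2 x); split.
  rewrite (_ : EFin \o _ = (EFin \o h1) \- (EFin \o h2))%E; last by [].
  exact: integrableB.
move=> s t a_s st tb; rewrite RintegralB//; last 2 first.
  exact: integrable_itv ih1.
  exact: integrable_itv ih2.
by rewrite -h1E// -h2E//=; ring.
Qed.

(** Lebesgue's fundamental theorem of calculus: by Lebesgue's differentiation theorem,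
the Radon-Nikodym density is almost everywhere the derivative. *)
Theorem rabs_continuous_FTC a b f : a <= b -> rabs_continuous a b f ->
  exists h : R -> R, [/\ leb.-integrable setT (EFin \o h),
    forall s t : R, a <= s -> s <= t -> t <= b ->
      f t - f s = \int[leb]_(x in `]s, t]) h x &
    {ae leb, forall t : R, a < t < b -> derivable f t 1 /\ derive1 f t = h t}].
Proof.
move=> ab /(rabs_continuous_density ab)[h [ih hE]]; exists h; split=> //.
have loch : locally_integrable setT h.
  split; first by apply/measurable_EFinP; case/integrableP : ih.
    exact: openT.
  move=> K _ cK; have /integrableP[_] : leb.-integrable K (EFin \o h).
    by apply: integrableS ih => //; exact: compact_measurable.
  by [].
have hy y : leb.-integrable `]a, y] (EFin \o h).
  exact: integrable_itv ih.
have := FTC1 (a := BRight a) hy loch.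
apply: ae_sub => t H atb; have /andP[at_ tb] := atb.
have [|dt et] := H; first by rewrite lte_fin.
have nf : \forall s \near t, f a + \int[leb]_(x in `]a, s]) h x = f s.
  near=> s; have /andP[as_ sb] : a < s < b by near: s; exact: near_itvoo.
  by rewrite -hE ?subrKC// ltW.
have dG : is_derive t (1 : R) (fun u => f a + \int[leb]_(x in `]a, u]) h x) (h t).
  rewrite -[h t]add0r; apply: is_deriveD.
  by apply: DeriveDef; [exact: dt|rewrite -derive1E; exact: et].
split.
  have := @ex_derive _ _ _ _ _ _ _ dG; apply: near_eq_derivable.
  exact: nf.
by rewrite derive1E -(near_eq_derive _ nf) derive_val.
Unshelve. all: by end_near. Qed.

(** Increments of a function are controlled by its derivative: this is false without
absolute continuity (Cantor's function). *)
Corollary rabs_continuous_nondecreasing a b f : a <= b -> rabs_continuous a b f ->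
  {ae leb, forall t : R, a < t < b -> derivable f t 1 -> 0 <= derive1 f t} ->
  f a <= f b.
Proof.
move=> ab acf f'0; have [h [ih hE hd]] := rabs_continuous_FTC ab acf.
rewrite -subr_ge0 (hE a b)//.
have ihab : leb.-integrable `]a, b[ (EFin \o h) by exact: integrable_itv.
rewrite -Rintegral_itv_bndo_bndc//.
have -> : 0 = \int[leb]_(x in `]a, b[) (fun=> 0 : R) x.
  by rewrite Rintegral_cst ?mul0r.
apply: ae_le_Rintegral => //.
  by rewrite (_ : _ \o _ = cst 0%E)//; exact: integrable0.
apply: ae_sub (ae_and hd f'0) => t [+ +]; rewrite /mkset in_itv/= => H1 H2 atb.
by have [dt <-] := H1 atb; exact: H2.
Qed.

Lemma rabs_continuousN a b f : rabs_continuous a b f -> rabs_continuous a b (\- f).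
Proof.
move=> acf; apply: (rabs_continuous_dominated (K := 1) acf acf) => p q _ _ _ /=.
by rewrite -opprD normrN mul1r lerDl.
Qed.

Lemma rabs_continuousD a b f g : rabs_continuous a b f -> rabs_continuous a b g ->
  rabs_continuous a b (f \+ g).
Proof.
move=> acf acg; apply: (rabs_continuous_dominated (K := 1) acf acg) => p q _ _ _ /=.
by rewrite opprD addrACA mul1r ler_normD.
Qed.

Lemma rabs_continuousM (M a b : R) f g :
  (forall t, a <= t <= b -> `|f t| <= M /\ `|g t| <= M) ->
  rabs_continuous a b f -> rabs_continuous a b g ->
  rabs_continuous a b (f \* g).
Proof.
move=> fgM acf acg.
apply: (rabs_continuous_dominated (K := M) acf acg) => p q ap pq qb /=.
have [|_ gq] := fgM q; first by rewrite (le_trans ap pq).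
have [|fp _] := fgM p; first by rewrite ap (le_trans pq qb).
rewrite (_ : _ - _ = (f q - f p) * g q + f p * (g q - g p)); last by ring.
rewrite (le_trans (ler_normD _ _))// !normrM mulrDr; apply: lerD.
  by rewrite mulrC ler_wpM2r.
by rewrite ler_wpM2r.
Qed.

Lemma rabs_continuous_expR (c a b : R) :
  rabs_continuous a b (fun t => expR (c * t)).
Proof.
have key p q : a <= p -> p <= q -> q <= b ->
    `|expR (c * q) - expR (c * p)| <= expR (`|c| * (`|a| + `|b|)) * (`|c| * (q - p)).
  move=> ap pq qb.
  have pM : `|p| <= `|a| + `|b|.
    by rewrite ler_norml; case: (ler0P a); case: (ler0P b); lra.
  have qM : `|q| <= `|a| + `|b|.
    by rewrite ler_norml; case: (ler0P a); case: (ler0P b); lra.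
  have lip u v : u <= v -> `|expR v - expR u| <= expR v * (v - u).
    move=> uv; rewrite ger0_norm ?subr_ge0 ?ler_expR//.
    have -> : expR v - expR u = expR v * (1 - expR (u - v)).
      by rewrite mulrBr mulr1 -expRD subrKC.
    rewrite ler_wpM2l ?expR_ge0//.
    by have := expR_ge1Dx (u - v); lra.
  have cM w : `|w| <= `|a| + `|b| -> expR (c * w) <= expR (`|c| * (`|a| + `|b|)).
    by move=> wM; rewrite ler_expR (le_trans (ler_norm _))// normrM ler_wpM2l.
  have [c0|c0] := ler0P c.
    rewrite distrC; apply: (le_trans (lip _ (c * q) (c * p) _)); first by rewrite ler_wnM2l.
    rewrite (_ : c * p - c * q = - c * (q - p)); last by ring.
    apply: ler_pM; rewrite ?expR_ge0 ?mulr_ge0 ?subr_ge0 ?oppr_ge0//.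
    by have := cM _ pM; rewrite ler0_norm.
  apply: (le_trans (lip _ (c * p) (c * q) _)); first by rewrite ler_wpM2l// ltW.
  rewrite -mulrBr; apply: ler_pM; rewrite ?expR_ge0 ?mulr_ge0 ?subr_ge0 ?(ltW c0)//.
  by have := cM _ qM; rewrite gtr0_norm.
apply: (@rabs_continuous_lipschitz (expR (`|c| * (`|a| + `|b|)) * `|c|)) => p q ap pq qb.
by rewrite -mulrA key.
Qed.

Lemma is_derive_expRM (c t : R) :
  is_derive t (1 : R) (fun u : R => expR (c * u)) (c * expR (c * t)).
Proof. by apply: is_derive_eq; rewrite /GRing.scale/= mulr1; ring. Qed.

(** The product of u and of exp (- c t) has a nonpositive derivative almost everywhere;
M bounds u, so that this product is absolutely continuous. *)
Lemma gronwall (M c a b : R) u : a <= b -> rabs_continuous a b u ->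
  (forall t, a <= t <= b -> `|u t| <= M) ->
  {ae leb, forall t : R, a < t < b -> derivable u t 1 -> derive1 u t <= c * u t} ->
  u b * expR (- c * b) <= u a * expR (- c * a).
Proof.
move=> ab acu uM u'.
pose E t : R := expR (- c * t).
have acE : rabs_continuous a b E by exact: rabs_continuous_expR.
pose B := expR (`|c| * (`|a| + `|b|)).
have EM t : a <= t <= b -> `|E t| <= B.
  move=> /andP[at_ tb]; rewrite ger0_norm ?expR_ge0// ler_expR.
  rewrite (le_trans (ler_norm _))// normrM normrN ler_wpM2l//.
  by rewrite ler_norml; case: (ler0P a); case: (ler0P b); lra.
have M0 : 0 <= M by apply: le_trans (uM a _); rewrite ?lexx.
have B0 : 0 <= B by exact: expR_ge0.
have acuE : rabs_continuous a b (u \* E).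
  apply: (@rabs_continuousM (M + B)) => // t tab.
  by split; [apply: (le_trans (uM t tab))|apply: (le_trans (EM t tab))]; lra.
rewrite -lerN2.
apply: (rabs_continuous_nondecreasing ab (rabs_continuousN acuE)).
have [h [_ _ hd]] := rabs_continuous_FTC ab acu.
apply: ae_sub (ae_and u' hd) => t [H1 H2] atb _.
have [du _] := H2 atb.
have dE : is_derive t (1 : R) E (- c * E t) by exact: is_derive_expRM.
have := @is_deriveM _ _ u E t 1 _ _ (derivableP du) dE.
move=> dM; rewrite derive1E derive_val.
rewrite -derive1E /GRing.scale/=.
have := H1 atb du; have := expR_ge0 (- c * t); rewrite -/(E t); nra.
Qed.

(** The Lagrangian along a path need not be a measurable function of time. The integral
of a nonnegative function, which is the supremum of the integrals of the simple functions
below it, is nevertheless monotone, and can be compared with those of measurable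
functions. *)
Lemma nonmeasurable_le_integral (D : set R) (f g : R -> \bar R) :
  (forall x, D x -> 0 <= f x)%E -> (forall x, D x -> f x <= g x)%E ->
  (\int[leb]_(x in D) f x <= \int[leb]_(x in D) g x)%E.
Proof.
move=> f0 fg.
have g0 x : D x -> (0 <= g x)%E by move=> Dx; exact: le_trans (f0 _ Dx) (fg _ Dx).
rewrite !ge0_integralE//; apply: le_ereal_sup => _ [h hf <-].
exists h => // x; apply: (le_trans (hf x)); rewrite /patch.
by case: ifPn => // /set_mem; exact: fg.
Qed.

Lemma nonmeasurable_le_integral_subset (A D : set R) (f : R -> \bar R) :
  A `<=` D -> (forall x, D x -> 0 <= f x)%E ->
  (\int[leb]_(x in A) f x <= \int[leb]_(x in D) f x)%E.
Proof.
move=> AD f0; rewrite integral_mkcond [leRHS]integral_mkcond.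
apply: nonmeasurable_le_integral => x _.
  by rewrite patchE; case: ifPn => // /set_mem/AD; exact: f0.
rewrite !patchE; case: ifPn => [/set_mem/AD Dx|_]; first by rewrite mem_set.
by case: ifPn => // /set_mem; exact: f0.
Qed.

Lemma Rintegral_le_nonmeasurable (A D : set R) (h : R -> R) (f : R -> \bar R) :
  measurable (A : set (measurableTypeR R)) -> A `<=` D ->
  (forall x, D x -> 0 <= f x)%E -> leb.-integrable A (EFin \o h) ->
  {ae leb, forall x, A x -> (h x)%:E <= f x}%E ->
  ((\int[leb]_(x in A) h x)%:E <= \int[leb]_(x in D) f x)%E.
Proof.
move=> mA AD f0 ih [N [mN N0 hN]].
apply: le_trans (nonmeasurable_le_integral_subset AD f0).
have f0A x : A x -> (0 <= f x)%E by move=> /AD; exact: f0.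
have mh : measurable_fun A h by apply/measurable_EFinP; case/integrableP : ih.
have mNc : measurable (~` N) by exact: measurableC.
(* The positive part of h, made zero on the exceptional set, is below f everywhere. *)
pose k (x : R) : R := Num.max (h x) 0 * \1_(~` N) x.
have k0 x : 0 <= k x by rewrite /k mulr_ge0// le_max lexx orbT.
have mk : measurable_fun A (EFin \o k).
  apply/measurable_EFinP; apply: measurable_funM.
    exact: measurable_maxr.
  by apply: measurable_funTS.
apply: (@le_trans _ _ (\int[leb]_(x in A) (k x)%:E)%E); last first.
  apply: nonmeasurable_le_integral => x Ax; first by rewrite lee_fin.
  rewrite /k indicE; case: (pselect (N x)) => Nx.
    by rewrite memNset ?mulr0; [exact: f0A|apply].
  rewrite mem_set// mulr1 EFin_max ge_max f0A// andbT.
  by apply: contrapT => hf; apply: Nx; apply: hN => /= H; apply: hf; exact: H.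
have ik : leb.-integrable A (EFin \o k).
  apply: (le_integrable mA mk _ ih) => //= x Ax; rewrite lee_fin /k normrM.
  rewrite (ger0_norm (_ : 0 <= \1_(~` N) x)); last by rewrite indicE.
  rewrite ger0_norm ?le_max ?lexx ?orbT// indicE.
  have : Num.max (h x) 0 <= `|h x| by rewrite ge_max ler_norm normr_ge0.
  by case: (_ \in _); rewrite ?mulr1// mulr0 normr_ge0.
rewrite -[leRHS]fineK ?lee_fin; last exact: integrable_fin_num.
apply: ae_le_Rintegral => //; exists N; split => // x Hx.
apply: contrapT => Nx; apply: Hx => Ax; rewrite /k indicE mem_set// mulr1.
by rewrite le_max lexx.
Qed.

Import HBNNSimple.

Lemma nonmeasurable_le_Rintegral (D : set R) (h : R -> R) (f : R -> \bar R) :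
  measurable (D : set (measurableTypeR R)) ->
  (forall x, D x -> 0 <= f x)%E -> leb.-integrable D (EFin \o h) ->
  {ae leb, forall x, D x -> f x <= (h x)%:E}%E ->
  (\int[leb]_(x in D) f x <= (\int[leb]_(x in D) h x)%:E)%E.
Proof.
move=> mD f0 ih fh; rewrite ge0_integralE//.
apply: ge_ereal_sup => _ [s hs <-].
have mh : measurable_fun D h by apply/measurable_EFinP; case/integrableP : ih.
rewrite /Rintegral fineK; last exact: integrable_fin_num.
rewrite -integralT_nnsfun.
rewrite (_ : (\int[leb]_x (s x)%:E)%E = (\int[leb]_(x in D) (s x)%:E)%E); last first.
  rewrite [RHS]integral_mkcond; apply: eq_integral => x _; rewrite patchE.
  case: ifPn => // xD; have := hs x; rewrite patchE (negbTE xD) lee_fin => sx0.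
  by congr EFin; apply/eqP; rewrite eq_le sx0 /=.
have -> : (\int[leb]_(x in D) (h x)%:E = \int[leb]_(x in D) `|h x|%:E)%E.
  apply: ae_eq_integral => //; first exact/measurable_EFinP.
    by apply/measurable_EFinP; exact: measurableT_comp.
  apply: ae_sub fh => x fhx Dx; rewrite /= ger0_norm// -lee_fin.
  exact: le_trans (f0 _ Dx) (fhx Dx).
apply: ae_ge0_le_integral => //.
- by move=> x _; rewrite lee_fin.
- by apply/measurable_EFinP; exact: measurable_funTS.
- by apply/measurable_EFinP; exact: measurableT_comp.
apply: ae_sub fh => x fhx Dx; rewrite lee_fin (le_trans _ (ler_norm _))// -lee_fin.
by apply: le_trans (fhx Dx); have := hs x; rewrite patchE mem_set.
Qed.

End RealAbsoluteContinuity.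

(** * Perron root, Hamiltonian and Lagrangian *)

Section TwoPoints.
Context {R : realType}.

Lemma sum_I2 (V : nmodType) (F : 'I_2 -> V) : \sum_i F i = F 0 + F 1.
Proof.
rewrite !big_ord_recl big_ord0 addr0; congr (F _ + F _); exact/val_inj.
Qed.

Lemma I2P (i : 'I_2) : i = 0 \/ i = 1.
Proof. by case: i => -[|[|//]] h; [left|right]; exact/val_inj. Qed.

Lemma dotpE (u v : 'rV[R]_2) : dotp u v = u 0 0 * v 0 0 + u 0 1 * v 0 1.
Proof. by rewrite /dotp sum_I2. Qed.

(** The larger root of the characteristic polynomial of the matrix with rows
((1 - p) q0, p q0) and (r q1, (1 - r) q1). *)
Definition perron_root (p r q0 q1 : R) : R :=
  let a := (1 - p) * q0 in let d := (1 - r) * q1 in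
  (a + d + Num.sqrt ((a - d) ^+ 2 + 4 * (p * q0 * (r * q1)))) / 2.

Lemma perron_rootP (p r q0 q1 : R) : 0 < p -> 0 < r -> 0 < q0 -> 0 < q1 ->
  let x := perron_root p r q0 q1 in
  [/\ (1 - p) * q0 < x, (1 - r) * q1 < x &
    (x - (1 - p) * q0) * (x - (1 - r) * q1) = p * q0 * (r * q1)].
Proof.
move=> p0 r0 q00 q10 x.
set a := (1 - p) * q0 in x *; set d := (1 - r) * q1 in x *.
set bc := p * q0 * (r * q1) in x *.
have bc0 : 0 < bc by rewrite /bc !mulr_gt0.
pose s := Num.sqrt ((a - d) ^+ 2 + 4 * bc).
have s2 : s ^+ 2 = (a - d) ^+ 2 + 4 * bc.
  by rewrite sqr_sqrtr// addr_ge0 ?sqr_ge0// mulr_ge0// ltW.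
have xE : x = (a + d + s) / 2 by [].
have s0 : 0 <= s by exact: sqrtr_ge0.
have sad : `|a - d| < s.
  rewrite -(@ltr_pXn2r _ 2)// ?nnegrE// s2 -normrX ger0_norm ?sqr_ge0//.
  by rewrite ltrDl mulr_gt0.
move: sad; rewrite ltr_norml => /andP[h1 h2].
split; [rewrite xE; lra|rewrite xE; lra|].
have -> : (x - a) * (x - d) = (s ^+ 2 - (a - d) ^+ 2) / 4 by rewrite xE; field.
by rewrite s2; field.
Qed.

(** To the right of the diagonal entries the characteristic polynomial is increasing. *)
Lemma perron_root_le (p r q0 q1 y : R) : 0 < p -> 0 < r -> 0 < q0 -> 0 < q1 ->
  (1 - p) * q0 <= y -> (1 - r) * q1 <= y ->
  p * q0 * (r * q1) <= (y - (1 - p) * q0) * (y - (1 - r) * q1) ->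
  perron_root p r q0 q1 <= y.
Proof.
move=> p0 r0 q00 q10 ay dy bcy; have [/=] := perron_rootP p0 r0 q00 q10.
move: (perron_root _ _ _ _) => x ax dx xE; rewrite leNgt; apply/negP => yx.
move: bcy; rewrite -xE leNgt => /negP; apply.
move: ((1 - p) * q0) ((1 - r) * q1) ay dy ax dx => a d; nra.
Qed.

(** The other eigenvalue is A 0 0 + A 1 1 - r, which lies between - r and r. *)
Lemma perron_frobeniusE (A : 'M[R]_2) (r : R) :
  (forall i j, 0 <= A i j) -> 0 < A 1 0 -> A 0 0 <= r -> A 1 1 <= r ->
  (r - A 0 0) * (r - A 1 1) = A 0 1 * A 1 0 -> perron_frobenius A = r.
Proof.
move=> A0 c0 ar dr re.
have eigE (F : fieldType) (B : 'M[F]_2) z : eigenvalue B z ->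
    (z - B 0 0) * (z - B 1 1) = B 0 1 * B 1 0.
  move=> /eigenvalueP[v vB v0].
  have e0 : v 0 0 * (z - B 0 0) = v 0 1 * B 1 0.
    have := congr1 (fun w : 'rV_2 => w 0 0) vB; rewrite !mxE sum_I2 => h.
    by rewrite mulrBr (mulrC _ z) -h addrAC subrr add0r.
  have e1 : v 0 1 * (z - B 1 1) = v 0 0 * B 0 1.
    have := congr1 (fun w : 'rV_2 => w 0 1) vB; rewrite !mxE sum_I2 => h.
    by rewrite mulrBr (mulrC _ z) -h addrK.
  have [v00|v00] := eqVneq (v 0 0) 0; last first.
    apply: (mulfI v00); rewrite mulrA e0 -mulrA [B 1 0 * _]mulrC mulrA e1; ring.
  have [v01|v01] := eqVneq (v 0 1) 0; last first.
    apply: (mulfI v01); rewrite mulrCA e1 mulrCA mulrA e0; ring.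
  case/eqP: v0; apply/rowP => i; rewrite mxE.
  by have [->|->] := I2P i.
have eigr : eigenvalue A r.
  apply/eigenvalueP; exists (\row_i if i == 0 then A 1 0 else r - A 0 0).
    apply/rowP => i; rewrite !mxE sum_I2 !mxE/=.
    have [->|->] := I2P i; rewrite /=; first by ring.
    by rewrite [A 1 0 * _]mulrC -re; ring.
  apply/eqP => /rowP/(_ 0); rewrite !mxE/= => h.
  by rewrite h ltxx in c0.
have domr (z : R[i]) : eigenvalue (map_mx (real_complex R) A) z ->
    `|z| <= real_complex R r.
  move=> /eigE; rewrite !mxE => h.
  have normrC (y : R) : `|real_complex R y| = real_complex R `|y|.
    by rewrite normc_def/= expr0n addr0 sqrtr_sqr.
  have : (z - real_complex R r) * (z - real_complex R (A 0 0 + A 1 1 - r)) = 0.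
    transitivity ((z - real_complex R (A 0 0)) * (z - real_complex R (A 1 1)) -
        real_complex R ((r - A 0 0) * (r - A 1 1))).
      by rewrite rmorphM !(rmorphB, rmorphD)/=; ring.
    by rewrite h re rmorphM subrr.
  have r0 : 0 <= r by exact: le_trans (A0 0 0) ar.
  move/eqP; rewrite mulf_eq0 !subr_eq0 => /orP[]/eqP ->; rewrite normrC lecR.
    by rewrite ger0_norm.
  by have := A0 0 0; have := A0 1 1; rewrite ler_norml; lra.
rewrite /perron_frobenius; apply: xget_subset1; first by split.
move=> x y [ex dx] [ey dy].
have norm_le (u v : R) : `|real_complex R u| <= real_complex R v -> `|u| <= v.
  by rewrite normc_def/= expr0n addr0 sqrtr_sqr lecR.
have xy : `|x| <= y by apply/norm_le/dy; rewrite eigenvalue_map.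
have yx : `|y| <= x by apply/norm_le/dx; rewrite eigenvalue_map.
apply/eqP; rewrite eq_le (le_trans (ler_norm _) xy).
by rewrite (le_trans (ler_norm _) yx).
Qed.

Lemma ln_le_subr1 (y : R) : 0 < y -> ln y <= y - 1.
Proof.
by move=> y0; have := expR_ge1Dx (ln y); rewrite lnK ?posrE//; lra.
Qed.

Lemma ln_concave (w u v : R) : 0 <= w <= 1 -> 0 < u -> 0 < v ->
  w * ln u + (1 - w) * ln v <= ln (w * u + (1 - w) * v).
Proof.
move=> /andP[w0 w1] u0 v0; set m := w * u + (1 - w) * v.
have m0 : 0 < m by rewrite /m; case: (leP u v) => uv; nra.
have lnq y : 0 < y -> ln y - ln m <= y / m - 1.
  by move=> y0; rewrite -ln_div ?posrE// ln_le_subr1// divr_gt0.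
have hu := lnq _ u0; have hv := lnq _ v0.
have mE : w * (u / m - 1) + (1 - w) * (v / m - 1) = 0.
  rewrite (_ : _ + _ = m / m - 1); last by rewrite /m; ring.
  by rewrite divff ?subrr// gt_eqF.
nra.
Qed.

(** The two equations of the eigenvector (h0, h1), to which concavity of the logarithm
is applied, are averaged with respect to the invariant probability (r, p) / (p + r): the
logarithms of h0 and h1 cancel. *)
Lemma ln_perron_root_ge (p r q0 q1 : R) : 0 < p <= 1 -> 0 < r <= 1 ->
  0 < q0 -> 0 < q1 ->
  (r * ln q0 + p * ln q1) / (p + r) <= ln (perron_root p r q0 q1).
Proof.
move=> /andP[p0 p1] /andP[r0 r1] q00 q10.
have [/=] := perron_rootP p0 r0 q00 q10.
move: (perron_root _ _ _ _) => x ax dx xE.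
have x0 : 0 < x by apply: le_lt_trans ax; rewrite mulr_ge0 ?subr_ge0// ltW.
set h0 := p * q0; set h1 := x - (1 - p) * q0.
have h00 : 0 < h0 by rewrite mulr_gt0.
have h10 : 0 < h1 by rewrite subr_gt0.
have e0 : q0 * ((1 - p) * h0 + (1 - (1 - p)) * h1) = x * h0 by rewrite /h0 /h1; ring.
have e1 : q1 * (r * h0 + (1 - r) * h1) = x * h1.
  have : h1 * (x - (1 - r) * q1) = h0 * (r * q1) by [].
  have -> : x * h1 = h1 * (x - (1 - r) * q1) + (1 - r) * q1 * h1 by ring.
  by move=> ->; ring.
have m0 : 0 < (1 - p) * h0 + (1 - (1 - p)) * h1 by nra.
have m1 : 0 < r * h0 + (1 - r) * h1 by nra.
clearbody h0 h1.
have := congr1 (@ln R) e0; have := congr1 (@ln R) e1.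
rewrite !lnM ?posrE// => l1 l0.
have c0 := @ln_concave (1 - p) h0 h1 _ h00 h10.
have c1 := @ln_concave r h0 h1 _ h00 h10.
have {}c0 : (1 - p) * ln h0 + (1 - (1 - p)) * ln h1 <= ln ((1 - p) * h0 + (1 - (1 - p)) * h1).
  by apply: c0; lra.
have {}c1 : r * ln h0 + (1 - r) * ln h1 <= ln (r * h0 + (1 - r) * h1).
  by apply: c1; lra.
rewrite ler_pdivrMr ?addr_gt0//.
move: l0 l1 c0 c1; move: (ln x) (ln h0) (ln h1) (ln q0) (ln q1) (ln ((1 - p) * h0 + (1 - (1 - p)) * h1))
  (ln (r * h0 + (1 - r) * h1)).
move=> X a b k0 k1 L0 L1 l0 l1 c0 c1.
have : r * (k0 + (1 - p) * a + p * b) <= r * (X + a) by rewrite ler_wpM2l//; lra.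
have : p * (k1 + r * a + (1 - r) * b) <= p * (X + b) by rewrite ler_wpM2l//; lra.
lra.
Qed.

(** At e = 0 the matrix is stochastic. The first order term is the mean of the w's with
respect to the invariant probability. *)
Lemma ln_perron_root_le (p r w0 w1 e : R) : 0 < p <= 1 -> 0 < r <= 1 ->
  0 < w0 < 1 -> 0 < w1 < 1 -> `|e| <= Num.min p r / 4 ->
  ln (perron_root p r (1 + w0 * e) (1 + w1 * e)) <=
    (r * w0 + p * w1) / (p + r) * e + 4 / (p + r) * e ^+ 2.
Proof.
move=> /andP[p0 p1] /andP[r0 r1] /andP[w00 w01] /andP[w10 w11].
have S0 : 0 < p + r by rewrite addr_gt0.
rewrite ler_norml; set m := Num.min p r => /andP[em me].
have mp : m <= p by rewrite ge_min lexx.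
have mr : m <= r by rewrite ge_min lexx orbT.
set k := (r * w0 + p * w1) / (p + r); set C := 4 / (p + r).
have kS : k * (p + r) = r * w0 + p * w1 by rewrite mulfVK// gt_eqF.
have CS : C * (p + r) = 4 by rewrite mulfVK// gt_eqF.
have C0 : 0 < C by rewrite divr_gt0.
have q00 : 0 < 1 + w0 * e by nra.
have q10 : 0 < 1 + w1 * e by nra.
have k0 : 0 < k by rewrite divr_gt0// addr_gt0// mulr_gt0.
have k1 : k < 1.
  by rewrite ltr_pdivrMr// mul1r; nra.
have [/=] := perron_rootP p0 r0 q00 q10.
move=> ax _ _.
apply: (@le_trans _ _ (perron_root p r (1 + w0 * e) (1 + w1 * e) - 1)).
  apply: ln_le_subr1; apply: le_lt_trans ax.
  by rewrite mulr_ge0 ?subr_ge0// ltW.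
rewrite lerBlDr [leRHS]addrC.
have e2 : 0 <= e ^+ 2 by exact: sqr_ge0.
have Ce2 : 0 <= C * e ^+ 2 by rewrite mulr_ge0// ltW.
pose A := k - (1 - p) * w0; pose B := k - (1 - r) * w1.
have A1 : -1 <= A <= 1 by rewrite /A; apply/andP; split; nra.
have B1 : -1 <= B <= 1 by rewrite /B; apply/andP; split; nra.
have aE : 1 + (k * e + C * e ^+ 2) - (1 - p) * (1 + w0 * e) = p + A * e + C * e ^+ 2.
  by rewrite /A; ring.
have dE : 1 + (k * e + C * e ^+ 2) - (1 - r) * (1 + w1 * e) = r + B * e + C * e ^+ 2.
  by rewrite /B; ring.
have /andP[A1l A1r] := A1; have /andP[B1l B1r] := B1.
have Ae : - (m / 4) <= A * e by nra.
have Be : - (m / 4) <= B * e by nra.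
apply: perron_root_le => //.
- by rewrite -subr_ge0 aE; lra.
- by rewrite -subr_ge0 dE; lra.
rewrite aE dE -subr_ge0.
have -> : (p + A * e + C * e ^+ 2) * (r + B * e + C * e ^+ 2)
   - p * (1 + w0 * e) * (r * (1 + w1 * e))
  = (p * B + r * A - p * r * (w0 + w1)) * e
    + e ^+ 2 * (C * (p + r) + A * B - (p * r) * (w0 * w1) + C * (A + B) * e)
    + (C * e ^+ 2) ^+ 2 by ring.
have -> : p * B + r * A - p * r * (w0 + w1) = k * (p + r) - (r * w0 + p * w1).
  by rewrite /A /B; ring.
rewrite kS subrr mul0r add0r CS addr_ge0 ?sqr_ge0// mulr_ge0//.
have AB : -1 <= A * B by nra.
have pr1 : p * r <= 1 by nra.
have ww : w0 * w1 <= 1 by nra.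
have prww : (p * r) * (w0 * w1) <= 1.
  have : 0 < p * r by rewrite mulr_gt0.
  have : 0 < w0 * w1 by rewrite mulr_gt0.
  nra.
have Cm : C * m <= 2 by nra.
have ABe : - (m / 2) <= (A + B) * e by nra.
have : - 1 <= C * (A + B) * e.
  rewrite -mulrA; apply: (@le_trans _ _ (C * - (m / 2))); first by nra.
  by rewrite ler_pM2l.
by lra.
Qed.

End TwoPoints.

Section Tilt.
Context {R : realType}.
Implicit Types (g a s : R).

(** Generating function of a step of +1 or -1 along an axis, of mean - g. *)
Definition tilt g a : R := 2^-1 * (expR a * (1 - g) + expR (- a) * (1 + g)).

Lemma tilt_gt0 g a : 0 <= g < 1 -> 0 < tilt g a.
Proof.
move=> /andP[g0 g1]; rewrite /tilt mulr_gt0// addr_gt0// mulr_gt0 ?expR_gt0//.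
  by rewrite subr_gt0.
by rewrite ltr_wpDr.
Qed.

Lemma tilt0 g : tilt g 0 = 1.
Proof. by rewrite /tilt oppr0 expR0; field. Qed.

Lemma expR_artanh g : 0 <= g < 1 -> expR (2 * artanh g) = (1 + g) / (1 - g).
Proof.
move=> /andP[g0 g1]; rewrite /artanh mulrA divff// mul1r lnK// posrE divr_gt0//.
  by rewrite ltr_wpDr.
by rewrite subr_gt0.
Qed.

(** This symmetry is the reason for the explicit potential: a -> 2 artanh g - a exchanges
the tilted weights exp (a) (1 - g) and exp (- a) (1 + g). *)
Lemma tilt_sym g a : 0 <= g < 1 -> tilt g (2 * artanh g - a) = tilt g a.
Proof.
move=> g01; have /andP[g0 g1] := g01.
have n1 : 1 - g != 0 by rewrite gt_eqF// subr_gt0.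
have n2 : 1 + g != 0 by rewrite gt_eqF// ltr_wpDr.
rewrite /tilt opprB expRD (expRD a) (expRN (2 * _)) expR_artanh//.
by move: (expR a) (expR (- a)) => u v; field; rewrite n1 n2.
Qed.

Lemma tilt_artanh g : 0 <= g < 1 -> tilt g (2 * artanh g) = 1.
Proof. by move=> g01; rewrite -(subr0 (2 * _)) tilt_sym// tilt0. Qed.

Lemma ln_tilt_ge g a : 0 <= g < 1 -> - g * a <= ln (tilt g a).
Proof.
move=> /andP[g0 g1].
have := @ln_concave R ((1 - g) / 2) (expR a) (expR (- a)) _ (expR_gt0 _) (expR_gt0 _).
rewrite !expRK => h.
have -> : tilt g a = (1 - g) / 2 * expR a + (1 - (1 - g) / 2) * expR (- a).
  by rewrite /tilt; field.
by apply: le_trans (h _); lra.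
Qed.

Lemma ln_tilt_ge_norm g M a : 0 <= g <= M -> M < 1 ->
  `|a| + ln ((1 - M) / 2) <= ln (tilt g a).
Proof.
move=> /andP[g0 gM] M1; have M0 : 0 <= M by exact: le_trans gM.
have d0 : 0 < (1 - M) / 2 by rewrite divr_gt0// subr_gt0.
have t0 : 0 < tilt g a by apply: tilt_gt0; rewrite g0 (le_lt_trans gM).
rewrite -[X in X + _]expRK -lnM ?posrE ?expR_gt0//.
have ed0 : 0 < expR `|a| * ((1 - M) / 2) by rewrite mulr_gt0// expR_gt0.
rewrite ler_ln ?posrE//.
rewrite /tilt; have := expR_gt0 a; have := expR_gt0 (- a).
by case: (ler0P a) => _; nra.
Qed.

Lemma tilt_bounds g s : 0 <= g < 1 -> `|s| <= 2^-1 ->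
  - g * s <= tilt g s - 1 <= - g * s + 2 * s ^+ 2.
Proof.
move=> /andP[g0 g1]; rewrite ler_norml => /andP[sl sr].
have key (u : R) : - 2^-1 <= u -> u <= 2^-1 -> 1 + u <= expR u <= 1 + u + 2 * u ^+ 2.
  move=> ul ur; rewrite expR_ge1Dx/=.
  have := expR_ge1Dx (- u); rewrite expRN => h.
  have e0 := expR_gt0 u.
  have {h} : (1 - u) * expR u <= 1.
    by rewrite -ler_pdivlMr// div1r.
  move: e0; move: (expR u) => e e0 h.
  have u1 : 0 < 1 - u by lra.
  rewrite -(ler_pM2l u1); apply: (le_trans h).
  rewrite -subr_ge0 (_ : _ - 1 = u ^+ 2 * (1 - 2 * u)); last by ring.
  by rewrite mulr_ge0 ?sqr_ge0//; lra.
have /andP[k1 k2] := key s sl sr.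
have /andP[k3 k4] : 1 + - s <= expR (- s) <= 1 + - s + 2 * (- s) ^+ 2 by apply: key; lra.
rewrite sqrrN in k4.
rewrite /tilt; move: (expR s) (expR (- s)) k1 k2 k3 k4 => u v k1 k2 k3 k4.
have s2 : 0 <= s ^+ 2 by exact: sqr_ge0.
by apply/andP; split; nra.
Qed.

Lemma artanh_ge g : 0 <= g < 1 -> g <= 2 * artanh g.
Proof.
move=> g01; have /andP[g0 g1] := g01.
have := @ln_le_subr1 R (expR (- (2 * artanh g))) (expR_gt0 _).
rewrite expRK expRN expR_artanh// invf_div => h.
have g1' : 0 < 1 + g by rewrite ltr_wpDr.
have : (1 - g) / (1 + g) = 1 - 2 * g / (1 + g) by field; rewrite gt_eqF.
move=> E; rewrite E in h.
have : g <= 2 * g / (1 + g) by rewrite ler_pdivlMr//; nra.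
lra.
Qed.

End Tilt.

Section Hamiltonian.
Context {R : realType}.
Variables (P : 'M[R]_2) (mu : 'rV[R]_2) (lam : 'I_2 -> R) (g : 'I_2 -> R -> R).
Hypothesis Pstoch : stochastic_mx P.
Hypothesis Pirr : irreducible_mx P.
Hypothesis muP : invariant_probability P mu.
Hypothesis lam01 : forall i, 0 < lam i < 1.
Hypothesis g01 : forall j z, 0 <= z <= 1 -> 0 <= g j z < 1.
Implicit Types (x v alpha : 'rV[R]_2) (l : 'I_2).

Local Notation p := (P 0 1).
Local Notation r := (P 1 0).

Definition weight l (i : 'I_2) : R := if l == 0 then lam i else 1 - lam i.

(** The mean of weight l with respect to mu, hence the averaged drift along the axis l
is - kappa l * g l. *)
Definition kappa l : R := if l == 0 then lambda mu lam else 1 - lambda mu lam.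

(** The gradient of the potential along the axis l. *)
Definition slope l (z : R) : R := 2 * artanh (g l z).

Lemma stochastic_rows : P 0 0 = 1 - p /\ P 1 1 = 1 - r.
Proof. by have [_ h] := Pstoch; have := h 0; have := h 1; rewrite !sum_I2; lra. Qed.

Lemma irreducible_gt0 : 0 < p <= 1 /\ 0 < r <= 1.
Proof.
have [P0 _] := Pstoch; have [P00 P11] := stochastic_rows.
have p1 : p <= 1 by have := P0 0 0; lra.
have r1 : r <= 1 by have := P0 1 1; lra.
rewrite p1 r1 !andbT !lt_neqAle !P0 !andbT.
split; apply/eqP => e0.
  have [n] := Pirr 0 1; suff -> : (P ^+ n) 0 1 = 0 by rewrite ltxx.
  elim: n => [|n ih]; first by rewrite expr0 mxE.
  by rewrite exprS mxE sum_I2 ih -e0 mul0r mulr0 addr0.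
have [n] := Pirr 1 0; suff -> : (P ^+ n) 1 0 = 0 by rewrite ltxx.
elim: n => [|n ih]; first by rewrite expr0 mxE.
by rewrite exprS mxE sum_I2 ih -e0 mul0r mulr0 addr0.
Qed.

Lemma invariantE : mu 0 0 = r / (p + r) /\ mu 0 1 = p / (p + r).
Proof.
have [/andP[p0 _] /andP[r0 _]] := irreducible_gt0.
have [_ m1 mP] := muP; rewrite sum_I2 in m1.
have := congr1 (fun w : 'rV_2 => w 0 0) mP; rewrite mxE sum_I2.
have [-> _] := stochastic_rows => h.
have pr0 : p + r != 0 by rewrite gt_eqF// addr_gt0.
split; apply: (mulIf pr0); rewrite mulfVK//.
  have : r * (mu 0 0 + mu 0 1) = r by rewrite m1 mulr1.
  lra.
have : p * (mu 0 0 + mu 0 1) = p by rewrite m1 mulr1.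
lra.
Qed.

Lemma weight_gt0 l i : 0 < weight l i < 1.
Proof. by have /andP[h1 h2] := lam01 i; rewrite /weight; case: ifP => _; lra. Qed.

Lemma kappaE l : kappa l = (r * weight l 0 + p * weight l 1) / (p + r).
Proof.
have [m0 m1] := invariantE; have [/andP[p0 _] /andP[r0 _]] := irreducible_gt0.
rewrite /kappa /lambda sum_I2 m0 m1 /weight.
by case: ifP => _; field; rewrite gt_eqF// addr_gt0.
Qed.

Lemma kappa_gt0 l : 0 < kappa l <= 1.
Proof.
have [/andP[p0 _] /andP[r0 _]] := irreducible_gt0.
have /andP[w0 w1] := weight_gt0 l 0; have /andP[w2 w3] := weight_gt0 l 1.
rewrite kappaE; apply/andP; split.
  by rewrite divr_gt0 ?addr_gt0 ?mulr_gt0.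
by rewrite ler_pdivrMr ?addr_gt0// mul1r; nra.
Qed.

Definition tilted_rate x alpha i : R := \sum_l weight l i * tilt (g l (x 0 l)) (alpha 0 l).

Lemma tilted_mxE x alpha i j : tilted_mx P lam g x alpha i j = P i j * tilted_rate x alpha i.
Proof.
rewrite mxE; congr (_ * _).
rewrite -(pair_bigA _ (fun b l => expR (dotp alpha (step (b, l))) * jump lam g x i (b, l)))/=.
rewrite big_bool !sum_I2 /tilted_rate sum_I2 /jump /step /tilt /weight !dotpE /= !mxE/=.
rewrite !expr0 !expr1 !(mulr0, mulr1, addr0, add0r, mul1r, mulN1r, mulrN1, mulrN, oppr0, subr0, sub0r).
by field.
Qed.

Lemma square_g01 x l : square x -> 0 <= g l (x 0 l) < 1.
Proof. by move=> sx; apply/g01/sx. Qed.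

Lemma tilted_rate_gt0 x alpha i : square x -> 0 < tilted_rate x alpha i.
Proof.
move=> sx; have w l : 0 < weight l i by case/andP: (weight_gt0 l i).
by rewrite /tilted_rate sum_I2 addr_gt0// mulr_gt0 ?tilt_gt0 ?square_g01.
Qed.

Lemma hamiltonianE x alpha : square x -> hamiltonian P lam g x alpha =
  ln (perron_root p r (tilted_rate x alpha 0) (tilted_rate x alpha 1)).
Proof.
move=> sx; have [/andP[p0 p1] /andP[r0 r1]] := irreducible_gt0.
have [P00 P11] := stochastic_rows.
have q0 := tilted_rate_gt0 alpha 0 sx; have q1 := tilted_rate_gt0 alpha 1 sx.
have [/= ax dx xE] := perron_rootP p0 r0 q0 q1.
congr ln; apply: perron_frobeniusE; rewrite ?tilted_mxE ?P00 ?P11 ?ltW ?mulr_gt0//.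
move=> i j; rewrite tilted_mxE.
by apply: mulr_ge0; [exact: Pstoch.1|exact/ltW/tilted_rate_gt0].
Qed.

(** Concavity of the logarithm, over the two states and over the two axes. *)
Lemma hamiltonian_ge x alpha : square x ->
  \sum_l kappa l * ln (tilt (g l (x 0 l)) (alpha 0 l)) <= hamiltonian P lam g x alpha.
Proof.
move=> sx; rewrite hamiltonianE//.
have [p01 r01] := irreducible_gt0; have /andP[p0 p1] := p01; have /andP[r0 r1] := r01.
apply: le_trans (ln_perron_root_ge p01 r01 (tilted_rate_gt0 _ _ sx) (tilted_rate_gt0 _ _ sx)).
have lnq i : \sum_l weight l i * ln (tilt (g l (x 0 l)) (alpha 0 l)) <= ln (tilted_rate x alpha i).
  rewrite /tilted_rate !sum_I2 /weight/=; have /andP[l0 l1] := lam01 i.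
  by apply: ln_concave; rewrite ?tilt_gt0 ?square_g01//; lra.
have kE l : kappa l * (p + r) = r * weight l 0 + p * weight l 1.
  by rewrite kappaE mulfVK// gt_eqF// addr_gt0.
rewrite ler_pdivlMr ?addr_gt0// sum_I2 mulrDl !(mulrAC _ _ (p + r)) !kE.
have := ler_wpM2l (ltW r0) (lnq 0); have := ler_wpM2l (ltW p0) (lnq 1).
rewrite !sum_I2; lra.
Qed.

(** Second order expansion, from above, around a momentum at which both tilts are 1.
The hypotheses are on the tilts only, so that by symmetry they cover the momenta close to
0 and those close to slope. *)
Lemma hamiltonian_le : exists s0 C : R, [/\ 0 < s0, 0 < C &
  forall x alpha l s, square x -> `|s| <= s0 ->
    tilt (g l (x 0 l)) (alpha 0 l) = tilt (g l (x 0 l)) s ->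
    (forall k, k != l -> tilt (g k (x 0 k)) (alpha 0 k) = 1) ->
    hamiltonian P lam g x alpha <= - (kappa l * g l (x 0 l)) * s + C * s ^+ 2].
Proof.
have [p01 r01] := irreducible_gt0; have /andP[p0 p1] := p01; have /andP[r0 r1] := r01.
set m := Num.min p r; have m0 : 0 < m by rewrite lt_min p0.
have pr0 : 0 < p + r by rewrite addr_gt0.
exists (Num.min 2^-1 (m / 8)), (2 + 16 / (p + r)); split.
- by rewrite lt_min invr_gt0 ltr0n divr_gt0.
- by rewrite addr_gt0// divr_gt0.
move=> x alpha l s sx; rewrite le_min => /andP[s2 sm] tl tk.
rewrite hamiltonianE//.
set e := tilt (g l (x 0 l)) s - 1.
have g01l := square_g01 l sx; have /andP[gl0 gl1] := g01l.
have /andP[e1 e2] := tilt_bounds g01l s2; rewrite -/e in e1 e2.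
have rateE i : tilted_rate x alpha i = 1 + weight l i * e.
  rewrite /tilted_rate (bigD1 l)//= tl.
  have -> : \sum_(k < 2 | k != l) weight k i * tilt (g k (x 0 k)) (alpha 0 k) = 1 - weight l i.
    rewrite (eq_bigr (fun k => weight k i)); last by move=> k kl; rewrite tk ?mulr1.
    have : \sum_k weight k i = 1 by rewrite sum_I2 /weight/=; ring.
    by rewrite (bigD1 l)//= => <-; rewrite [RHS]addrAC subrr add0r.
  by rewrite /e; ring.
have s_sq : s ^+ 2 = `|s| * `|s| by rewrite -normrM -expr2 ger0_norm ?sqr_ge0.
have eb : `|e| <= 2 * `|s|.
  have [k1 k2] : - `|s| <= s /\ s <= `|s| by have := ler_norm (- s); rewrite normrN; have := ler_norm s; split; lra.
  have := normr_ge0 s.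
  by rewrite ler_norml; move: `|s| s_sq s2 k1 k2 => n; nra.
rewrite !rateE; apply: (le_trans (ln_perron_root_le p01 r01 (weight_gt0 _ _) (weight_gt0 _ _) _)).
  by apply: (le_trans eb); rewrite -/m; lra.
rewrite -kappaE; have /andP[k0 k1] := kappa_gt0 l.
have : e ^+ 2 <= 4 * s ^+ 2.
  rewrite s_sq (_ : e ^+ 2 = `|e| * `|e|); last by rewrite -normrM -expr2 ger0_norm ?sqr_ge0.
  move: eb (normr_ge0 e) (normr_ge0 s); move: `|e| `|s| => E N ?? ?; nra.
have c0 : 0 <= 4 / (p + r) by rewrite divr_ge0// ltW.
rewrite (_ : 16 / (p + r) = 4 * (4 / (p + r))); last by ring.
have sq0 : 0 <= s ^+ 2 by exact: sqr_ge0.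
move: (4 / (p + r)) c0 (s ^+ 2) (e ^+ 2) sq0 e2 => c c0 s2' e2' sq0 e2 h.
have : kappa l * e <= kappa l * (- g l (x 0 l) * s + 2 * s2') by rewrite ler_pM2l.
nra.
Qed.

(** All the tilts are 1, so that the tilted matrix is P. When alpha is the gradient of
the potential, this is the Hamilton-Jacobi equation; the momenta with a vanishing
coordinate are those of the paths that stay on an axis. *)
Lemma hamiltonian_slope x alpha : square x ->
  (forall l, alpha 0 l = 0 \/ alpha 0 l = slope l (x 0 l)) ->
  hamiltonian P lam g x alpha = 0.
Proof.
move=> sx a0.
have t1 l : tilt (g l (x 0 l)) (alpha 0 l) = 1.
  by have [->|->] := a0 l; rewrite ?tilt0// tilt_artanh// square_g01.
have [s0 [C [s00 C0 Hle]]] := hamiltonian_le.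
apply/eqP; rewrite eq_le; apply/andP; split.
  have := Hle x alpha 0 0 sx; rewrite normr0 (ltW s00) expr0n/= !mulr0 addr0.
  by apply => //; rewrite t1 tilt0.
apply: le_trans (hamiltonian_ge _ sx).
by rewrite sum_I2 !t1 ln1 !mulr0 addr0.
Qed.

End Hamiltonian.

Section Lagrangian.
Context {R : realType}.
Variables (P : 'M[R]_2) (mu : 'rV[R]_2) (lam : 'I_2 -> R) (g : 'I_2 -> R -> R).
Hypothesis Pstoch : stochastic_mx P.
Hypothesis Pirr : irreducible_mx P.
Hypothesis muP : invariant_probability P mu.
Hypothesis lam01 : forall i, 0 < lam i < 1.
Hypothesis g01 : forall j z, 0 <= z <= 1 -> 0 <= g j z < 1.
Implicit Types (x v alpha : 'rV[R]_2) (l : 'I_2).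

Local Notation H := (hamiltonian P lam g).
Local Notation L := (lagrangian P lam g).
Local Notation Lref := (lagrangian_ref P lam g).
Local Notation kap := (kappa mu lam).
Local Notation slp := (slope g).

Lemma lagrangian_ge x v alpha : ((dotp alpha v - H x alpha)%:E <= L x v)%E.
Proof. by apply: ereal_sup_ubound; exists alpha. Qed.

Lemma lagrangian_le x v (M : R) :
  (forall alpha, dotp alpha v - H x alpha <= M) -> (L x v <= M%:E)%E.
Proof. by move=> h; apply: ge_ereal_sup => _ [alpha _ <-]; rewrite lee_fin. Qed.

Lemma lagrangian_ge0 x v : square x -> (0 <= L x v)%E.
Proof.
move=> sx; apply: le_trans (lagrangian_ge x v 0).
rewrite (hamiltonian_slope Pstoch Pirr muP lam01 g01 sx); last by move=> l; left; rewrite mxE.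
by rewrite subr0 dotpE !mxE !mul0r addr0.
Qed.

Lemma lagrangian_ref_ge0 x v : square x -> (0 <= Lref x v)%E.
Proof.
move=> sx; rewrite /lagrangian_ref; case: ifPn => _; first exact: lagrangian_ge0.
case: ifPn => _ //; case: ifPn => _; first exact: lagrangian_ge0.
by apply: le_ereal_inf_tmp => _ [b [n [_ _ _ ->]]]; exact: lagrangian_ge0.
Qed.

(** By the symmetry of the tilts, going against the drift at its own speed costs the
slope per unit of length, whereas following the drift is free. *)
Lemma lagrangian_le_slope x v : square x ->
  (forall l, v 0 l = kap l * g l (x 0 l) \/ v 0 l = - (kap l * g l (x 0 l))) ->
  (L x v <= (\sum_l slp l (x 0 l) * Num.max (v 0 l) 0)%:E)%E.
Proof.
move=> sx vE; apply: lagrangian_le => alpha; rewrite lerBlDr.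
apply: (@le_trans _ _ (\sum_l slp l (x 0 l) * Num.max (v 0 l) 0 +
    \sum_l kap l * ln (tilt (g l (x 0 l)) (alpha 0 l)))); last first.
  by rewrite lerD2l hamiltonian_ge.
rewrite -big_split/= /dotp; apply: ler_sum => l _.
have gl := square_g01 g01 l sx; have /andP[g0 _] := gl.
have /andP[k0 _] := kappa_gt0 Pstoch Pirr muP lam01 l.
have kg0 : 0 <= kap l * g l (x 0 l) by rewrite mulr_ge0// ltW.
have [->|->] := vE l.
  rewrite max_l// -tilt_sym//.
  have := ln_tilt_ge (2 * artanh (g l (x 0 l)) - alpha 0 l) gl.
  rewrite -/(slope g l (x 0 l)) => /(ler_wpM2l (ltW k0)); lra.
rewrite max_r ?oppr_le0// mulr0 add0r.
by have := ler_wpM2l (ltW k0) (ln_tilt_ge (alpha 0 l) gl); lra.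
Qed.

(** This bounds the cost of leaving the origin along a straight line. *)
Lemma lagrangian_le_cst x v (M : R) : square x -> M < 1 ->
  (forall l, g l (x 0 l) <= M) -> (forall l, `|v 0 l| <= kap l) ->
  (L x v <= (- ln ((1 - M) / 2))%:E)%E.
Proof.
move=> sx M1 gM vk; apply: lagrangian_le => alpha; rewrite lerBlDr -lerBlDl opprK.
apply: le_trans (hamiltonian_ge Pstoch Pirr muP lam01 g01 alpha sx).
have k1 : \sum_l kap l = 1 by rewrite sum_I2 /kappa/=; ring.
have -> : ln ((1 - M) / 2) = \sum_l kap l * ln ((1 - M) / 2) by rewrite -mulr_suml k1 mul1r.
rewrite addrC /dotp -big_split/=; apply: ler_sum => l _.
have /andP[g0 _] := square_g01 g01 l sx.
have /andP[k0 _] := kappa_gt0 Pstoch Pirr muP lam01 l.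
have gM' : 0 <= g l (x 0 l) <= M by rewrite g0 gM.
have := ler_wpM2l (ltW k0) (ln_tilt_ge_norm (alpha 0 l) gM' M1).
apply: le_trans; rewrite mulrDr addrC lerD2r.
rewrite (le_trans (ler_norm _))// normrM mulrC ler_wpM2r//.
Qed.

(** The gain from shifting the momentum by a bounded multiple of D: quadratic for small
D, linear for large D. *)
Definition theta (D : R) := D ^+ 2 / (1 + `|D|).

Lemma theta_ge0 D : 0 <= theta D.
Proof. by rewrite /theta divr_ge0 ?sqr_ge0// addr_ge0. Qed.

Lemma theta_eq0 D : theta D = 0 -> D = 0.
Proof.
move=> /eqP; rewrite /theta mulf_eq0 invr_eq0 expf_eq0/=.
by case/orP=> [/eqP//|]; rewrite gt_eqF// ltr_wpDr.
Qed.

(** The coordinate vectors in the directions of the coordinates of n are also normal, so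
that every product v_l n_l is nonpositive, while their sum is zero. *)
Lemma orthogonal_normal x v (n : 'rV[R]_2) : square x -> normals x n ->
  dotp n v = 0 -> ~ (exists2 n, normals x n & 0 < dotp v n) ->
  forall l, v 0 l * n 0 l = 0.
Proof.
move=> sx [n1 nx] nv vn.
have vn_le0 l : v 0 l * n 0 l <= 0.
  rewrite leNgt; apply/negP => vnl; apply: vn.
  have nl0 : n 0 l != 0 by apply: contraTneq vnl => ->; rewrite mulr0 ltxx.
  exists (\row_k if k == l then Num.sg (n 0 l) else 0).
    split.
      rewrite /enorm /dotp (bigD1 l)//= big1; last first.
        by move=> k kl; rewrite mxE (negbTE kl) mul0r.
      by rewrite addr0 mxE eqxx -expr2 sqr_sg nl0 sqrtr1.
    move=> k; rewrite mxE; case: eqP => [->|_]; last by split.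
    have [h1 h2 h3] := nx l; split => [/h1 h|/h2|/h3].
    - by rewrite h eqxx in nl0.
    - by rewrite sgr_le0.
    - by rewrite sgr_ge0.
  rewrite /dotp (bigD1 l)//= big1; last first.
    by move=> k kl; rewrite mxE (negbTE kl) mulr0.
  rewrite addr0 mxE eqxx -(pmulr_lgt0 _ (_ : 0 < `|n 0 l|)) ?normr_gt0//.
  by rewrite -mulrA -numEsg.
have := nv; rewrite dotpE => nv'.
have h0 := vn_le0 0; have h1 := vn_le0 1.
move=> l; have [->|->] := I2P l; lra.
Qed.

(** Compared with the momentum slope, the momentum slope - s e_l gains s D and loses at
most C s^2 in the Hamiltonian; s is chosen proportional to D / (1 + |D|). On the boundary
it is tested against the velocity v + beta n, and its other coordinates are set to 0 where v
vanishes. The only coordinates without gain are those at rest at 0. *)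
Lemma lagrangian_ref_ge : exists2 c : R, 0 < c & forall x v l, square x ->
  ((\sum_k slp k (x 0 k) * v 0 k +
    if (x 0 l == 0) && (v 0 l == 0) then 0
    else c * theta (kap l * g l (x 0 l) - v 0 l))%:E <= Lref x v)%E.
Proof.
have [s0 [C [s00 C0 Hle]]] := hamiltonian_le Pstoch Pirr muP lam01 g01.
pose c := Num.min s0 (Num.min 1 (2 * C)^-1).
have c0 : 0 < c by rewrite !lt_min s00 ltr01 invr_gt0 mulr_gt0.
have cs0 : c <= s0 by rewrite ge_min lexx.
have c1 : c <= 1 by rewrite !ge_min lexx orbT.
have cC : C * c <= 2^-1.
  rewrite -ler_pdivlMl// -invfM mulrC; by rewrite !ge_min lexx !orbT.
exists (c / 2); first by rewrite divr_gt0.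
move=> x v l sx.
set D := kap l * g l (x 0 l) - v 0 l.
pose s := c * (D / (1 + `|D|)).
have D1 : 0 < 1 + `|D| by rewrite ltr_wpDr.
have sD : `|s| <= c * Num.min `|D| 1.
  rewrite /s normrM (gtr0_norm c0) ler_wpM2l ?(ltW c0)//.
  rewrite normrM normfV (gtr0_norm D1) le_min ler_pdivrMr// ler_pdivrMr//.
  by rewrite mul1r; have := normr_ge0 D; move: `|D| => d d0; apply/andP; split; nra.
have ss0 : `|s| <= s0.
  rewrite (le_trans sD)// (le_trans _ cs0)// ger_pMr// ge_min lexx orbT//.
have gain : c / 2 * theta D <= s * D - C * s ^+ 2.
  have -> : s * D = c * theta D by rewrite /s /theta; ring.
  have : s ^+ 2 <= c ^+ 2 * theta D.
    rewrite /s /theta exprMn ler_wpM2l ?sqr_ge0// expr_div_n ler_wpM2l ?sqr_ge0//.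
    rewrite lef_pV2 ?posrE ?exprn_gt0//.
    by have := normr_ge0 D; move: `|D| => d d0; nra.
  have := theta_ge0 D; move: (theta D) (s ^+ 2) => t s2 t0 s2t.
  have : C * s2 <= C * (c ^+ 2 * t) by rewrite ler_wpM2l// ltW.
  have : C * c * (c * t) <= 2^-1 * (c * t) by rewrite ler_wpM2r// mulr_ge0// ltW.
  lra.
have core (w alpha : 'rV[R]_2) : alpha 0 l = slp l (x 0 l) - s ->
    (slp l (x 0 l) - s) * v 0 l <= alpha 0 l * w 0 l ->
    (forall k, k != l -> (alpha 0 k = 0 \/ alpha 0 k = slp k (x 0 k)) /\
       alpha 0 k * w 0 k = slp k (x 0 k) * v 0 k) ->
    ((\sum_k slp k (x 0 k) * v 0 k + c / 2 * theta D)%:E <= L x w)%E.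
  move=> al aw ak; apply: le_trans (lagrangian_ge x w alpha); rewrite lee_fin.
  have Hx : H x alpha <= - (kap l * g l (x 0 l)) * s + C * s ^+ 2.
    apply: Hle => //; first by rewrite al tilt_sym// square_g01.
    move=> k kl; have [[->|->] _] := ak k kl; first exact: tilt0.
    by rewrite tilt_artanh// square_g01.
  pose S := \sum_(k < 2 | k != l) slp k (x 0 k) * v 0 k.
  have -> : \sum_k slp k (x 0 k) * v 0 k = slp l (x 0 l) * v 0 l + S by rewrite (bigD1 l).
  have -> : dotp alpha w = alpha 0 l * w 0 l + S.
    rewrite /dotp (bigD1 l)//=; congr (_ + _).
    by apply: eq_bigr => k /ak[].
  by move: gain; rewrite /D; lra.
have coreD : ((\sum_k slp k (x 0 k) * v 0 k + c / 2 * theta D)%:E <= L x v)%E.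
  apply: (core _ (\row_k (slp k (x 0 k) - (if k == l then s else 0)))).
  - by rewrite mxE eqxx.
  - by rewrite mxE eqxx.
  - by move=> k kl; rewrite mxE (negbTE kl) subr0; split; [right|].
have ifle : (\sum_k slp k (x 0 k) * v 0 k +
    (if (x 0 l == 0) && (v 0 l == 0) then 0 else c / 2 * theta D)) <=
    \sum_k slp k (x 0 k) * v 0 k + c / 2 * theta D.
  by rewrite lerD2l; case: ifP => // _; rewrite mulr_ge0 ?theta_ge0// divr_ge0// ltW.
rewrite /lagrangian_ref; case: asboolP => _.
  by apply: le_trans coreD; rewrite lee_fin.
case: asboolP => [_|vn]; first by rewrite leey.
case: asboolP => _; first by apply: le_trans coreD; rewrite lee_fin.
apply: le_ereal_inf_tmp => _ [b [n [b0 nx nv ->]]].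
have vn0 := orthogonal_normal sx nx nv vn.
pose alpha0 : 'rV[R]_2 := \row_k (if v 0 k == 0 then 0 else slp k (x 0 k)).
have ak k : alpha0 0 k * (v + b *: n) 0 k = slp k (x 0 k) * v 0 k.
  rewrite !mxE; case: eqP => [->|/eqP vk]; first by rewrite mul0r mulr0.
  have := vn0 k => /eqP; rewrite mulf_eq0 (negbTE vk)/= => /eqP ->.
  by rewrite mulr0 addr0.
case: ifPn => [_|xv].
  rewrite addr0; apply: le_trans (lagrangian_ge x _ alpha0); rewrite lee_fin.
  rewrite (hamiltonian_slope Pstoch Pirr muP lam01 g01 sx).
    by rewrite subr0 /dotp; under [leRHS]eq_bigr do rewrite ak.
  by move=> k; rewrite mxE; case: ifP; [left|right].
apply: (core _ (\row_k (if k == l then slp l (x 0 l) - s else alpha0 0 k))).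
- by rewrite mxE eqxx.
- rewrite !mxE eqxx.
  have [vl0|vl0] := eqVneq (v 0 l) 0; last first.
    have := vn0 l => /eqP; rewrite mulf_eq0 (negbTE vl0)/= => /eqP ->.
    by rewrite mulr0 addr0.
  rewrite vl0 mulr0 add0r.
  have xl0 : x 0 l != 0 by move: xv; rewrite vl0 eqxx andbT.
  have /andP[xl0' xl1] := sx l.
  have [h1 _ h3] := nx.2 l.
  have [xl1'|xl1'] := eqVneq (x 0 l) 1; last first.
    by rewrite h1 ?mulr0// !lt_neqAle eq_sym xl0 xl0' xl1' xl1.
  rewrite mulr_ge0 ?mulr_ge0 ?h3//.
  have gl := square_g01 g01 l sx; have /andP[g0 _] := gl.
  have /andP[k0 k1] := kappa_gt0 Pstoch Pirr muP lam01 l.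
  have := artanh_ge gl; rewrite -/(slope g l (x 0 l)).
  have : D <= g l (x 0 l) by rewrite /D vl0 subr0 ler_piMl.
  have D0 : 0 <= D by rewrite /D vl0 subr0 mulr_ge0// ltW.
  have : s <= D.
    rewrite (le_trans (ler_norm _))// (le_trans sD)// (ger0_norm D0).
    by apply: (@le_trans _ _ (c * D)); [rewrite ler_pM2l// ge_min lexx|nra].
  lra.
- move=> k kl; rewrite mxE (negbTE kl); split; last exact: ak.
  by rewrite mxE; case: ifP; [left|right].
Qed.

(** Going against the drift costs exactly the slope. At rest at 0, the velocity
v + beta n can be taken equal to the drift, which is free. *)
Lemma lagrangian_ref_le x v : square x -> (forall l, x 0 l < 1) ->
  (forall l, v 0 l = if x 0 l == 0 then 0 else kap l * g l (x 0 l)) ->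
  (Lref x v <= (\sum_l slp l (x 0 l) * v 0 l)%:E)%E.
Proof.
move=> sx x1 vE.
have kg0 l : 0 <= kap l * g l (x 0 l).
  have /andP[g0 _] := square_g01 g01 l sx.
  by have /andP[k0 k1] := kappa_gt0 Pstoch Pirr muP lam01 l; rewrite mulr_ge0// ltW.
have Lw (w : 'rV[R]_2) :
    (forall l, w 0 l = if x 0 l == 0 then - (kap l * g l (x 0 l)) else v 0 l) ->
    (L x w <= (\sum_l slp l (x 0 l) * v 0 l)%:E)%E.
  move=> wE; apply: (@le_trans _ _ (\sum_l slp l (x 0 l) * Num.max (w 0 l) 0)%:E).
    by apply: lagrangian_le_slope => // l; rewrite wE vE; case: (x 0 l == 0); [right|left].
  rewrite lee_fin; apply: ler_sum => l _; rewrite wE vE; case: (x 0 l == 0).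
    by rewrite max_r// oppr_le0.
  by rewrite max_l.
have vn n : normals x n -> dotp v n = 0.
  move=> [_ nx]; rewrite /dotp big1// => l _; rewrite vE.
  case: eqP => [_|/eqP xl0]; first by rewrite mul0r.
  have [h _ _] := nx l; rewrite h ?mulr0// x1 andbT lt_neqAle eq_sym xl0.
  by have /andP[] := sx l.
rewrite /lagrangian_ref; case: ifPn => [/asboolP ox|/asboolPn ox].
  by apply: Lw => l; case: eqP => // xl0; have := ox l; rewrite xl0 ltxx.
have [l xl0] : exists l, x 0 l = 0.
  apply: contrapT => h; apply: ox => l; rewrite x1 andbT lt_neqAle eq_sym.
  have /andP[-> _] := sx l; rewrite andbT.
  by apply/eqP => xl0; apply: h; exists l.
(* The vector b n is the part of the drift along the axes on which x lies. *)
have [n [b [nx b0 bn]]] : exists n b, [/\ normals x n, 0 <= b &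
    forall k, b * n 0 k = if x 0 k == 0 then - (kap k * g k (x 0 k)) else 0].
  pose u : 'rV[R]_2 := \row_k if x 0 k == 0 then - (kap k * g k (x 0 k)) else 0.
  have uk0 k : u 0 k <= 0 by rewrite mxE; case: ifP => //; rewrite oppr_le0.
  have uk k : 0 < x 0 k < 1 -> u 0 k = 0.
    by move=> /andP[xk _]; rewrite mxE gt_eqF.
  have u2 : 0 <= dotp u u by rewrite dotpE addr_ge0// -expr2 sqr_ge0.
  have [u0|u0] := eqVneq (enorm u) 0.
    exists (- delta_mx 0 l), 0; split => // [|k].
      split.
        rewrite /enorm /dotp (bigD1 l)//= big1; last first.
          by move=> k kl; rewrite !mxE (negbTE kl) andbF oppr0 mul0r.
        by rewrite addr0 !mxE !eqxx mulrNN mulr1 sqrtr1.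
      move=> k; rewrite !mxE eqxx/=; case: eqP => [->|_]; last by rewrite oppr0.
      by split => [|_|/eqP]; rewrite ?xl0 ?ltxx// ?oppr_le0// eq_sym oner_eq0.
    have : dotp u u = 0.
      by move/eqP: u0; rewrite /enorm sqrtr_eq0 => h; apply/eqP; rewrite eq_le h.
    rewrite mul0r dotpE => /eqP; rewrite paddr_eq0 -?expr2 ?sqr_ge0// !sqrf_eq0.
    move=> /andP[/eqP h0 /eqP h1].
    have uk1 : u 0 k = 0 by have [->|->] := I2P k.
    by transitivity (u 0 k); [rewrite uk1|rewrite mxE].
  have b0 : 0 < enorm u by rewrite lt_neqAle eq_sym u0 sqrtr_ge0.
  exists ((enorm u)^-1 *: u), (enorm u); split => [||k].
  - split; last first.
      move=> k; rewrite mxE; split => [/uk ->|_|xk1]; first by rewrite mulr0.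
        by rewrite mulr_ge0_le0// invr_ge0 ltW.
      by rewrite mxE xk1 oner_eq0 mulr0.
    have dE : dotp ((enorm u)^-1 *: u) ((enorm u)^-1 *: u) = (enorm u)^-1 ^+ 2 * dotp u u.
      by rewrite !dotpE !mxE; ring.
    have uu : dotp u u = enorm u ^+ 2 by rewrite sqr_sqrtr.
    by rewrite /enorm dE uu -exprMn mulVf// expr1n sqrtr1.
  - exact: ltW.
  - by rewrite mxE mulrA divff// mul1r mxE.
case: ifPn => [/asboolP[m mx]|_]; first by rewrite vn// ltxx.
case: ifPn => [/asboolP/(_ n nx)|_]; first by rewrite vn// ltxx.
apply: (@le_trans _ _ (L x (v + b *: n))).
  apply: ereal_inf_lbound; exists b, n; split=> //.
  by have := vn n nx; rewrite !dotpE !(mulrC (v 0 _)).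
apply: Lw => k; rewrite !mxE bn vE; case: ifP => _; first by rewrite add0r.
by rewrite addr0.
Qed.

End Lagrangian.

(** * The one-dimensional equation *)

Section Primitive.
Context {R : realType}.
Local Notation leb := (@lebesgue_measure R).
Implicit Types (h : R -> R) (s t : R).

Lemma bounded_integrable_itv (M s t : R) (b0 b1 : bool) h : measurable_fun setT h ->
  (forall u, `|h u| <= M) ->
  leb.-integrable [set` Interval (BSide b0 s) (BSide b1 t)] (EFin \o h).
Proof.
move=> mh hM; apply: measurable_bounded_integrable => //.
- have : (lebesgue_measure ([set` Interval (BSide b0 s) (BSide b1 t)] : set R) < +oo)%E.
    rewrite lebesgue_measure_itv/=; case: ifP => _; last by rewrite ltry.
    by rewrite -EFinB ltry.
  by [].
- exact: measurable_funTS.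
- exists M; split; first exact: num_real.
  by move=> y /ltW My u _; apply: le_trans My; exact: hM.
Qed.

Definition prim h t : R := \int[leb]_(u in `[0, t]) h u.

Lemma prim_le0 h t : t <= 0 -> prim h t = 0.
Proof.
rewrite le_eqVlt => /predU1P[->|t0]; rewrite /prim.
  by rewrite set_itv1 Rintegral_set1.
by rewrite set_itv_ge ?Rintegral_set0// bnd_simp -ltNge.
Qed.

Lemma prim_diff (M : R) h s t : measurable_fun setT h -> (forall u, `|h u| <= M) ->
  0 <= s -> s <= t -> prim h t - prim h s = \int[leb]_(u in `]s, t]) h u.
Proof.
move=> mh hM s0 st; rewrite /prim Rintegral_itvB//.
  exact: bounded_integrable_itv hM.
Qed.

Lemma Rintegral_itv_cst s t (M : R) : s <= t ->
  \int[leb]_(u in `]s, t]) M = M * (t - s).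
Proof.
move=> st; rewrite Rintegral_cst//; congr (M * _).
exact: (congr1 fine (stieltjes_itv idfun st)).
Qed.

Lemma Rintegral_itv_le (M s t : R) h : measurable_fun setT h ->
  (forall u, `|h u| <= M) -> s <= t ->
  `|\int[leb]_(u in `]s, t]) h u| <= M * (t - s).
Proof.
move=> mh hM st; have ih := @bounded_integrable_itv M s t false false h mh hM.
rewrite (le_trans (le_normr_Rintegral _ _))// -Rintegral_itv_cst//.
apply: le_Rintegral => //.
  have : measurable_fun setT (fun u => `|h u|) by exact: measurableT_comp.
  by move=> mn; apply: (@bounded_integrable_itv M) => // u /=; rewrite normr_id.
by apply: (@bounded_integrable_itv `|M|).
Qed.

Lemma prim_lipschitz (M s t : R) h : measurable_fun setT h ->
  (forall u, `|h u| <= M) -> `|prim h t - prim h s| <= M * `|t - s|.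
Proof.
move=> mh hM; have M0 : 0 <= M := le_trans (normr_ge0 _) (hM 0).
wlog st : s t / s <= t => [hw|].
  by have /orP[/hw//|/hw] := le_total s t; rewrite distrC [X in _ <= _ * X]distrC.
rewrite (ger0_norm (_ : 0 <= t - s)) ?subr_ge0//.
have [t0|t0] := leP t 0.
  by rewrite !prim_le0 ?(le_trans st)// subrr normr0 mulr_ge0// subr_ge0.
have [s0|s0] := leP s 0; last first.
  by rewrite (prim_diff mh hM) ?(ltW s0)//; exact: Rintegral_itv_le.
rewrite (prim_le0 _ s0) -(@prim_le0 h 0)// (prim_diff mh hM) ?(ltW t0)//.
rewrite (le_trans (Rintegral_itv_le mh hM (ltW t0)))// ler_wpM2l// lerD2l lerN2//.
Qed.

Lemma lipschitz_continuous (M : R) h : (forall s t, `|h t - h s| <= M * `|t - s|) ->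
  continuous h.
Proof.
move=> hM s; apply/cvgrPdist_lt => e e0.
have M1 : 0 < `|M| + 1 by rewrite ltr_wpDl.
near=> t; apply: le_lt_trans (hM _ _) _.
apply: (@le_lt_trans _ _ ((`|M| + 1) * `|s - t|)).
  by rewrite ler_wpM2r// (le_trans (ler_norm _))// lerDl.
rewrite mulrC -ltr_pdivlMr//.
by near: t; apply/nbhs_ballP; exists (e / (`|M| + 1)) => //=; rewrite divr_gt0.
Unshelve. all: by end_near. Qed.

Lemma prim_derive (M : R) h t : measurable_fun setT h -> (forall u, `|h u| <= M) ->
  0 < t -> {for t, continuous h} -> is_derive t (1 : R) (prim h) (h t).
Proof.
move=> mh hM t0 ht.
have [|||dh eh] := @continuous_FTC1 R h (BLeft 0) t (t + 1) _ _ _ ht.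
- by rewrite ltrDl.
- exact: bounded_integrable_itv hM.
- by rewrite lte_fin.
by apply: DeriveDef; [exact: dh|rewrite -derive1E; exact: eh].
Qed.

Lemma prim_ae_derive (M : R) h : measurable_fun setT h -> (forall u, `|h u| <= M) ->
  {ae leb, forall t, 0 < t -> is_derive t (1 : R) (prim h) (h t)}.
Proof.
move=> mh hM.
have ih t : leb.-integrable `[0, t] (EFin \o h) by exact: bounded_integrable_itv hM.
have lh : locally_integrable setT h.
  split=> //; first exact: openT.
  move=> A _ cA; have /integrableP[_] : leb.-integrable A (EFin \o h).
    apply: measurable_bounded_integrable => //.
    - exact: compact_measurable.
    - exact: compact_finite_measure.
    - exact: measurable_funTS.
    - exists M; split; first exact: num_real.
      by move=> y /ltW My u _; apply: le_trans My; exact: hM.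
  by [].
have := FTC1 (a := BLeft 0) ih lh; apply: ae_sub => t H t0.
have [|dh eh] := H; first by rewrite lte_fin.
by apply: DeriveDef; [exact: dh|rewrite -derive1E; exact: eh].
Qed.

End Primitive.

Section Picard.
Context {R : realType}.
Local Notation leb := (@lebesgue_measure R).
Variables (G : R -> R) (K kap y0 : R).
Hypothesis G01 : forall y, 0 <= G y <= 1.
Hypothesis Glip : forall y z, `|G y - G z| <= K * `|y - z|.
Hypothesis kap01 : 0 < kap <= 1.
Implicit Types (s t : R) (n : nat).

Let G_bound (u : R -> R) s : `|(G \o u) s| <= 1.
Proof. by have /andP[h0 h1] := G01 (u s); rewrite /= ger0_norm. Qed.

Let G_meas (u : R -> R) : measurable_fun setT u -> measurable_fun setT (G \o u).
Proof.
move=> mu; apply: measurableT_comp => //; apply: continuous_measurable_fun.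
exact: (@lipschitz_continuous _ K) => s t; rewrite Glip.
Qed.

Fixpoint picard n : R -> R :=
  if n is m.+1 then fun t => y0 - kap * prim (G \o picard m) t else cst y0.

Let step_lipschitz (u : R -> R) s t : measurable_fun setT u ->
  `|(y0 - kap * prim (G \o u) t) - (y0 - kap * prim (G \o u) s)| <= `|t - s|.
Proof.
move=> mu; have := prim_lipschitz s t (G_meas mu) (G_bound u).
have /andP[k0 k1] := kap01 => h.
rewrite (_ : _ - _ = - (kap * (prim (G \o u) t - prim (G \o u) s))); last by ring.
rewrite normrN normrM (gtr0_norm k0) (le_trans (ler_wpM2l (ltW k0) h))//.
by rewrite mul1r ler_piMl.
Qed.

Lemma picard_continuous n : continuous (picard n).
Proof.
elim: n => [|n ih]; first by move=> x; exact: cvg_cst.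
apply: (@lipschitz_continuous _ 1) => s t; rewrite mul1r step_lipschitz//.
exact: continuous_measurable_fun.
Qed.

Lemma picard_measurable n : measurable_fun setT (picard n).
Proof. by apply: continuous_measurable_fun; exact: picard_continuous. Qed.

Lemma picard_lipschitz n s t : `|picard n t - picard n s| <= `|t - s|.
Proof.
case: n => [|n]; first by rewrite /= subrr normr0.
by apply: step_lipschitz; exact: picard_measurable.
Qed.

Lemma picard_le0 n t : t <= 0 -> picard n t = y0.
Proof. by case: n => [//|n] t0; rewrite /= prim_le0// mulr0 subr0. Qed.

Let c := 2 * (`|K| + 1).

Let exp_integral t : 0 <= t -> exists h : R -> R,
  [/\ leb.-integrable setT (EFin \o h),
   \int[leb]_(s in `]0, t]) h s = (expR (c * t) - 1) / c &
   {ae leb, forall s, 0 < s < t -> h s = expR (c * s)}].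
Proof.
move=> t0; have acE := @rabs_continuous_expR R c 0 t.
have [h [ih hE hd]] := rabs_continuous_FTC t0 acE.
exists (fun s => c^-1 * h s); split.
- rewrite (_ : _ \o _ = (fun s => c^-1%:E * (EFin \o h) s)%E); last by [].
  exact: integrableZl.
- rewrite RintegralZl//; last exact: integrable_itv.
  by rewrite -(hE 0 t)// mulr0 expR0 mulrC.
- apply: ae_sub hd => s H st; have [_ <-] := H st.
  have dE := is_derive_expRM c s.
  rewrite derive1E derive_val mulrA mulVf ?mul1r//.
  by rewrite mulf_neq0 ?pnatr_eq0// gt_eqF// ltr_wpDl.
Qed.

(** With respect to the weight exp (c t), one Picard iteration is a contraction by the
factor 1/2. *)
Lemma picard_step n t : 0 <= t ->
  `|picard n.+1 t - picard n t| <= (2 ^ n)%:R^-1 * expR (c * t).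
Proof.
have /andP[k0 k1] := kap01.
have c0 : 0 < c by rewrite mulr_gt0// ltr_wpDl.
elim: n t => [|n ih] t t0.
  rewrite expn0 invr1 mul1r.
  have := picard_lipschitz 1 0 t; rewrite (picard_le0 _ (lexx 0)) subr0 (ger0_norm t0).
  move=> /le_trans; apply; have := expR_ge1Dx (c * t).
  have : t <= c * t by rewrite ler_peMl// /c; have := normr_ge0 K; lra.
  lra.
have [h [ih1 hE hd]] := exp_integral t0.
have mpn := picard_measurable n; have mpn1 := picard_measurable n.+1.
rewrite [picard n.+2 t]/(y0 - _) [X in _ - X]/(y0 - _) opprB addrC subrKA.
rewrite -mulrBr normrM (gtr0_norm k0).
have i0 (u : R -> R) : measurable_fun setT u -> prim (G \o u) t = \int[leb]_(s in `]0, t]) (G \o u) s.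
  by move=> mu; rewrite -(prim_diff (G_meas mu) (G_bound u))// (prim_le0 _ (lexx 0)) subr0.
rewrite (i0 _ mpn) (i0 _ mpn1) -RintegralB//; last 2 first.
  exact: bounded_integrable_itv (G_meas mpn) (G_bound _).
  exact: bounded_integrable_itv (G_meas mpn1) (G_bound _).
have mB : measurable_fun setT (fun s => (G \o picard n) s - (G \o picard n.+1) s).
  by apply: measurable_funB; exact: G_meas.
have BB s : `|(G \o picard n) s - (G \o picard n.+1) s| <= 2.
  have := G_bound (picard n) s; have := G_bound (picard n.+1) s.
  by have := ler_normB ((G \o picard n) s) ((G \o picard n.+1) s); lra.
apply: (@le_trans _ _ (1 * \int[leb]_(s in `]0, t]) `|(G \o picard n) s - (G \o picard n.+1) s|)).
  apply: ler_pM => //; first exact: ltW.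
  by apply: le_normr_Rintegral => //; exact: bounded_integrable_itv mB BB.
rewrite mul1r.
apply: (@le_trans _ _ (\int[leb]_(s in `]0, t]) ((`|K| + 1) * (2 ^ n)%:R^-1 * h s))).
  have iN : leb.-integrable `]0, t[ (EFin \o (fun s => `|(G \o picard n) s - (G \o picard n.+1) s|)).
    apply: (@bounded_integrable_itv _ 2); first exact: measurableT_comp.
    by move=> u; rewrite normr_id.
  have iH : leb.-integrable setT (EFin \o (fun s => (`|K| + 1) * (2 ^ n)%:R^-1 * h s)).
    exact: (@integrableZl _ _ _ leb setT measurableT ((`|K| + 1) * (2 ^ n)%:R^-1) (EFin \o h)).
  rewrite -Rintegral_itv_bndo_bndc// -Rintegral_itv_bndo_bndc; last exact: integrable_itv.
  apply: ae_le_Rintegral => //; first exact: integrable_itv.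
  apply: ae_sub hd => s hs; rewrite /mkset in_itv/= => st; rewrite (hs st) -mulrA.
  have /andP[s0 _] := st; rewrite distrC (le_trans (Glip _ _))//.
  apply: (@le_trans _ _ ((`|K| + 1) * `|picard n.+1 s - picard n s|)).
    by rewrite ler_wpM2r// (le_trans (ler_norm _))// lerDl.
  by rewrite ler_wpM2l ?addr_ge0//; apply: ih; exact: ltW.
rewrite RintegralZl//; last exact: integrable_itv.
have -> : (2 ^ n.+1)%:R^-1 = 2^-1 * (2 ^ n)%:R^-1 :> R by rewrite expnS natrM invfM.
rewrite hE /c.
have K0 : `|K| + 1 != 0 by rewrite gt_eqF// ltr_wpDl.
have q0 : 0 <= (2 ^ n)%:R^-1 :> R by rewrite invr_ge0.
move: ((2 ^ n)%:R^-1) q0 (expR _) => q q0 e.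
have -> : (`|K| + 1) * q * ((e - 1) / (2 * (`|K| + 1))) = 2^-1 * q * (e - 1) by field.
by rewrite ler_wpM2l ?mulr_ge0 ?invr_ge0//; lra.
Qed.

Lemma picard_dist n m t : 0 <= t -> (n <= m)%N ->
  `|picard m t - picard n t| <= 2 * (2 ^ n)%:R^-1 * expR (c * t).
Proof.
move=> t0 nm.
suff H : `|picard m t - picard n t| <= (2 * (2 ^ n)%:R^-1 - 2 * (2 ^ m)%:R^-1) * expR (c * t).
  apply: (le_trans H); rewrite ler_wpM2r ?expR_ge0// gerBl mulr_ge0// invr_ge0//.
rewrite -(subnK nm); elim: (m - n)%N => [|k ih].
  by rewrite add0n !subrr mul0r normr0.
have h := picard_step (k + n) t0.
rewrite addSn (_ : _ - _ = (picard (k + n).+1 t - picard (k + n) t) + (picard (k + n) t - picard n t)); last by ring.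
rewrite (le_trans (ler_normD _ _))// (le_trans (lerD h ih))// expnS natrM invfM.
have : 0 <= expR (c * t) by exact: expR_ge0.
move: (2 ^ n)%:R^-1 (2 ^ (k + n))%:R^-1 (expR _) => a b e e0; nra.
Qed.

Lemma picard_cvg t : cvgn (fun n => picard n t).
Proof.
have [t0|t0] := leP t 0.
  apply/cvg_ex; exists y0; apply: cvg_near_cst; apply: nearW => n.
  exact: picard_le0.
pose u n : R := picard n.+1 t - picard n t.
have pu n : picard n t = y0 + series u n.
  elim: n => [|n ih]; first by rewrite /series/= big_geq// addr0.
  by rewrite /series/= big_nat_recr//= -/(series u n) addrA -ih /u subrKC.
rewrite (_ : (fun n => picard n t) = (fun n => y0 + series u n)); last exact/funext.
apply: is_cvgD; first exact: is_cvg_cst.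
apply: normed_cvg; apply: (@series_le_cvg _ _ (geometric (expR (c * t)) 2^-1)).
- by move=> n; exact: normr_ge0.
- by move=> n; rewrite /geometric/= mulr_ge0 ?expR_ge0// exprn_ge0// invr_ge0.
- move=> n; rewrite /= /u (le_trans (picard_step n (ltW t0)))//.
  by rewrite mulrC natrX exprVn.
- by apply: is_cvg_geometric_series; rewrite ger0_norm ?invr_ge0// invf_lt1// ltr1n.
Qed.

(** The solution, constant equal to y0 at negative times. *)
Definition flow t : R := limn (fun n => picard n t).

Lemma flowP t : (fun n => picard n t) @ \oo --> flow t.
Proof. exact: picard_cvg. Qed.

Lemma flow_le0 t : t <= 0 -> flow t = y0.
Proof.
move=> t0; apply: (cvg_unique _ (@flowP t)) => //.
by apply: cvg_near_cst; apply: nearW => n; exact: picard_le0.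
Qed.

Lemma flow_lipschitz s t : `|flow t - flow s| <= `|t - s|.
Proof.
have h : `|picard n t - picard n s| @[n --> \oo] --> `|flow t - flow s|.
  by apply: cvg_norm; apply: cvgB; exact: flowP.
apply: (ler_cvg_to h (cvg_cst _)).
by apply: nearW => n; exact: picard_lipschitz.
Qed.

Lemma flow_continuous : continuous flow.
Proof. by apply: (@lipschitz_continuous _ 1) => s t; rewrite mul1r flow_lipschitz. Qed.

Lemma flow_measurable : measurable_fun setT flow.
Proof. by apply: continuous_measurable_fun; exact: flow_continuous. Qed.

Lemma flow_dist n t : 0 <= t ->
  `|flow t - picard n t| <= 2 * (2 ^ n)%:R^-1 * expR (c * t).
Proof.
move=> t0.
have h : `|picard m t - picard n t| @[m --> \oo] --> `|flow t - picard n t|.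
  by apply: cvg_norm; apply: cvgB; [exact: flowP|exact: cvg_cst].
apply: (ler_cvg_to h (cvg_cst _)).
by exists n => // m /= nm; exact: picard_dist.
Qed.

Lemma flowE t : flow t = y0 - kap * prim (G \o flow) t.
Proof.
have [t0|t0] := leP t 0; first by rewrite flow_le0// prim_le0// mulr0 subr0.
have /andP[k0 k1] := kap01.
have c0 : 0 < c by rewrite mulr_gt0// ltr_wpDl.
pose B := (`|K| + 1) * 2 * expR (c * t) * t.
have key n : `|picard n.+1 t - (y0 - kap * prim (G \o flow) t)| <= B * (2 ^ n)%:R^-1.
  have mpn := picard_measurable n; have mf := flow_measurable.
  rewrite [picard n.+1 t]/(y0 - _) opprB addrC subrKA -mulrBr normrM (gtr0_norm k0).
  have i0 (u : R -> R) : measurable_fun setT u -> prim (G \o u) t = \int[leb]_(s in `]0, t]) (G \o u) s.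
    by move=> mu; rewrite -(prim_diff (G_meas mu) (G_bound u)) ?(ltW t0)// (prim_le0 _ (lexx 0)) subr0.
  rewrite (i0 _ mpn) (i0 _ mf) -RintegralB//; last 2 first.
    exact: bounded_integrable_itv (G_meas mf) (G_bound _).
    exact: bounded_integrable_itv (G_meas mpn) (G_bound _).
  have mB : measurable_fun setT (fun s => (G \o flow) s - (G \o picard n) s).
    by apply: measurable_funB; exact: G_meas.
  have BB s : `|(G \o flow) s - (G \o picard n) s| <= 2.
    have := G_bound (picard n) s; have := G_bound flow s.
    by have := ler_normB ((G \o flow) s) ((G \o picard n) s); lra.
  have iN : leb.-integrable `]0, t] (EFin \o (fun s => `|(G \o flow) s - (G \o picard n) s|)).
    apply: (@bounded_integrable_itv _ 2); first exact: measurableT_comp.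
    by move=> u; rewrite normr_id.
  apply: (@le_trans _ _ (1 * \int[leb]_(s in `]0, t]) `|(G \o flow) s - (G \o picard n) s|)).
    apply: ler_pM => //; first exact: ltW.
    by apply: le_normr_Rintegral => //; exact: bounded_integrable_itv mB BB.
  rewrite mul1r.
  apply: (@le_trans _ _ (\int[leb]_(s in `]0, t]) ((`|K| + 1) * (2 * (2 ^ n)%:R^-1 * expR (c * t))))).
    apply: le_Rintegral => //.
      by apply: (@bounded_integrable_itv _ `|(`|K| + 1) * (2 * (2 ^ n)%:R^-1 * expR (c * t))|).
    move=> s; rewrite /mkset in_itv/= => /andP[s0 st].
    rewrite (le_trans (Glip _ _))//.
    apply: (@le_trans _ _ ((`|K| + 1) * `|flow s - picard n s|)).
      by rewrite ler_wpM2r// (le_trans (ler_norm _))// lerDl.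
    rewrite ler_wpM2l ?addr_ge0// (le_trans (flow_dist n (ltW s0)))//.
    by rewrite ler_wpM2l ?mulr_ge0 ?invr_ge0// ler_expR ler_wpM2l// ltW.
  rewrite Rintegral_itv_cst ?(ltW t0)// subr0 /B.
  by rewrite le_eqVlt; apply/orP; left; apply/eqP; ring.
have h0 : B * (2 ^ n)%:R^-1 @[n --> \oo] --> 0.
  rewrite -(mulr0 B); apply: cvgMr.
  rewrite (_ : (fun n => _) = (fun n => 2^-1 ^+ n)); last first.
    by apply/funext => n; rewrite natrX exprVn.
  by apply: cvg_expr; rewrite ger0_norm ?invr_ge0// invf_lt1// ltr1n.
have h1 : `|picard n.+1 t - (y0 - kap * prim (G \o flow) t)| @[n --> \oo] -->
    `|flow t - (y0 - kap * prim (G \o flow) t)|.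
  apply: cvg_norm; apply: cvgB; last exact: cvg_cst.
  by have := @flowP t; rewrite -(cvg_shiftS (fun n => picard n t)).
apply/eqP; rewrite -subr_eq0 -normr_le0.
by apply: (ler_cvg_to h1 h0); apply: nearW.
Qed.

End Picard.

Section Trajectory.
Context {R : realType}.
Local Notation leb := (@lebesgue_measure R).
Variables (g : R -> R) (K kap x0 : R).
Hypothesis g01 : forall z, 0 <= z <= 1 -> 0 <= g z < 1.
Hypothesis glip : forall y z, 0 <= y <= 1 -> 0 <= z <= 1 -> `|g y - g z| <= K * `|y - z|.
Hypothesis gpos : forall z, 0 < z <= 1 -> 0 < g z.
Hypothesis kap01 : 0 < kap <= 1.
Hypothesis x01 : 0 <= x0 <= 1.
Implicit Types (s t y : R).

(** The drift is extended to the line in order to solve the equation without constraint: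
its solution becomes negative in finite time when g 0 > 0. *)
Definition gext y := g (clamp 0 1 y).

Lemma gext_id y : 0 <= y <= 1 -> gext y = g y.
Proof. by move=> y01; rewrite /gext clamp_id. Qed.

Lemma gext01 y : 0 <= gext y < 1.
Proof. by apply: g01; apply: clamp_itv. Qed.

Lemma gextW y : 0 <= gext y <= 1.
Proof. by have /andP[-> /ltW->] := gext01 y. Qed.

Lemma gext_lip y z : `|gext y - gext z| <= `|K| * `|y - z|.
Proof.
rewrite (le_trans (glip _ _)) ?clamp_itv//.
apply: (@le_trans _ _ (`|K| * `|clamp 0 1 y - clamp 0 1 z|)).
  by rewrite ler_wpM2r// ler_norm.
by rewrite ler_wpM2l// clamp_dist.
Qed.

Lemma gext_continuous : continuous gext.
Proof. by apply: (@lipschitz_continuous _ `|K|) => s t; exact: gext_lip. Qed.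

Local Notation flow := (flow gext kap x0).

Let gflow_measurable : measurable_fun setT (gext \o flow).
Proof.
apply: measurableT_comp.
  by apply: continuous_measurable_fun; exact: gext_continuous.
exact: flow_measurable gextW gext_lip kap01.
Qed.

Let gflow_bound s : `|(gext \o flow) s| <= 1.
Proof. by have /andP[h0 h1] := gextW (flow s); rewrite /= ger0_norm. Qed.

Lemma flow_decr_ge (m s t : R) : 0 <= s -> s <= t ->
  (forall u, s < u <= t -> m <= gext (flow u)) -> flow t <= flow s - kap * m * (t - s).
Proof.
move=> s0 st gm; have /andP[k0 k1] := kap01.
rewrite (flowE x0 gextW gext_lip kap01 t) (flowE x0 gextW gext_lip kap01 s).
have : m * (t - s) <= prim (gext \o flow) t - prim (gext \o flow) s.
  rewrite (prim_diff gflow_measurable gflow_bound s0 st) -Rintegral_itv_cst//.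
  apply: le_Rintegral => //.
  - exact: (@bounded_integrable_itv _ `|m|).
  - exact: bounded_integrable_itv gflow_measurable gflow_bound.
by move/(ler_wpM2l (ltW k0)); lra.
Qed.

Lemma flow_nonincreasing s t : s <= t -> flow t <= flow s.
Proof.
move=> st; have [s0|/ltW s0] := leP 0 s.
  have := @flow_decr_ge 0 s t s0 st; rewrite mulr0 mul0r subr0; apply => u _.
  by have /andP[] := gext01 (flow u).
rewrite (flow_le0 x0 gextW gext_lip kap01 s0).
have [t0|/ltW t0] := leP 0 t; last by rewrite (flow_le0 x0 gextW gext_lip kap01 t0).
rewrite -[leRHS](flow_le0 x0 gextW gext_lip kap01 (lexx 0)).
have := @flow_decr_ge 0 0 t (lexx _) t0; rewrite mulr0 mul0r !subr0; apply => u _.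
by have /andP[] := gext01 (flow u).
Qed.

(** The equation reflected at 0: for a one-dimensional autonomous decreasing motion,
the reflection map is the positive part. *)
Definition traj t := Num.max (flow t) 0.

Lemma traj_le0 t : t <= 0 -> traj t = x0.
Proof.
by move=> t0; rewrite /traj (flow_le0 x0 gextW gext_lip kap01 t0) max_l//; case/andP: x01.
Qed.

Lemma traj_nonincreasing s t : s <= t -> traj t <= traj s.
Proof.
move=> /flow_nonincreasing h.
by rewrite /traj ge_max !le_max h lexx !orbT.
Qed.

Lemma traj_itv t : 0 <= traj t <= x0.
Proof.
rewrite {1}/traj le_max lexx orbT/=.
have [t0|/ltW t0] := leP t 0; first by rewrite traj_le0.
by rewrite -(traj_le0 (lexx 0)) traj_nonincreasing.
Qed.

Lemma traj01 t : 0 <= traj t <= 1.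
Proof.
have /andP[-> h] := traj_itv t; have /andP[_] := x01; exact: le_trans.
Qed.

Lemma traj_lipschitz s t : `|traj t - traj s| <= `|t - s|.
Proof.
apply: le_trans (flow_lipschitz x0 gextW gext_lip kap01 s t).
rewrite /traj; move: (flow t) (flow s) => u v.
by case: (leP u 0) => u0; case: (leP v 0) => v0; rewrite ?subrr ?normr0// ?sub0r ?subr0
  ler_norml; have := ler_norm (u - v); have := ler_norm (v - u); rewrite -(distrC u); lra.
Qed.

Lemma traj_derive t : 0 < t -> 0 < traj t ->
  is_derive t (1 : R) traj (- (kap * g (traj t))).
Proof.
move=> t0 zt; have /andP[k0 k1] := kap01.
have ft : 0 < flow t by move: zt; rewrite /traj lt_max ltxx orbF.
have zE : traj t = flow t by rewrite /traj max_l// ltW.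
have cf : continuous flow by exact: flow_continuous gextW gext_lip kap01.
have d1 : is_derive t (1 : R) (prim (gext \o flow)) (gext (flow t)).
  apply: (prim_derive gflow_measurable gflow_bound t0).
  by apply: continuous_comp; [exact: cf|exact: gext_continuous].
have d2 : is_derive t (1 : R) (fun u => x0 - kap * prim (gext \o flow) u) (- (kap * g (traj t))).
  apply: is_derive_eq.
  rewrite /GRing.scale/= add0r mul1r zE gext_id//.
  by rewrite -zE traj01.
have near_eq : \forall u \near t, x0 - kap * prim (gext \o flow) u = traj u.
  near=> u; rewrite -(flowE x0 gextW gext_lip kap01 u) /traj max_l// ltW//.
  near: u; by apply: cvgr_gt ft; exact: cf.
apply: DeriveDef.
  have := @ex_derive _ _ _ _ _ _ _ d2; apply: near_eq_derivable; exact: near_eq.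
by rewrite -(near_eq_derive _ near_eq) derive_val.
Unshelve. all: by end_near. Qed.

(** While the motion remains above e, its speed is bounded from below. *)
Lemma traj_cvg0 (e : R) : 0 < e -> exists2 T, 0 < T & forall t, T <= t -> traj t < e.
Proof.
move=> e0; have [//|h] := pselect (exists2 T, 0 < T & forall t, T <= t -> traj t < e).
have ze t : e <= traj t.
  rewrite leNgt; apply/negP => zt; apply: h; exists (Num.max t 1).
    by rewrite lt_max ltr01 orbT.
  move=> u; rewrite ge_max => /andP[tu _].
  exact: le_lt_trans (traj_nonincreasing tu) zt.
have e1 : e <= 1 by have /andP[_] := traj01 0; exact: le_trans.
have [] := @EVT_min R gext e 1 e1.
  by apply: continuous_subspaceT; exact: gext_continuous.
move=> c; rewrite in_itv/= => /andP[ec c1] cmin.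
have c01 : 0 <= c <= 1 by rewrite c1 (le_trans (ltW e0) ec).
have m0 : 0 < gext c by rewrite gext_id//; apply: gpos; rewrite (lt_le_trans e0 ec).
have /andP[k0 k1] := kap01.
pose t := 2 / (kap * gext c).
have t0 : 0 < t by rewrite divr_gt0// mulr_gt0.
have fz u : flow u = traj u.
  by have := ze u; rewrite /traj; case: (leP (flow u) 0) => // _ e00; have := lt_le_trans e0 e00; rewrite ltxx.
have := @flow_decr_ge (gext c) 0 t (lexx 0) (ltW t0).
rewrite subr0 {1}/t mulrCA divff ?mulr1; last by rewrite gt_eqF// mulr_gt0.
have /andP[_ z01] := traj01 0.
rewrite !fz => H; have : traj t <= traj 0 - 2.
  apply: H => u _; apply: cmin; rewrite fz in_itv/= ze.
  by have /andP[] := traj01 u.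
by have /andP[zt _] := traj01 t; lra.
Qed.

(** A motion at 1 at time t has been there since time 0, against g 1 > 0. *)
Lemma traj_lt1 t : 0 < t -> traj t < 1.
Proof.
move=> t0; have /andP[k0 k1] := kap01; have [//|z1] := ltP (traj t) 1.
have z1' s : s <= t -> traj s = 1.
  move=> st; apply/eqP; rewrite eq_le (le_trans z1 (traj_nonincreasing st)) andbT.
  by have /andP[] := traj01 s.
have fz s : s <= t -> flow s = 1.
  by move=> /z1'; rewrite /traj; case: leP => // _ /eqP; rewrite eq_sym oner_eq0.
have g1 : 0 < g 1 by apply: gpos; rewrite ltr01 lexx.
have := @flow_decr_ge (g 1) 0 t (lexx 0) (ltW t0).
rewrite !fz ?(ltW t0)// subr0 => H.
have : 1 <= 1 - kap * g 1 * t.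
  by apply: H => u /andP[_ ut]; rewrite fz// gext_id// ler01 lexx.
have : 0 < kap * g 1 * t by rewrite !mulr_gt0.
lra.
Qed.

End Trajectory.

(** * Derivatives at local extrema *)

Section LocalExtrema.
Context {R : realType}.
Implicit Types (f : R -> R) (t : R).

Lemma derive1_ge0_right f t : derivable f t 1 ->
  (\forall s \near t, t < s -> f t <= f s) -> 0 <= derive1 f t.
Proof.
move=> df ft; rewrite derive1E.
have q : (fun h : R => h^-1 *: (f (h *: 1 + t) - f t)) @ 0^' --> 'D_1 f t by exact: df.
have {}q : (fun h : R => h^-1 *: (f (h *: 1 + t) - f t)) @ 0^'+ --> 'D_1 f t.
  apply: cvg_trans q; apply: cvg_app => A [d d0 dA].
  by exists d => // y yd y0; apply: dA => //; rewrite gt_eqF.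
apply: (ler_cvg_to (cvg_cst 0) q).
move: ft => [d /= d0 ft].
near=> h.
have h0 : 0 < h by near: h; exact: nbhs_right_gt.
have hd : h < d by near: h; exact: nbhs_right_lt.
have th : t < h + t by rewrite ltrDr.
rewrite /GRing.scale/= mulr1 mulr_ge0// ?invr_ge0 ?(ltW h0)// subr_ge0; apply: ft => //.
by rewrite /= opprD addrCA subrr addr0 normrN gtr0_norm.
Unshelve. all: by end_near. Qed.

Lemma derive1_ge0_left f t : derivable f t 1 ->
  (\forall s \near t, s < t -> f s <= f t) -> 0 <= derive1 f t.
Proof.
move=> df ft.
pose u (s : R) := - f (- s).
have dN : is_derive (- t) (1 : R) (fun s : R => - s) (-1) by apply: is_derive_eq.
have df' : is_derive (- - t) (1 : R) f (derive1 f t).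
  by rewrite opprK; apply: DeriveDef; [exact: df|rewrite derive1E].
have du : is_derive (- t) (1 : R) u (derive1 f t).
  have := @is_deriveN _ _ _ _ _ _ _ (@is_derive1_comp _ f -%R (- t) _ _ df' dN).
  by rewrite mulrN1 opprK.
have -> : derive1 f t = derive1 u (- t) by rewrite (derive1E u) derive_val.
apply: derive1_ge0_right; first exact: (@ex_derive _ _ _ _ _ _ _ du).
move: ft => [d /= d0 ft]; exists d => // s /= st ts.
rewrite /u opprK lerN2; apply: ft; last by rewrite ltrNl.
by rewrite /= opprK -normrN opprD.
Qed.

Lemma derive1_eq0_min f t : derivable f t 1 ->
  (\forall s \near t, f t <= f s) -> derive1 f t = 0.
Proof.
move=> df ft; apply/eqP; rewrite eq_le; apply/andP; split; last first.
  by apply: derive1_ge0_right => //; apply: filterS ft => s h _.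
have dN : is_derive t (1 : R) (\- f) (- derive1 f t).
  by rewrite derive1E; apply: is_deriveN; exact: derivableP.
rewrite -oppr_ge0.
have -> : - derive1 f t = derive1 (\- f) t by rewrite [RHS]derive1E derive_val.
apply: derive1_ge0_left; first exact: (@ex_derive _ _ _ _ _ _ _ dN).
by apply: filterS ft => s h _; rewrite /= lerN2.
Qed.

Lemma derive1_eq0_max f t : derivable f t 1 ->
  (\forall s \near t, f s <= f t) -> derive1 f t = 0.
Proof.
move=> df ft.
have dN : is_derive t (1 : R) (\- f) (- derive1 f t).
  by rewrite derive1E; apply: is_deriveN; exact: derivableP.
have := @derive1_eq0_min (\- f) t (@ex_derive _ _ _ _ _ _ _ dN).
have -> : derive1 (\- f) t = - derive1 f t by rewrite [LHS]derive1E derive_val.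
move=> h.
apply/eqP; rewrite -oppr_eq0; apply/eqP; apply: h.
by apply: filterS ft => s h; rewrite /= lerN2.
Qed.

Lemma derivable_near_gt f t a : derivable f t 1 -> a < f t ->
  \forall s \near t, a < f s.
Proof.
move=> df aft.
have cf : {for t, continuous f} by apply: differentiable_continuous; apply/derivable1_diffP.
exact: (@cvgr_gt _ _ _ _ f (f t) cf a aft).
Qed.

Lemma derivable_near_lt f t a : derivable f t 1 -> f t < a ->
  \forall s \near t, f s < a.
Proof.
move=> df aft.
have cf : {for t, continuous f} by apply: differentiable_continuous; apply/derivable1_diffP.
exact: (@cvgr_lt _ _ _ _ f (f t) cf a aft).
Qed.

End LocalExtrema.

(** * One-dimensional reflected paths *)

Section ReflectedCoordinate.
Context {R : realType}.
Local Notation leb := (@lebesgue_measure R).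
Implicit Types (x w k : R -> R) (s t T : R).

(** What the Skorokhod problem in the square says of a coordinate x of the solution,
for the input w: the path w - x increases away from 0 and decreases away from 1. *)
Definition reflected_coordinate T w x :=
  [/\ {within `[0, T], continuous x},
      forall t, 0 <= t <= T -> 0 <= x t <= 1,
      forall s t, 0 <= s -> s <= t -> t <= T -> (forall u, s < u <= t -> 0 < x u) ->
        x t - x s <= w t - w s &
      forall s t, 0 <= s -> s <= t -> t <= T -> (forall u, s < u <= t -> x u < 1) ->
        w t - w s <= x t - x s].

(** The time r is the last one before t at which x is at most x s. *)
Lemma increment_last_passage s t x w : s <= t -> {within `[s, t], continuous x} ->
  (forall r, s <= r <= t -> (forall u, r < u <= t -> x s < x u) -> x t - x r <= w t - w r) ->
  x s <= x t ->
  exists2 r, s <= r <= t & x t - x s <= w t - w r.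
Proof.
move=> st cx H xst.
pose A := [set u | s <= u <= t /\ x u <= x s].
have As : A s by split; rewrite ?lexx ?st.
have supA : has_sup A.
  by split; [exists s|exists t => u [/andP[_ ut] _]].
pose r := sup A.
have sr : s <= r by apply: ub_le_sup => //; case: supA.
have rt : r <= t by apply: ge_sup; [exists s|move=> u [/andP[]]].
have srt : s <= r <= t by rewrite sr rt.
exists r => //.
have xr : x r <= x s.
  rewrite leNgt; apply/negP => xsr.
  have [d d0 hd] : exists2 d, 0 < d & forall u, s <= u <= t -> `|r - u| < d -> x s < x u.
    have rst : `[s, t]%classic r by rewrite /= in_itv.
    have cxr := (subspace_continuousP _ _).1 cx r rst.
    have [d d0 hd] : within `[s, t]%classic (nbhs r) [set u | x s < x u].
      exact: (@cvgr_gt _ _ _ _ x (x r) cxr (x s) xsr).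
    by exists d => // u ust ru; apply: hd => //=; rewrite in_itv.
  have [u [/andP[su ut] xu] ru] := sup_adherent d0 supA.
  have ur : u <= r by apply: ub_le_sup; [case: supA|split; rewrite ?su].
  have := hd u; rewrite su ut => /(_ erefl).
  have rud : r - u < d by move: ru; rewrite -/r; lra.
  by rewrite ger0_norm ?subr_ge0// => /(_ rud); rewrite ltNge xu.
apply: (@le_trans _ _ (x t - x r)); first by lra.
apply: H => // u /andP[ru ut]; rewrite ltNge; apply/negP => xu.
have : u <= r by apply: ub_le_sup; [case: supA|split=> //; rewrite (le_trans sr (ltW ru))].
by rewrite leNgt ru.
Qed.

(** Since its last passage at the level x s, the path has stayed away from the wall that
pushes in the direction of its increment. *)
Lemma reflected_increment T w x s t : reflected_coordinate T w x ->
  0 <= s -> s <= t -> t <= T ->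
  exists2 r, s <= r <= t & `|x t - x s| <= `|w t - w r|.
Proof.
move=> [cx x01 incr decr] s0 st tT.
have cst (f : R -> R) : {within `[0, T], continuous f} -> {within `[s, t], continuous f}.
  by apply: continuous_subspaceW; apply: subset_itv; rewrite bnd_simp.
have sT : s <= T by exact: le_trans tT.
have xs01 : 0 <= x s <= 1 by apply: x01; rewrite s0.
have [xst|/ltW xts] := leP (x s) (x t).
  have [|r srt h] := increment_last_passage (w := w) st (cst _ cx) _ xst.
    move=> r /andP[sr rt] h; apply: incr => //; first exact: le_trans sr.
    move=> u /h; apply: le_lt_trans.
    by case/andP: xs01.
  exists r => //; rewrite ger0_norm ?subr_ge0// (le_trans h)// ler_norm//.
have [|||r srt h] := @increment_last_passage s t (\- x) (\- w) st.
- apply: cst => u; apply: continuousN; exact: cx.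
- move=> r /andP[sr rt] h /=; rewrite -!opprD lerN2; apply: decr => //.
    exact: le_trans sr.
  move=> u /h /=; rewrite ltrN2 => xus; apply: (lt_le_trans xus).
  by case/andP: xs01.
- by rewrite /= lerN2.
exists r => //; rewrite distrC ger0_norm ?subr_ge0// distrC.
by move: h => /= h; rewrite (le_trans _ (ler_norm _))//; lra.
Qed.

(** The reflection map does not increase the modulus of absolute continuity: every
interval of a family is shortened on its left so as to bound the increment of x. *)
Lemma reflected_rabs_continuous T w x : reflected_coordinate T w x ->
  rabs_continuous 0 T w -> rabs_continuous 0 T x.
Proof.
move=> wx acw e e0; have [d d0 wd] := acw _ e0; exists d => // s [s1 s2] sd.
pose c (p : R * R) : R := if pselect (exists2 r, p.1 <= r <= p.2 &
  `|x p.2 - x p.1| <= `|w p.2 - w r|) is left h then sval (cid2 h) else p.1.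
have cP p : p \in s -> p.1 <= c p <= p.2 /\ `|x p.2 - x p.1| <= `|w p.2 - w (c p)|.
  move=> /s1[p0 [pp pT]]; rewrite /c; case: pselect => [h|]; first by case: cid2.
  by case; exact: reflected_increment pT.
pose s' := [seq (c p, p.2) | p <- s].
have := wd s'; rewrite !big_map/= => H.
apply: (@le_lt_trans _ _ (\sum_(p <- s) `|w p.2 - w (c p)|)).
  by rewrite big_seq [leRHS]big_seq; apply: ler_sum => p /cP[].
apply: H; last first.
  apply: le_lt_trans sd; rewrite big_seq [leRHS]big_seq; apply: ler_sum => p /cP[/andP[h _] _].
  by rewrite lerD2l lerN2.
split.
  move=> _ /mapP[p ps ->] /=; have [/andP[h1 h2] _] := cP _ ps.
  have [h3 [_ h4]] := s1 _ ps; split; [exact: le_trans h1|by []].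
have cq q : q \in s -> q.1 <= c q by case/cP => /andP[].
rewrite /s' pairwise_map; elim: (s) s2 cq => //= p r ih /andP[pr rr] cq.
apply/andP; split; last by apply: ih => // q qr; apply: cq; rewrite inE qr orbT.
apply/allP => q qr; apply: le_trans (cq q _); last by rewrite inE qr orbT.
by have /allP/(_ q qr) := pr.
Qed.

(** Away from a wall, that wall does not push. On a wall the path is at an extremum. *)
Lemma reflected_derive T w x t : reflected_coordinate T w x -> 0 < t < T ->
  derivable x t 1 -> derivable w t 1 ->
  [/\ 0 < x t -> derive1 x t <= derive1 w t,
      x t < 1 -> derive1 w t <= derive1 x t,
      x t = 0 -> derive1 x t = 0 & x t = 1 -> derive1 x t = 0].
Proof.
move=> [cx x01 incr decr] t0T dx dw; have /andP[t0 tT] := t0T.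
have near_between (Q : R -> Prop) : (\forall s \near t, Q s) ->
    \forall s \near t, t < s -> s <= T /\ forall u, t < u <= s -> Q u.
  move=> [d /= d0 hd].
  near=> s => ts; split.
    by apply/ltW; near: s; apply: lt_nbhsl.
  move=> u /andP[tu us]; apply: hd => /=.
  rewrite distrC gtr0_norm ?subr_gt0//.
  apply: (@le_lt_trans _ _ `|t - s|).
    by rewrite distrC gtr0_norm ?subr_gt0// lerD2r.
  by near: s; apply/nbhs_ballP; exists d.
have dwx : is_derive t (1 : R) (w \- x) (derive1 w t - derive1 x t).
  by rewrite !derive1E; apply: is_deriveB; exact: derivableP.
have dxw : is_derive t (1 : R) (x \- w) (derive1 x t - derive1 w t).
  by rewrite !derive1E; apply: is_deriveB; exact: derivableP.
split.
- move=> xt; rewrite -subr_ge0.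
  have -> : derive1 w t - derive1 x t = derive1 (w \- x) t by rewrite [RHS]derive1E derive_val.
  apply: derive1_ge0_right; first exact: (@ex_derive _ _ _ _ _ _ _ dwx).
  apply: filterS (near_between _ (derivable_near_gt dx xt)) => s h ts.
  have [sT hu] := h ts.
  by have := incr t s (ltW t0) (ltW ts) sT hu; rewrite /=; lra.
- move=> xt; rewrite -subr_ge0.
  have -> : derive1 x t - derive1 w t = derive1 (x \- w) t by rewrite [RHS]derive1E derive_val.
  apply: derive1_ge0_right; first exact: (@ex_derive _ _ _ _ _ _ _ dxw).
  apply: filterS (near_between _ (derivable_near_lt dx xt)) => s h ts.
  have [sT hu] := h ts.
  by have := decr t s (ltW t0) (ltW ts) sT hu; rewrite /=; lra.
- move=> xt; apply: derive1_eq0_min => //; rewrite xt.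
  apply: filterS (near_itvoo t0T) => s /andP[s0 sT].
  by have /andP[] : 0 <= x s <= 1 by apply: x01; rewrite (ltW s0) (ltW sT).
- move=> xt; apply: derive1_eq0_max => //; rewrite xt.
  apply: filterS (near_itvoo t0T) => s /andP[s0 sT].
  by have /andP[] : 0 <= x s <= 1 by apply: x01; rewrite (ltW s0) (ltW sT).
Unshelve. all: by end_near. Qed.

End ReflectedCoordinate.

(** * Coordinates of a solution of the Skorokhod problem *)

Section SkorokhodCoordinates.
Context {R : realType}.
Local Notation leb := (@lebesgue_measure R).
Implicit Types (D : set R) (w x k : R -> 'rV[R]_2) (l : 'I_2).

Lemma norm_coord_le_enorm (u : 'rV[R]_2) l : `|u 0 l| <= enorm u.
Proof.
rewrite /enorm -(sqrtr_sqr (u 0 l)) ler_wsqrtr// /dotp (bigD1 l)//= expr2 lerDl.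
by apply: sumr_ge0 => j _; rewrite -expr2 sqr_ge0.
Qed.

Lemma enorm_ge0 (u : 'rV[R]_2) : 0 <= enorm u.
Proof. exact: sqrtr_ge0. Qed.

Lemma within_continuous_coord D (f : R -> 'rV[R]_2) l :
  {within D, continuous f} -> {within D, continuous (fun t => f t 0 l)}.
Proof.
move=> cf t; apply: (@continuous_comp (subspace D) _ _ f (fun M : 'rV[R]_2 => M 0 l)).
  exact: cf.
exact: coord_continuous.
Qed.

Lemma Rintegral_le0 (m : {measure set (measurableTypeR R) -> \bar R}) (A : set R)
    (f : R -> R) : (forall u : R, A u -> f u <= 0) -> \int[m]_(u in A) f u <= 0.
Proof.
move=> f0; rewrite /Rintegral.
have -> : (\int[m]_(u in A) (f u)%:E = \int[m]_(u in A) - (- f u)%:E)%E.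
  by apply: eq_integral => u _; rewrite EFinN oppeK.
rewrite integral_ge0N; last by move=> u /f0; rewrite lee_fin oppr_ge0.
rewrite fineN oppr_le0 fine_ge0// integral_ge0// => u /f0.
by rewrite lee_fin oppr_ge0.
Qed.

(** The measure is d|k|; the density is the coordinate of the normal, made zero off the
boundary, which d|k| does not charge. *)
Lemma skorokhod_push D (T : R) w x k l :
  measurable (D : set (measurableTypeR R)) -> (forall t, 0 <= t <= T -> D t) ->
  0 <= T -> skorokhod D w x k ->
  exists (m : {measure set (measurableTypeR R) -> \bar R}) (n : R -> R),
    [/\ forall s t : R, 0 <= s -> s <= t -> t <= T ->
          k t 0 l - k s 0 l = \int[m]_(u in `]s, t]) n u,
        forall u : R, 0 < u <= T -> 0 < x u 0 l -> 0 <= n u &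
        forall u : R, 0 < u <= T -> x u 0 l < 1 -> n u <= 0].
Proof.
move=> mD TD T0 [[cx ck] xw tvfin [m [n [mE mn nx kE tvE]]]].
have DT : D T by apply: TD; rewrite T0 lexx.
have subD s t : 0 <= s -> t <= T -> `]s, t]%classic `<=` D.
  move=> s0 tT u; rewrite /= in_itv/= => /andP[su ut]; apply: TD.
  by rewrite (le_trans s0 (ltW su)) (le_trans ut tT).
have mx j : measurable_fun (`]0, T]%classic : set (measurableTypeR R)) (fun t => x t 0 j).
  apply: (@measurable_funS _ _ _ _ D) => //; first exact: subD.
  apply: subspace_continuous_measurable_fun => //.
  exact: within_continuous_coord.
pose A : set (measurableTypeR R) := `]0, T]%classic.
have mA : measurable A by exact: measurable_itv.
pose I j := A `&` [set t | x t 0 j \in `]0, 1[].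
have mI j : measurable (I j).
  have := mx j mA `]0, 1[%classic (measurable_itv _); rewrite /I.
  by [].
pose B := A `\` (I 0 `&` I 1).
have mB : measurable B by apply: measurableD => //; exact: measurableI.
have sq t : A t -> square (x t).
  by move=> At; have [] := xw t (subD 0 T (lexx _) (lexx _) t At).
have BP t : A t -> B t <-> bd_square (x t).
  move=> At; split.
    move=> [_ h]; split; first exact: sq.
    by move=> ox; apply: h; split; split => //=; rewrite in_itv/=; exact: ox.
  move=> [_ h]; split=> // -[[_ h0] [_ h1]]; apply: h => j.
  by move: h0 h1; rewrite /= !in_itv/=; have [->|->] := I2P j.
have mAfin : (m A < +oo)%E by rewrite mE ?(tvfin T DT).
have mAB : m A = m B.
  rewrite mE// (tvE T DT).
  transitivity (\int[m]_(s in A) (\1_B s)%:E)%E.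
    apply: eq_integral => t /set_mem At; congr EFin; rewrite !indicE.
    congr (nat_of_bool _)%:R; apply/idP/idP => /set_mem h; apply/mem_set.
      by apply/(BP t At).
    by apply/(BP t At).
  by rewrite integral_indic//; congr (m _); rewrite setIidl// => t [].
have mN : m (A `\` B) = 0%E.
  have BA : B `<=` A by move=> t [].
  rewrite measureD// (setIidr BA) [X in (X - _)%E]mAB subee// ge0_fin_numE -?mAB//.
pose n' u := n u 0 l * \1_B u.
have n'1 u : `|n' u| <= 1.
  rewrite /n' indicE; case: (boolP (u \in B)); rewrite ?mulr0 ?normr0// mulr1.
  move=> /set_mem Bu; have [Au _] := Bu.
  have [<- _] := nx u (subD 0 T (lexx _) (lexx _) u Au) ((BP u Au).1 Bu).
  exact: norm_coord_le_enorm.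
have mn' : measurable_fun A n'.
  apply: measurable_funM; last exact: measurable_indic.
  apply: (@measurable_funS _ _ _ _ D) => //; exact: subD.
have AtA t : t <= T -> `]0, t]%classic `<=` A.
  by move=> tT u; rewrite /A /= !in_itv/= => /andP[-> /le_trans]; apply.
have in' t : t <= T -> m.-integrable `]0, t]%classic (EFin \o n').
  move=> tT; apply: measurable_bounded_integrable => //.
  - by apply: le_lt_trans mAfin; apply: le_measure; rewrite ?inE//; exact: AtA.
  - by apply: measurable_funS mn' => //; exact: AtA.
  - exists 1; split; first exact: num_real.
    by move=> y /ltW y1 u _; apply: le_trans y1; exact: n'1.
have kE' t : 0 <= t -> t <= T -> k t 0 l = \int[m]_(u in `]0, t]) n' u.
  move=> t0 tT; rewrite kE; last by apply: TD; rewrite t0.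
  rewrite /Rintegral; congr fine; apply: ae_eq_integral => //.
  - apply/measurable_EFinP; apply: (@measurable_funS _ _ _ _ D) => //; exact: subD.
  - by apply/measurable_EFinP; apply: measurable_funS mn' => //; exact: AtA.
  exists (A `\` B); split => //; first exact: measurableD.
  move=> u /= h; apply: contrapT => ABu; apply: h => u0t; congr EFin.
  rewrite /n' indicE mem_set ?mulr1//; apply: contrapT => Bu; apply: ABu.
  by split=> //; exact: (AtA t).
exists m, n'; split.
- move=> s t s0 st tT.
  rewrite (kE' t) ?(le_trans s0)// (kE' s) ?(le_trans st)//.
  have U : `]0, t]%classic = `]0, s]%classic `|` `]s, t]%classic.
    by rewrite -itv_bndbnd_setU// bnd_simp.
  rewrite U Rintegral_setU//; first by rewrite addrAC subrr add0r.
    by rewrite -U; exact: in'.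
  apply/disj_setPS => u []; rewrite /= !in_itv/= => /andP[_ us] /andP[su _].
  by have := lt_le_trans su us; rewrite ltxx.
- move=> u u0T xu; rewrite /n' indicE; case: (boolP (u \in B)); rewrite ?mulr0// mulr1.
  move=> /set_mem Bu; have [Au _] := Bu.
  have [_ /(_ l)[h1 h2 h3]] := nx u (subD 0 T (lexx _) (lexx _) u Au) ((BP u Au).1 Bu).
  have /andP[xu0 xu1] := sq u Au l.
  have [xu1'|xu1'] := eqVneq (x u 0 l) 1; first exact: h3.
  by rewrite h1// xu lt_neqAle xu1' xu1.
- move=> u u0T xu; rewrite /n' indicE; case: (boolP (u \in B)); rewrite ?mulr0// mulr1.
  move=> /set_mem Bu; have [Au _] := Bu.
  have [_ /(_ l)[h1 h2 h3]] := nx u (subD 0 T (lexx _) (lexx _) u Au) ((BP u Au).1 Bu).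
  have /andP[xu0 xu1] := sq u Au l.
  have [xu0'|xu0'] := eqVneq (x u 0 l) 0; first exact: h2.
  by rewrite h1// xu lt_neqAle eq_sym xu0' xu0.
Qed.

Lemma skorokhod_coordinate D (T : R) w x k l :
  measurable (D : set (measurableTypeR R)) -> (forall t, 0 <= t <= T -> D t) ->
  0 <= T -> skorokhod D w x k ->
  reflected_coordinate T (fun t => w t 0 l) (fun t => x t 0 l).
Proof.
move=> mD TD T0 sk; have [m [n [kE n0 n1]]] := skorokhod_push l mD TD T0 sk.
have [[cx _] xw _ _] := sk.
have wE t : 0 <= t -> t <= T -> w t 0 l = x t 0 l + k t 0 l.
  by move=> t0 tT; have [|_ ->] := xw t; [apply: TD; rewrite t0|rewrite mxE].
split.
- apply: continuous_subspaceW (@within_continuous_coord D x l cx).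
  by move=> t; rewrite /= in_itv/=; exact: TD.
- by move=> t /TD/xw[sx _]; exact: sx.
- move=> s t s0 st tT xu; rewrite !wE ?(le_trans s0 st) ?(le_trans st tT)//.
  suff : 0 <= k t 0 l - k s 0 l by lra.
  rewrite kE//; apply: Rintegral_ge0 => u; rewrite /= in_itv/= => /andP[su ut].
  apply: n0; first by rewrite (le_lt_trans s0 su) (le_trans ut tT).
  by apply: xu; rewrite su.
- move=> s t s0 st tT xu; rewrite !wE ?(le_trans s0 st) ?(le_trans st tT)//.
  suff : k t 0 l - k s 0 l <= 0 by lra.
  rewrite kE//; apply: Rintegral_le0 => u; rewrite /= in_itv/= => /andP[su ut].
  apply: n1; first by rewrite (le_lt_trans s0 su) (le_trans ut tT).
  by apply: xu; rewrite su.
Qed.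

End SkorokhodCoordinates.

(** * Variation of a path with bounded velocity *)

Section DensityMeasure.
Context {R : realType}.
Local Notation leb := (@lebesgue_measure R).
Variable f : R -> R.
Hypothesis mf : measurable_fun setT f.
Hypothesis f0 : forall s, 0 <= f s.

Definition density (A : set (measurableTypeR R)) : \bar R := (\int[leb]_(s in A) (f s)%:E)%E.

Let density0 : density set0 = 0%E.
Proof. exact: integral_set0. Qed.

Let density_ge0 A : (0 <= density A)%E.
Proof. by apply: integral_ge0 => s _; rewrite lee_fin. Qed.

Let density_sigma_additive : semi_sigma_additive density.
Proof.
move=> F mF tF mUF; rewrite /density ge0_integral_bigcup//.
- apply: is_cvg_ereal_nneg_natsum => n _; exact: density_ge0.
- by apply/measurable_EFinP; exact: measurable_funTS.
- by move=> s _; rewrite lee_fin.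
Qed.

HB.instance Definition _ := isMeasure.Build _ _ _ density
  density0 density_ge0 density_sigma_additive.

Definition density_measure : {measure set (measurableTypeR R) -> \bar R} := density.

End DensityMeasure.

Section EuclideanVariation.
Context {R : realType}.
Local Notation leb := (@lebesgue_measure R).
Implicit Types (u v : 'rV[R]_2) (k : R -> 'rV[R]_2) (s t : R).

Lemma sqr_enorm u : enorm u ^+ 2 = dotp u u.
Proof. by rewrite sqr_sqrtr// dotpE addr_ge0// -expr2 sqr_ge0. Qed.

Lemma dotp_le_enorm u v : dotp u v <= enorm u * enorm v.
Proof.
have : dotp u v ^+ 2 <= (enorm u * enorm v) ^+ 2.
  rewrite exprMn !sqr_enorm !dotpE -subr_ge0.
  rewrite (_ : _ - _ = (u 0 0 * v 0 1 - u 0 1 * v 0 0) ^+ 2) ?sqr_ge0//; ring.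
have e0 : 0 <= enorm u * enorm v by rewrite mulr_ge0// sqrtr_ge0.
move=> h; rewrite (le_trans (ler_norm _))//.
by rewrite -(@ler_pXn2r _ 2) ?nnegrE// -normrX ger0_norm ?sqr_ge0.
Qed.

Lemma enormD u v : enorm (u + v) <= enorm u + enorm v.
Proof.
have e0 : 0 <= enorm u + enorm v by rewrite addr_ge0// sqrtr_ge0.
rewrite -(@ler_pXn2r _ 2) ?nnegrE ?sqrtr_ge0// sqr_enorm sqrrD !sqr_enorm.
have := dotp_le_enorm u v; rewrite !dotpE !mxE; lra.
Qed.

Lemma enorm0 : enorm (0 : 'rV[R]_2) = 0.
Proof. by rewrite /enorm dotpE !mxE mul0r addr0 sqrtr0. Qed.

Lemma evariation_cons k a b y p :
  evariation a b k (y :: p) = enorm (k y - k a) + evariation y b k p.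
Proof. by rewrite /evariation/= big_nat_recl. Qed.

Lemma etotal_variationxx k b : etotal_variation b b k = 0%E.
Proof.
apply/eqP; rewrite eq_le; apply/andP; split.
  apply: ge_ereal_sup => _ [p /itv_partitionxx -> <-].
  by rewrite /evariation big_nil.
apply: ereal_sup_ubound; exists [::]; first by split.
by rewrite /evariation big_nil.
Qed.

Lemma etotal_variation_cons k s t b : s < t -> t <= b ->
  ((enorm (k t - k s))%:E + etotal_variation t b k <= etotal_variation s b k)%E.
Proof.
move=> st tb; rewrite addeC -leeBrDr//.
apply: ge_ereal_sup => _ [p pt <-]; rewrite leeBrDr// -EFinD.
apply: ereal_sup_ubound; exists (t :: p); last by rewrite evariation_cons addrC.
by move: pt => [pt lt]; split; rewrite //= st.
Qed.

Lemma etotal_variation_ge0 k t b : t <= b -> (0 <= etotal_variation t b k)%E.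
Proof.
rewrite le_eqVlt => /predU1P[->|tb]; first by rewrite etotal_variationxx.
apply: le_trans (etotal_variation_cons k tb (lexx b)).
by rewrite etotal_variationxx adde0 lee_fin sqrtr_ge0.
Qed.

Variables (k : R -> 'rV[R]_2) (G : R -> R) (b : R).
Hypothesis kG : forall s t, 0 <= s -> s <= t -> enorm (k t - k s) <= G t - G s.

(** A partition of [s, b] is cut at t; on its first part, the increments of G bound
those of k. *)
Lemma etotal_variation_split s t : 0 <= s -> s <= t -> t <= b ->
  (etotal_variation s b k <= (G t - G s)%:E + etotal_variation t b k)%E.
Proof.
move=> s0 st tb; apply: ge_ereal_sup => _ [p ps <-].
elim: p s s0 st ps => [|y p ih] s s0 st ps.
  have tE : t = b.
    by apply/eqP; rewrite eq_le tb -(itv_partition_nil ps).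
  rewrite /evariation big_nil tE etotal_variationxx adde0 lee_fin subr_ge0.
  by have := kG s0 st; rewrite tE => h; have := le_trans (sqrtr_ge0 _) h; rewrite subr_ge0.
have py := itv_partition_cons ps.
have sy : s < y by move: ps => -[/= /andP[]].
rewrite evariation_cons EFinD; have [yt|ty] := leP y t.
  have := ih y (le_trans s0 (ltW sy)) yt py => h.
  apply: le_trans (leeD (_ : (enorm (k y - k s))%:E <= (G y - G s)%:E)%E h) _.
    by rewrite lee_fin; apply: kG => //; exact: ltW.
  by rewrite addeA -EFinD (_ : G y - G s + (G t - G y) = G t - G s)//; ring.
have pt : itv_partition t b (y :: p).
  by move: ps => [/= /andP[_ yp] l]; split; rewrite //= ty.
apply: (@le_trans _ _ ((enorm (k t - k s))%:E + (evariation t b k (y :: p))%:E)%E).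
  rewrite evariation_cons -!EFinD lee_fin addrA lerD2r.
  by rewrite (_ : k y - k s = (k t - k s) + (k y - k t)) ?enormD// [RHS]addrC subrKA.
apply: leeD; first by rewrite lee_fin; exact: kG.
by apply: ereal_sup_ubound; exists (y :: p).
Qed.

Lemma etotal_variation_le s : 0 <= s -> s <= b ->
  (etotal_variation s b k <= (G b - G s)%:E)%E.
Proof.
move=> s0 sb; have := etotal_variation_split s0 sb (lexx b).
by rewrite etotal_variationxx adde0.
Qed.

Lemma etotal_variation_fin s : 0 <= s -> s <= b -> etotal_variation s b k \is a fin_num.
Proof.
move=> s0 sb; rewrite ge0_fin_numE ?etotal_variation_ge0//.
by rewrite (le_lt_trans (etotal_variation_le s0 sb))// ltry.
Qed.

End EuclideanVariation.

Section BoundedVelocity.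
Context {R : realType}.
Local Notation leb := (@lebesgue_measure R).
Implicit Types (s t : R).
Variables (v : R -> 'rV[R]_2) (M : R).
Hypothesis mv : forall l, measurable_fun setT (fun s => v s 0 l).
Hypothesis vM : forall s, enorm (v s) <= M.

Definition displacement t : 'rV[R]_2 := \row_l prim (fun s => v s 0 l) t.

Let vlM l s : `|v s 0 l| <= M.
Proof. exact: le_trans (norm_coord_le_enorm _ _) (vM s). Qed.

Lemma measurable_speed : measurable_fun setT (fun s => enorm (v s)).
Proof.
rewrite /enorm; apply: (@measurableT_comp _ _ _ _ _ _ (@Num.sqrt R)) => //.
  by apply: continuous_measurable_fun; exact: sqrt_continuous.
under eq_fun do rewrite dotpE.
by apply: measurable_funD; apply: measurable_funM.
Qed.

Let speedM s : `|enorm (v s)| <= M.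
Proof. by rewrite ger0_norm ?sqrtr_ge0. Qed.

Lemma prim_nondecreasing (f : R -> R) (B s t : R) : measurable_fun setT f ->
  (forall u, `|f u| <= B) -> (forall u, 0 <= f u) -> 0 <= s -> s <= t -> prim f s <= prim f t.
Proof.
move=> mf fB f0 s0 st; rewrite -subr_ge0 (prim_diff mf fB)//.
by apply: Rintegral_ge0.
Qed.

Let displacementB s t : 0 <= s -> s <= t -> forall l,
  (displacement t - displacement s) 0 l = \int[leb]_(u in `]s, t]) v u 0 l.
Proof. by move=> s0 st l; rewrite !mxE (prim_diff (mv l) (vlM l)). Qed.

Lemma displacement_le s t : 0 <= s -> s <= t ->
  enorm (displacement t - displacement s) <=
    prim (fun u => enorm (v u)) t - prim (fun u => enorm (v u)) s.
Proof.
move=> s0 st; rewrite (prim_diff measurable_speed speedM)//.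
set d := displacement t - displacement s.
have [->|d0] := eqVneq (enorm d) 0; first by apply: Rintegral_ge0 => u _; exact: sqrtr_ge0.
have {}d0 : 0 < enorm d by rewrite lt_neqAle eq_sym d0 sqrtr_ge0.
have dE l : d 0 l = \int[leb]_(u in `]s, t]) v u 0 l by exact: displacementB.
rewrite -(ler_pM2l d0) -expr2 sqr_enorm dotpE.
rewrite [X in _ * X + _]dE [X in _ + _ * X]dE.
have iv l : leb.-integrable `]s, t] (EFin \o (fun u => v u 0 l)).
  exact: bounded_integrable_itv (mv l) (vlM l).
have isp : leb.-integrable `]s, t] (EFin \o (fun u => enorm (v u))).
  exact: bounded_integrable_itv measurable_speed speedM.
have iZ (f : R -> R) (a : R) : leb.-integrable `]s, t] (EFin \o f) ->
    leb.-integrable `]s, t] (EFin \o (fun u => a * f u)).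
  by move=> h; exact: (@integrableZl _ _ _ leb _ (measurable_itv _) a (EFin \o f)).
rewrite -!RintegralZl// -RintegralD//; [|exact: iZ|exact: iZ].
apply: le_Rintegral => //; last 2 first.
- exact: iZ.
- by move=> u _; have := dotp_le_enorm d (v u); rewrite dotpE.
have mst : measurable (`]s, t]%classic : set (measurableTypeR R)) by exact: measurable_itv.
exact: (integrableD mst (iZ _ (d 0 0) (iv 0)) (iZ _ (d 0 1) (iv 1))).
Qed.

Lemma displacement_derive : {ae leb, forall t, 0 < t ->
  is_derive t (1 : R) (prim (fun u => enorm (v u))) (enorm (v t)) /\
  forall l, is_derive t (1 : R) (prim (fun u => v u 0 l)) (v t 0 l)}.
Proof.
have h0 := prim_ae_derive (mv 0) (vlM 0); have h1 := prim_ae_derive (mv 1) (vlM 1).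
have hs := prim_ae_derive measurable_speed speedM.
apply: ae_sub (ae_and hs (ae_and h0 h1)) => t [ks [k0 k1]] t0.
by split => [|l]; [exact: ks|have [->|->] := I2P l; [exact: k0|exact: k1]].
Qed.

(** The Euclidean variation is the integral of the speed. For the lower bound,
the variation of the path on [s, b] is a Lipschitz function of s, and its derivative
is almost everywhere at least the speed. *)
Lemma etotal_variation_displacement a b : 0 <= a -> a <= b ->
  etotal_variation a b displacement = (\int[leb]_(u in `]a, b]) enorm (v u))%:E.
Proof.
move=> a0 ab; set G := prim (fun u => enorm (v u)).
have kG := displacement_le.
have fin s : 0 <= s -> s <= b -> etotal_variation s b displacement \is a fin_num.
  by move=> s0 sb; exact: etotal_variation_fin kG s s0 sb.
rewrite -(prim_diff measurable_speed speedM)// -/G.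
apply/eqP; rewrite eq_le (etotal_variation_le kG)//=.
pose V s := fine (etotal_variation s b displacement).
have VE s : 0 <= s -> s <= b -> (V s)%:E = etotal_variation s b displacement.
  by move=> s0 sb; exact: fineK (fin s s0 sb).
have Vsplit s t : 0 <= s -> s <= t -> t <= b -> V s <= G t - G s + V t.
  move=> s0 st tb; rewrite -lee_fin.
  rewrite (VE s s0 (le_trans st tb)).
  rewrite [X in (_ <= X)%E]EFinD.
  rewrite (VE t (le_trans s0 st) tb).
  exact: (etotal_variation_split kG).
have Vcons s t : 0 <= s -> s <= t -> t <= b -> enorm (displacement t - displacement s) + V t <= V s.
  move=> s0; rewrite le_eqVlt => /predU1P[->|st] tb; first by rewrite subrr enorm0 add0r.
  rewrite -lee_fin (VE s s0 (le_trans (ltW st) tb)) [X in (X <= _)%E]EFinD.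
  rewrite (VE t (le_trans s0 (ltW st)) tb).
  exact: etotal_variation_cons.
rewrite -(fineK (fin a a0 ab)) lee_fin -/(V a).
have Vb : V b = 0 by rewrite /V etotal_variationxx.
pose h s := - V s - G s.
have GM s t : 0 <= s -> s <= t -> 0 <= G t - G s <= M * (t - s).
  move=> s0 st; rewrite subr_ge0 (prim_nondecreasing measurable_speed speedM)//=; last first.
    by move=> u; exact: sqrtr_ge0.
  have := prim_lipschitz s t measurable_speed speedM.
  by rewrite (ger0_norm (_ : 0 <= t - s)) ?subr_ge0//; apply: le_trans; rewrite ler_norm.
have dispD : {ae leb, forall t, 0 < t -> is_derive t (1 : R) G (enorm (v t)) /\
    forall l, is_derive t (1 : R) (prim (fun u => v u 0 l)) (v t 0 l)}.
  exact: displacement_derive.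
clearbody G V.
suff : h a <= h b by rewrite /h Vb; lra.
apply: rabs_continuous_nondecreasing => //.
  apply: (@rabs_continuous_lipschitz _ (2 * M)) => p q ap pq qb.
  have p0 : 0 <= p by exact: le_trans ap.
  have /andP[g1 g2] := GM p q p0 pq.
  have v1 := Vsplit p q p0 pq qb; have v2 := Vcons p q p0 pq qb.
  have e0 := sqrtr_ge0 (dotp (displacement q - displacement p) (displacement q - displacement p)).
  rewrite -/(enorm _) in e0.
  by rewrite /h ler_norml; apply/andP; split; lra.
apply: ae_sub dispD => t H /andP[at_ tb] dh.
have t0 : 0 < t by exact: le_lt_trans at_.
have [dG dv] := H t0.
(* The speed at t is the derivative of the projection of the path on its direction u. *)
pose u : 'rV[R]_2 := (enorm (v t))^-1 *: v t.
have uv : dotp u (v t) = enorm (v t).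
  have -> : dotp u (v t) = (enorm (v t))^-1 * enorm (v t) ^+ 2.
    by rewrite sqr_enorm !dotpE !mxE; ring.
  have [->|n0] := eqVneq (enorm (v t)) 0; first by rewrite expr0n mulr0.
  by rewrite expr2 mulrA mulVf// mul1r.
have u1 : enorm u <= 1.
  rewrite -(@ler_pXn2r _ 2) ?nnegrE ?sqrtr_ge0// expr1n sqr_enorm.
  have -> : dotp u u = (enorm (v t))^-1 * dotp u (v t).
    by rewrite !dotpE !mxE; ring.
  rewrite uv; have [->|n0] := eqVneq (enorm (v t)) 0; first by rewrite mulr0.
  by rewrite mulVf.
pose q := fun s => h s + G s - (u 0 0 * prim (fun r => v r 0 0) s + u 0 1 * prim (fun r => v r 0 1) s).
have dq : is_derive t (1 : R) q (derive1 h t).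
  have d0 := dv 0; have d1 := dv 1.
  have dh' : is_derive t (1 : R) h (derive1 h t) by apply: DeriveDef; [exact: dh|rewrite derive1E].
  have e0 := is_deriveZ (u 0 0) d0.
  have e1 := is_deriveZ (u 0 1) d1.
  have := is_deriveB (is_deriveD dh' dG) (is_deriveD e0 e1).
  have -> : derive1 h t + enorm (v t) - (u 0 0 *: v t 0 0 + u 0 1 *: v t 0 1) = derive1 h t.
    by rewrite -[in X in _ + X - _]uv dotpE /GRing.scale/=; ring.
  by [].
have -> : derive1 h t = derive1 q t by rewrite [RHS]derive1E derive_val.
apply: derive1_ge0_right; first exact: (@ex_derive _ _ _ _ _ _ _ dq).
near=> s => ts.
have sb : s <= b by apply/ltW; near: s; exact: lt_nbhsl.
have := Vcons t s (ltW t0) (ltW ts) sb.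
have := dotp_le_enorm u (displacement s - displacement t).
have : enorm u * enorm (displacement s - displacement t) <= enorm (displacement s - displacement t).
  by rewrite ler_piMl// sqrtr_ge0.
rewrite /q /h dotpE !mxE; lra.
Unshelve. all: by end_near. Qed.

End BoundedVelocity.

(** * Construction of solutions of the Skorokhod problem *)

Section Push.
Context {R : realType}.
Local Notation leb := (@lebesgue_measure R).
Implicit Types (s t : R) (l : 'I_2).

Lemma enorm_le_sum (u : 'rV[R]_2) : enorm u <= `|u 0 0| + `|u 0 1|.
Proof.
rewrite -(@ler_pXn2r _ 2) ?nnegrE ?sqrtr_ge0 ?addr_ge0// sqr_enorm dotpE sqrrD.
rewrite -!expr2 -(real_normK (num_real (u 0 0))) -(real_normK (num_real (u 0 1))).
by have := mulr_ge0 (normr_ge0 (u 0 0)) (normr_ge0 (u 0 1)); rewrite mulr2n; lra.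
Qed.

Lemma continuous_row (f : R -> 'rV[R]_2) :
  (forall l, continuous (fun t => f t 0 l)) -> continuous f.
Proof.
move=> cf t; apply/cvg_ballP => e e0.
have h0 : \forall s \near t, ball (f t 0 0) e (f s 0 0).
  by have := cf 0 t; move/cvg_ballP; apply.
have h1 : \forall s \near t, ball (f t 0 1) e (f s 0 1).
  by have := cf 1 t; move/cvg_ballP; apply.
near=> s; split=> // i j; rewrite (ord1 i).
by have [->|->] := I2P j; near: s.
Unshelve. all: by end_near. Qed.

Variables (x : R -> 'rV[R]_2) (c : 'I_2 -> R).
Hypothesis cx : forall l, continuous (fun t => x t 0 l).
Hypothesis sqx : forall t, square (x t).
Hypothesis c0 : forall l, 0 <= c l.

(** The velocity of k = w - x: while x is on the wall x_l = 0, the free path w presses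
against this wall at the rate c l. *)
Definition push_velocity s : 'rV[R]_2 := \row_l (if x s 0 l == 0 then - c l else 0).

Local Notation v := push_velocity.
Local Notation k := (displacement push_velocity).

Let mx l : measurable_fun setT (fun s => x s 0 l).
Proof. by apply: continuous_measurable_fun; exact: cx. Qed.

Let Z l : set (measurableTypeR R) := [set s | x s 0 l == 0].

Let mZ l : measurable (Z l).
Proof.
have := mx l measurableT (measurable_set1 (0 : R)).
rewrite setTI (_ : _ @^-1` _ = Z l)//.
by apply/seteqP; split => s /=; rewrite /Z /= => /eqP.
Qed.

Let vE l s : v s 0 l = - c l * \1_(Z l) s.
Proof.
rewrite mxE indicE; case: ifPn => xs; first by rewrite mem_set// mulr1.
by rewrite memNset ?mulr0//; apply/negP.
Qed.

Let mv l : measurable_fun setT (fun s => v s 0 l).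
Proof.
under eq_fun do rewrite vE.
apply: measurable_funM; first exact: measurable_cst.
exact: (measurable_indic (mZ l)).
Qed.

Let M := c 0 + c 1.

Let vM s : enorm (v s) <= M.
Proof.
have vl l : `|v s 0 l| <= c l.
  by rewrite mxE; case: ifP => _; rewrite ?normr0// normrN ger0_norm.
by apply: le_trans (enorm_le_sum _) _; exact: lerD.
Qed.

Let mspeed : measurable_fun setT (fun s => enorm (v s)).
Proof. exact: measurable_speed. Qed.

Let m := density_measure mspeed (fun s => enorm_ge0 (v s)).

Let mEq (A : set (measurableTypeR R)) : m A = (\int[leb]_(s in A) (enorm (v s))%:E)%E.
Proof. by []. Qed.

Let other l : 'I_2 := if l == 0 then 1 else 0.

(* The times spent on the wall x_l = 0 only (E1 l), and in the corner (E2): the speed of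
the push is constant on each of these sets. *)
Let E1 l : set (measurableTypeR R) := Z l `\` Z (other l).

Let E2 : set (measurableTypeR R) := Z 0 `&` Z 1.

Let mE1 l : measurable (E1 l).
Proof. by apply: measurableD. Qed.

Let mE2 : measurable E2.
Proof. exact: measurableI. Qed.

Let C := enorm (\row_l c l).

Let enormE1 l s : E1 l s -> enorm (v s) = c l.
Proof.
rewrite /E1 /Z /other /= => -[].
have [->|->] := I2P l => /= h /negP/negbTE h'.
  by rewrite /enorm dotpE !mxE h h' mulr0 addr0 mulrNN -expr2 sqrtr_sqr ger0_norm.
by rewrite /enorm dotpE !mxE h h' mulr0 add0r mulrNN -expr2 sqrtr_sqr ger0_norm.
Qed.

Let enormE2 s : E2 s -> enorm (v s) = C.
Proof. by move=> [/= h h']; rewrite /C /enorm !dotpE !mxE h h' !mulrNN. Qed.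

Let ZE l s : \1_(Z l) s = \1_(E1 l) s + \1_E2 s :> R.
Proof.
rewrite !indicE; have [zl|zl] := boolP (s \in Z l); last first.
  rewrite !memNset ?addr0//.
    by move=> [h0 h1]; move/negP : zl; apply; apply/mem_set; have [->|->] := I2P l.
  by move=> [h _]; move/negP : zl; apply; apply/mem_set.
have zl' := set_mem zl; have [zo|zo] := boolP (s \in Z (other l)).
  rewrite (mem_set (A := E2)) ?memNset ?add0r//; first by move=> [_]; apply; exact: set_mem zo.
  by move: zl' (set_mem zo); rewrite /other; have [->|->] := I2P l.
have zo' : ~ Z (other l) s by move=> h; move/negP : zo; apply; exact/mem_set.
rewrite mem_set ?memNset ?addr0//.
by move: zo'; rewrite /other => h [h0 h1]; apply: h; case: ifP.
Qed.

(* The direction of the push, as a combination of indicator functions. *)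
Let unitE l s : (enorm (v s))^-1 * v s 0 l =
  0 - (c l / c l * \1_(E1 l) s + c l / C * \1_E2 s).
Proof.
rewrite vE ZE sub0r mulNr mulrN; congr (- _); rewrite !mulrDr.
rewrite !indicE; congr (_ + _).
  case: (boolP (s \in E1 l)) => [/set_mem/enormE1 ->|_]; last by rewrite !mulr0.
  by rewrite !mulr1 mulrC.
case: (boolP (s \in E2)) => [/set_mem/enormE2 ->|_]; last by rewrite !mulr0.
by rewrite !mulr1 mulrC.
Qed.

(* A normal for the times without push, at which any one would do. *)
Let dflt (y : 'rV[R]_2) : 'rV[R]_2 := \row_l
  (if l == 0 then (if y 0 0 == 0 then -1 else if y 0 0 == 1 then 1 else 0)
   else if (y 0 0 == 0) || (y 0 0 == 1) then 0
   else if y 0 1 == 0 then -1 else if y 0 1 == 1 then 1 else 0).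

Let dflt_normal (y : 'rV[R]_2) : bd_square y -> normals y (dflt y).
Proof.
move=> [sy oy]; have /andP[y00 y01] := sy 0; have /andP[y10 y11] := sy 1.
have n10 : (1 == 0 :> R) = false by exact: oner_eq0.
split.
  rewrite /enorm dotpE !mxE/=.
  have [e0|e0] := eqVneq (y 0 0) 0; first by rewrite /= mulrNN !mulr0 mulr1 addr0 sqrtr1.
  have [e1|e1] := eqVneq (y 0 0) 1; first by rewrite /= !mulr0 mulr1 addr0 sqrtr1.
  have [e2|e2] := eqVneq (y 0 1) 0; first by rewrite /= mulrNN !mulr0 mulr1 add0r sqrtr1.
  have [e3|e3] := eqVneq (y 0 1) 1; first by rewrite /= !mulr0 mulr1 add0r sqrtr1.
  exfalso; apply: oy => l.
  by have [->|->] := I2P l; rewrite !lt_neqAle eq_sym ?e0 ?e1 ?e2 ?e3 ?y00 ?y01 ?y10 ?y11.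
move=> l; rewrite mxE; have [->|->] := I2P l; rewrite /=; split.
- by move=> /andP[h0 h1]; rewrite gt_eqF// lt_eqF.
- by move=> ->; rewrite eqxx lerN10.
- by move=> ->; rewrite n10 eqxx.
- by move=> /andP[h0 h1]; case: ifP => // _; rewrite gt_eqF// lt_eqF.
- by move=> ->; case: ifP => // _; rewrite eqxx lerN10.
- by move=> ->; case: ifP => // _; rewrite n10 eqxx.
Qed.

Let n s : 'rV[R]_2 := if enorm (v s) == 0 then dflt (x s) else (enorm (v s))^-1 *: v s.

Let mb (f : R -> R) (a : R) : measurable_fun setT f -> measurable_fun setT (fun s => f s == a).
Proof. by move=> mf; apply: measurable_fun_eqr. Qed.

Let mtwo (a b : R) (A B : set (measurableTypeR R)) : measurable A -> measurable B ->
  measurable_fun setT (fun s => 0 - (a * \1_A s + b * \1_B s) : R).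
Proof.
move=> mA mB; apply: measurable_funB; first exact: measurable_cst.
apply: measurable_funD; (apply: measurable_funM; first exact: measurable_cst).
  exact: measurable_indic mA.
exact: measurable_indic mB.
Qed.

Let mn l : measurable_fun setT (fun s => n s 0 l).
Proof.
rewrite (_ : (fun s => _) = (fun s => if enorm (v s) == 0 then dflt (x s) 0 l
    else (enorm (v s))^-1 * v s 0 l)); last first.
  by apply/funext => s; rewrite /n; case: ifP => //; rewrite mxE.
apply: measurable_fun_ifT; first exact: mb.
  under eq_fun do rewrite mxE.
  case: (l == 0).
    apply: measurable_fun_ifT => //; first exact: mb.
    by apply: measurable_fun_ifT => //; exact: mb.
  apply: measurable_fun_ifT => //.
    by apply: measurable_or; exact: mb.
  apply: measurable_fun_ifT => //; first exact: mb.
  by apply: measurable_fun_ifT => //; exact: mb.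
under eq_fun do rewrite unitE.
exact: mtwo.
Qed.

Let n_normal s : bd_square (x s) -> normals (x s) (n s).
Proof.
move=> bx; rewrite /n; case: ifPn => [_|e0]; first exact: dflt_normal.
have e1 : 0 < enorm (v s) by rewrite lt_neqAle eq_sym e0 sqrtr_ge0.
split.
  have h : enorm ((enorm (v s))^-1 *: v s) ^+ 2 = 1.
    rewrite sqr_enorm (_ : dotp _ _ = (enorm (v s))^-1 ^+ 2 * dotp (v s) (v s)); last first.
      by rewrite !dotpE !mxE; ring.
    by rewrite -sqr_enorm -exprMn mulVf// expr1n.
  by apply/eqP; rewrite -(@eqrXn2 _ 2) ?sqrtr_ge0// ?expr1n ?h.
move=> l; rewrite !mxE; split => [/andP[h0 _]|_|->].
- by rewrite gt_eqF// mulr0.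
- by case: ifP; rewrite ?mulr0// mulr_ge0_le0// ?oppr_le0// invr_ge0 ltW.
- by rewrite oner_eq0 mulr0.
Qed.

Let integral_two_indic (mu : {measure set (measurableTypeR R) -> \bar R})
    (I A B : set (measurableTypeR R)) (a b : R) :
  measurable I -> measurable A -> measurable B -> 0 <= a -> 0 <= b ->
  (\int[mu]_(s in I) (0 - (a * \1_A s + b * \1_B s))%:E =
   - (a%:E * mu (A `&` I) + b%:E * mu (B `&` I)))%E.
Proof.
move=> mI mA mB a0 b0.
have i0 (D : set (measurableTypeR R)) s : (0 <= (\1_D s : R))%R by rewrite indicE.
under eq_integral do rewrite sub0r EFinN.
rewrite integral_ge0N; last by move=> s _; rewrite lee_fin addr_ge0 ?mulr_ge0.
congr (- _)%E; under eq_integral do rewrite EFinD !EFinM.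
have mi (D : set (measurableTypeR R)) : measurable D ->
    measurable_fun I (fun s => ((\1_D s : R)%:E)).
  by move=> mD; apply/measurable_EFinP; apply: measurable_funTS; exact: (measurable_indic mD).
rewrite ge0_integralD//; first last.
- exact: measurable_funeM (mi _ mB).
- by move=> s _; rewrite mule_ge0// lee_fin.
- exact: measurable_funeM (mi _ mA).
- by move=> s _; rewrite mule_ge0// lee_fin.
rewrite !ge0_integralZl//; [|exact: mi|exact: mi].
by rewrite !integral_indic.
Qed.

Let mcst (A I : set (measurableTypeR R)) (a : R) : measurable A -> measurable I ->
  (forall s, A s -> enorm (v s) = a) -> m (A `&` I) = (a%:E * leb (A `&` I))%E.
Proof.
move=> mA mI va; rewrite mEq -integral_cst//; last exact: measurableI.
by apply: eq_integral => s /set_mem[/va ->].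
Qed.

Let speed0 s : ~ bd_square (x s) -> enorm (v s) = 0.
Proof.
move=> nb; suff h l : v s 0 l = 0 by rewrite /enorm dotpE !h mulr0 addr0 sqrtr0.
rewrite mxE; case: ifPn => // /eqP xl; exfalso; apply: nb; split; first exact: sqx.
by move/(_ l); rewrite xl ltxx.
Qed.

Let dispE l t : 0 <= t -> k t 0 l = \int[leb]_(s in `]0, t]) v s 0 l.
Proof.
move=> t0; rewrite mxE.
have vlM s : `|v s 0 l| <= M := le_trans (norm_coord_le_enorm _ _) (vM s).
by rewrite -(prim_diff (mv l) vlM (lexx 0) t0) (prim_le0 _ (lexx 0)) subr0.
Qed.

Let push_integral l t : 0 <= t -> k t 0 l = \int[m]_(s in `]0, t]) n s 0 l.
Proof.
move=> t0; rewrite dispE//; congr fine.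
have mI : measurable (`]0, t]%classic : set (measurableTypeR R)) by exact: measurable_itv.
have C0 : 0 <= C by exact: enorm_ge0.
transitivity (\int[m]_(s in `]0%R, t]) (0 - (c l / c l * \1_(E1 l) s + c l / C * \1_E2 s))%:E)%E; last first.
  apply: ae_eq_integral => //.
  - by apply/measurable_EFinP; apply: measurable_funTS; exact: mtwo.
  - apply/measurable_EFinP; exact: (measurable_funTS (mn l)).
  exists [set s | enorm (v s) == 0]; split.
  - have := mspeed measurableT (measurable_set1 (0 : R)).
    by rewrite setTI (_ : _ @^-1` _ = [set s | enorm (v s) == 0])//;
      apply/seteqP; split => s /=; move/eqP.
  - rewrite mEq; rewrite (eq_integral (cst 0%E)) ?integral0//.
    by move=> s /set_mem /= /eqP ->.
  - move=> s /= /not_implyP[_ h]; apply/negPn/negP => e0; apply: h.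
    by congr EFin; rewrite -unitE /n (negbTE e0) [RHS]mxE.
rewrite integral_two_indic ?divr_ge0//.
rewrite (@mcst _ _ (c l))//; last by move=> s; exact: enormE1.
rewrite (@mcst _ _ C)//.
rewrite !muleA -!EFinM.
have -> : c l / c l * c l = c l.
  by have [->|cl] := eqVneq (c l) 0; [rewrite mulr0|rewrite divfK].
have -> : c l / C * C = c l.
  have [C00|Cn] := eqVneq C 0; last by rewrite divfK.
  rewrite C00 mulr0; apply/eqP; rewrite eq_sym -normr_le0 -C00.
  by have := norm_coord_le_enorm (\row_l c l) l; rewrite mxE.
rewrite -integral_two_indic//; apply: eq_integral => s _; congr EFin.
by rewrite vE ZE; ring.
Qed.

(** Pushing at a constant rate along each wall solves the Skorokhod problem for the
sum of the path and of the accumulated push. The measure d|k| has the speed of the push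
as its density, and the normal is the direction of the push, at the times when there is
one. *)
Lemma push_reflection (D : set R) : measurable D -> (forall t, D t -> 0 <= t) ->
  reflection D (fun t => x t + k t) x.
Proof.
move=> mD D0; exists k.
have vlM l s : `|v s 0 l| <= M := le_trans (norm_coord_le_enorm _ _) (vM s).
have TV a b : 0 <= a -> a <= b -> m `]a, b]%classic = etotal_variation a b k.
  move=> a0 ab; rewrite (etotal_variation_displacement mv vM)// /Rintegral fineK//.
  apply: integrable_fin_num => //.
  apply: (bounded_integrable_itv (M := M)) => // s.
  by rewrite ger0_norm ?enorm_ge0.
split.
- split; apply: continuous_subspaceT; apply: continuous_row => // l.
  apply: (lipschitz_continuous (M := M)) => s t; rewrite !mxE.
  exact: prim_lipschitz.
- by move=> t Dt; split.
- by move=> t Dt; rewrite (etotal_variation_displacement mv vM)// ?ltry// D0.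
exists m, n; split => //.
- by move=> a b a0 ab _; exact: TV.
- by move=> l; apply: measurable_funTS.
- by move=> s _; exact: n_normal.
- by move=> t Dt l; apply: push_integral; exact: D0.
move=> t Dt; rewrite -TV//; last exact: D0.
have mI : measurable (`]0, t]%classic : set (measurableTypeR R)) by exact: measurable_itv.
have mB : measurable ([set r | bd_square (x r)] : set (measurableTypeR R)).
  rewrite (_ : [set r | _] = Z 0 `|` Z 1 `|`
     ([set r | x r 0 0 == 1] `|` [set r | x r 0 1 == 1])); last first.
    apply/seteqP; split => r.
      move=> [sx ox]; apply: contrapT => h; apply: ox => l.
      have /andP[h0 h1] := sx l; rewrite !lt_neqAle h0 h1 !andbT eq_sym.
      apply/andP; split; apply/negP => e; apply: h.
        by left; move: e; have [->|->] := I2P l => e; [left|right].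
      by right; move: e; have [->|->] := I2P l => e; [left|right].
    rewrite /Z /= => h; split; first exact: sqx.
    by move=> ox; have := ox 0; have := ox 1; move: h =>
      [[/eqP ->|/eqP ->]|[/eqP ->|/eqP ->]]; rewrite ltxx ?andbF.
  have m1 l : measurable ([set r | x r 0 l == 1] : set (measurableTypeR R)).
    have := mx l measurableT (measurable_set1 (1 : R)).
    by rewrite setTI (_ : _ @^-1` _ = [set r | x r 0 l == 1])//;
      apply/seteqP; split => s /=; move/eqP.
  by apply: measurableU; apply: measurableU.
rewrite integral_indic// mEq mEq setIC integral_mkcondr; apply: eq_integral => s _.
rewrite patchE; case: ifPn => // /negP h; congr EFin; apply: speed0 => b; apply: h.
exact/mem_set.
Qed.

End Push.

(** * Absolutely continuous paths and the potential *)

Section ScalarTools.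
Context {R : realType}.
Local Notation leb := (@lebesgue_measure R).
Implicit Types (s t : R).

Lemma ae_neq (b : R) : {ae leb, forall t, t != b}.
Proof.
exists [set b]; split; [exact: measurable_set1|exact: lebesgue_measure_set1|].
by move=> t /= /negP; rewrite negbK => /eqP.
Qed.

Lemma is_derive1P (f : R -> R) t : derivable f t 1 -> is_derive t (1 : R) f (derive1 f t).
Proof. by move=> df; apply: DeriveDef; [exact: df|rewrite derive1E]. Qed.

Lemma rabs_continuous_constant a b (f : R -> R) : a <= b -> rabs_continuous a b f ->
  {ae leb, forall t, a < t < b -> derivable f t 1 -> derive1 f t = 0} -> f a = f b.
Proof.
move=> ab cf h; apply/eqP; rewrite eq_le; apply/andP; split.
  by apply: rabs_continuous_nondecreasing => //; apply: ae_sub h => t ft tab df; rewrite ft.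
rewrite -lerN2; apply: (rabs_continuous_nondecreasing ab (rabs_continuousN cf)).
apply: ae_sub h => t ft tab dNf.
have df : derivable f t 1.
  by have := derivableN dNf; rewrite (_ : - (\- f) = f)//; apply/funext => s; exact: opprK.
have dN := is_deriveN (is_derive1P df).
have -> : derive1 (\- f) t = - derive1 f t by rewrite [LHS]derive1E derive_val.
by rewrite ft// oppr0.
Qed.

End ScalarTools.

Section Potential.
Context {R : realType}.
Local Notation leb := (@lebesgue_measure R).
Variables (g : R -> R) (K : R).
Hypothesis g01 : forall z, 0 <= z <= 1 -> 0 <= g z < 1.
Hypothesis glip : forall y z, 0 <= y <= 1 -> 0 <= z <= 1 -> `|g y - g z| <= K * `|y - z|.
Implicit Types (s t y z : R).

(** The gradient of the potential, extended to the line by clamping. *)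
Definition slope_ext y : R := 2 * artanh (gext g y).

Definition potential z : R := prim slope_ext z.

Lemma slope_ext_id y : 0 <= y <= 1 -> slope_ext y = 2 * artanh (g y).
Proof. by move=> y01; rewrite /slope_ext gext_id. Qed.

Lemma slope_ext_ge0 y : 0 <= slope_ext y.
Proof.
have y01 := gext01 g01 y; apply: le_trans (artanh_ge y01).
by have /andP[] := y01.
Qed.

Lemma slope_ext_continuous : continuous slope_ext.
Proof.
move=> y; have /andP[G0 G1] := gext01 g01 y.
have cG : {for y, continuous (gext g)} by exact: gext_continuous glip _.
have p1 : 0 < 1 - gext g y by rewrite subr_gt0.
apply: cvgM; first exact: cvg_cst.
apply: cvgM; first exact: cvg_cst.
apply: (@continuous_comp _ _ _ (fun z => (1 + gext g z) / (1 - gext g z)) (@ln R)).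
  apply: cvgM; first by apply: cvgD; [exact: cvg_cst|exact: cG].
  apply: cvgV; first by rewrite gt_eqF.
  by apply: cvgB; [exact: cvg_cst|exact: cG].
by apply: continuous_ln; rewrite divr_gt0// ltr_pwDl.
Qed.

Lemma slope_ext_measurable : measurable_fun setT slope_ext.
Proof. by apply: continuous_measurable_fun; exact: slope_ext_continuous. Qed.

Lemma slope_ext_bounded : exists M, forall y, `|slope_ext y| <= M.
Proof.
have [|c _ cM] := @EVT_max R slope_ext 0 1 ler01.
  by apply: continuous_subspaceT; exact: slope_ext_continuous.
exists (slope_ext c) => y; rewrite ger0_norm ?slope_ext_ge0//.
have y01 := @clamp_itv R 0 1 y ler01.
have -> : slope_ext y = slope_ext (clamp 0 1 y) by rewrite /slope_ext (gext_id _ y01).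
by apply: cM; rewrite in_itv.
Qed.

Lemma potential_ge0 z : 0 <= potential z.
Proof. by apply: Rintegral_ge0 => y _; exact: slope_ext_ge0. Qed.

Lemma potential0 : potential 0 = 0.
Proof. exact: prim_le0. Qed.

Lemma potential_lipschitz : exists M, forall y z, `|potential z - potential y| <= M * `|z - y|.
Proof.
have [M rM] := slope_ext_bounded; exists M => y z.
exact: prim_lipschitz slope_ext_measurable rM.
Qed.

(** The chain rule. Where the path vanishes, both the path and its potential are at a
minimum, so that both derivatives are zero. *)
Lemma potential_path (a b : R) (phi : R -> R) : a <= b -> rabs_continuous a b phi ->
  (forall t, a <= t <= b -> 0 <= phi t <= 1) ->
  exists h : R -> R, [/\ leb.-integrable setT (EFin \o h),
    potential (phi b) - potential (phi a) = \int[leb]_(t in `]a, b]) h t &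
    {ae leb, forall t, a < t < b -> derivable phi t 1 /\
       h t = slope_ext (phi t) * derive1 phi t}].
Proof.
move=> ab cphi phi01; have [M potM] := potential_lipschitz.
have cpot : rabs_continuous a b (potential \o phi).
  apply: (rabs_continuous_dominated (K := `|M|) cphi cphi) => p q _ _ _ /=.
  apply: le_trans (potM _ _) _; have := normr_ge0 (phi q - phi p).
  set n := `|phi q - phi p| => n0.
  have h : M * n <= `|M| * n by rewrite ler_wpM2r// ler_norm.
  by apply: le_trans h _; rewrite mulrDr lerDl mulr_ge0.
have [h [ih hE hD]] := rabs_continuous_FTC ab cpot.
have [h0 [_ _ phiD]] := rabs_continuous_FTC ab cphi.
exists h; split => //; first exact: (hE a b (lexx a) ab (lexx b)).
apply: ae_sub (ae_and hD phiD) => t [h1 h2] tab.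
have [dpot <-] := h1 tab; have [dphi _] := h2 tab; split => //.
have /andP[at_ tb] := tab.
have /andP[p0 p1] : 0 <= phi t <= 1 by apply: phi01; rewrite !ltW.
have [pt|pt] := ltP 0 (phi t); last first.
  have pt0 : phi t = 0 by apply/eqP; rewrite eq_le pt p0.
  rewrite (derive1_eq0_min dphi) ?mulr0; last first.
    rewrite pt0; apply: filterS (near_itvoo tab) => s /andP[/ltW as_ /ltW sb].
    by have /andP[] : 0 <= phi s <= 1 by apply: phi01; rewrite as_ sb.
  apply: (derive1_eq0_min dpot); apply: (@nearW R (nbhs t)) => s /=.
  by rewrite pt0 potential0 potential_ge0.
have [M' rM] := slope_ext_bounded.
have dP := prim_derive slope_ext_measurable rM pt (@slope_ext_continuous (phi t)).
have := @is_derive1_comp R potential phi t _ _ dP (is_derive1P dphi).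
by move=> d; rewrite [LHS]derive1E derive_val.
Qed.

End Potential.

Section VectorPaths.
Context {R : realType}.
Implicit Types (f : R -> 'rV[R]_2) (a b t : R) (l : 'I_2).

Lemma abs_continuous_coordinate a b f l :
  abs_continuous a b f -> rabs_continuous a b (fun t => f t 0 l).
Proof.
move=> cf e e0; have [d d0 hd] := cf e e0; exists d => // s [sab sp] sd.
apply: le_lt_trans (hd s sab sp sd); apply: ler_sum => p _.
by have := norm_coord_le_enorm (f p.2 - f p.1) l; rewrite !mxE.
Qed.

Lemma abs_continuous_coordinates a b f :
  (forall l, rabs_continuous a b (fun t => f t 0 l)) -> abs_continuous a b f.
Proof.
move=> cf e e0; have e2 : 0 < e / 2 by rewrite divr_gt0.
have [d0 d00 h0] := cf 0 (e / 2) e2; have [d1 d10 h1] := cf 1 (e / 2) e2.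
exists (Num.min d0 d1); first by rewrite lt_min d00.
move=> s sab sp; rewrite lt_min => /andP[s0 s1].
have i0 := h0 s (conj sab sp) s0; have i1 := h1 s (conj sab sp) s1.
rewrite (splitr e); apply: le_lt_trans (ltrD i0 i1).
rewrite -big_split/=; apply: ler_sum => p _; apply: le_trans (enorm_le_sum _) _.
by rewrite !mxE.
Qed.

Lemma derive1_coordinate f t l : (forall k, derivable (fun s => f s 0 k) t 1) ->
  derive1 f t 0 l = derive1 (fun s => f s 0 l) t.
Proof.
move=> df; have dF : derivable f t 1.
  by apply/derivable_mxP => i j; rewrite (ord1 i); exact: df.
by rewrite !derive1E derive_mx// mxE.
Qed.

End VectorPaths.

(** * Uniqueness of the motions along the drift *)

Section Comparison.
Context {R : realType}.
Local Notation leb := (@lebesgue_measure R).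
Variables (g : R -> R) (K kap : R).
Hypothesis g01 : forall z, 0 <= z <= 1 -> 0 <= g z < 1.
Hypothesis glip : forall y z, 0 <= y <= 1 -> 0 <= z <= 1 -> `|g y - g z| <= K * `|y - z|.
Hypothesis kap01 : 0 < kap <= 1.
Implicit Types (s t a b : R) (u v : R -> R).

(** A motion which is held at 0 instead of moving away only gets closer to the others:
monotonicity of the reflection compensates the discontinuity of the velocity at 0. *)
Lemma velocity_gap (x y dx dy : R) : 0 <= x <= 1 -> 0 <= y <= 1 ->
  (x = 0 /\ dx = 0) \/ dx = kap * g x -> (y = 0 /\ dy = 0) \/ dy = kap * g y ->
  - `|K| * (x - y) ^+ 2 <= (x - y) * (dx - dy).
Proof.
move=> x01 y01 hx hy; have /andP[k0 k1] := kap01.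
have /andP[gx0 _] := g01 x01; have /andP[gy0 _] := g01 y01.
have /andP[x0 x1] := x01; have /andP[y0 y1] := y01.
have kx0 : 0 <= kap * g x by rewrite mulr_ge0// ltW.
have ky0 : 0 <= kap * g y by rewrite mulr_ge0// ltW.
have nK : 0 <= `|K| * (x - y) ^+ 2 by rewrite mulr_ge0// sqr_ge0.
case: hx hy => [[xE ->]|->] [[yE ->]|->].
- by rewrite subrr mulr0 mulNr oppr_le0.
- rewrite xE in nK *; apply: (@le_trans _ _ 0); first by rewrite mulNr oppr_le0.
  by rewrite !sub0r mulrNN mulr_ge0.
- rewrite yE in nK *; apply: (@le_trans _ _ 0); first by rewrite mulNr oppr_le0.
  by rewrite !subr0 mulr_ge0.
rewrite mulNr lerNl -mulrN opprB -mulrBr mulrCA.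
apply: (@le_trans _ _ (`|x - y| * `|g y - g x|)).
  apply: (@le_trans _ _ (kap * (`|x - y| * `|g y - g x|))).
    by rewrite ler_wpM2l ?(ltW k0)// -normrM ler_norm.
  by rewrite ler_piMl// mulr_ge0.
rewrite (distrC (g y)) -(real_normK (num_real (x - y))) expr2 mulrCA ler_wpM2l//.
apply: le_trans (glip x01 y01) _.
by rewrite ler_wpM2r// ler_norm.
Qed.

Variables (a b : R) (u v : R -> R).
Hypothesis ab : a <= b.
Hypothesis cu : rabs_continuous a b u.
Hypothesis cv : rabs_continuous a b v.
Hypothesis u01 : forall t, a <= t <= b -> 0 <= u t <= 1.
Hypothesis v01 : forall t, a <= t <= b -> 0 <= v t <= 1.

Let d := u \- v.

Let cd : rabs_continuous a b d.
Proof. exact: rabs_continuousD cu (rabs_continuousN cv). Qed.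

Let d1 t : a <= t <= b -> `|d t| <= 1.
Proof.
move=> tab; have /andP[? ?] := u01 tab; have /andP[? ?] := v01 tab.
by rewrite /d /= ler_norml; apply/andP; split; lra.
Qed.

Let cq : rabs_continuous a b (d \* d).
Proof. by apply: (rabs_continuousM (M := 1)) => // t /d1 h. Qed.

Let q1 t : a <= t <= b -> `|(d \* d) t| <= 1.
Proof. by move=> /d1 h; rewrite /= normrM mulr_ile1. Qed.

Let dq : {ae leb, forall t, a < t < b -> [/\ derivable u t 1, derivable v t 1 &
  is_derive t (1 : R) (d \* d) (2 * (d t * (derive1 u t - derive1 v t)))]}.
Proof.
have [h [_ _ hu]] := rabs_continuous_FTC ab cu.
have [h' [_ _ hv]] := rabs_continuous_FTC ab cv.
apply: ae_sub (ae_and hu hv) => t [{}hu {}hv] tab.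
have [du _] := hu tab; have [dv _] := hv tab; split; [exact: du|exact: dv|].
have dd := is_deriveB (is_derive1P du) (is_derive1P dv).
have := is_deriveM dd dd; set e := derive1 u t - derive1 v t.
by rewrite /GRing.scale/= (_ : 2 * (d t * e) = (u t - v t) * e + (u t - v t) * e)//;
  rewrite /d/=; ring.
Qed.

Let sqr_le0 (x : R) : x ^+ 2 <= 0 -> x = 0.
Proof. by move=> h; apply/eqP; rewrite -sqrf_eq0 eq_le h sqr_ge0. Qed.

Lemma climb_unique :
  {ae leb, forall t, a < t < b -> derivable u t 1 ->
     (u t = 0 /\ derive1 u t = 0) \/ derive1 u t = kap * g (u t)} ->
  {ae leb, forall t, a < t < b -> derivable v t 1 ->
     (v t = 0 /\ derive1 v t = 0) \/ derive1 v t = kap * g (v t)} ->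
  u b = v b -> u a = v a.
Proof.
move=> hu hv uvb.
have : (\- (d \* d)) b * expR (- (- (2 * `|K|)) * b) <= (\- (d \* d)) a * expR (- (- (2 * `|K|)) * a).
  apply: (gronwall (M := 1) ab).
  - exact: rabs_continuousN cq.
  - by move=> t /q1; rewrite /= normrN.
  apply: ae_sub (ae_and dq (ae_and hu hv)) => t [hq [{}hu {}hv]] tab _.
  have [du dv dqt] := hq tab; have dqN := is_deriveN dqt.
  have -> : derive1 (\- (d \* d)) t = - (2 * (d t * (derive1 u t - derive1 v t))).
    by rewrite [LHS]derive1E derive_val.
  have tab' : a <= t <= b by have /andP[h1 h2] := tab; rewrite !ltW.
  have := velocity_gap (u01 tab') (v01 tab') (hu tab du) (hv tab dv).
  rewrite /d /=; set X := (u t - v t) * (_ - _); set Y := u t - v t.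
  by rewrite expr2; set Z := Y * Y; lra.
have -> : (\- (d \* d)) b = 0 by rewrite /d /= uvb subrr mulr0 oppr0.
rewrite mul0r pmulr_lge0 ?expR_gt0//= oppr_ge0 -expr2 => /sqr_le0.
by rewrite /d /= => /subr0_eq.
Qed.

Lemma descent_unique :
  {ae leb, forall t, a < t < b -> derivable u t 1 ->
     (u t = 0 /\ derive1 u t = 0) \/ derive1 u t = - (kap * g (u t))} ->
  {ae leb, forall t, a < t < b -> derivable v t 1 ->
     (v t = 0 /\ derive1 v t = 0) \/ derive1 v t = - (kap * g (v t))} ->
  u a = v a -> u b = v b.
Proof.
move=> hu hv uva.
have : (d \* d) b * expR (- (2 * `|K|) * b) <= (d \* d) a * expR (- (2 * `|K|) * a).
  apply: (gronwall (M := 1) ab cq q1).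
  apply: ae_sub (ae_and dq (ae_and hu hv)) => t [hq [{}hu {}hv]] tab _.
  have [du dv dqt] := hq tab.
  have -> : derive1 (d \* d) t = 2 * (d t * (derive1 u t - derive1 v t)).
    by rewrite [LHS]derive1E derive_val.
  have tab' : a <= t <= b by have /andP[h1 h2] := tab; rewrite !ltW.
  have opp (w dw : R) : (w = 0 /\ dw = 0) \/ dw = - (kap * g w) ->
      (w = 0 /\ - dw = 0) \/ - dw = kap * g w.
    by move=> [[-> ->]|->]; [left; rewrite oppr0|right; rewrite opprK].
  have := velocity_gap (u01 tab') (v01 tab') (opp _ _ (hu tab du)) (opp _ _ (hv tab dv)).
  rewrite /d /= (_ : - derive1 u t - - derive1 v t = - (derive1 u t - derive1 v t)); last by ring.
  rewrite mulrN; set X := (u t - v t) * (_ - _); set Y := u t - v t.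
  by rewrite expr2; set Z := Y * Y; lra.
have -> : (d \* d) a = 0 by rewrite /d /= uva subrr mulr0.
rewrite mul0r pmulr_lle0 ?expR_gt0//= -expr2 => /sqr_le0.
by rewrite /d /= => /subr0_eq.
Qed.

End Comparison.

Section TrajectoryVelocity.
Context {R : realType}.
Variables (g : R -> R) (K kap x0 : R).
Hypothesis g01 : forall z, 0 <= z <= 1 -> 0 <= g z < 1.
Hypothesis glip : forall y z, 0 <= y <= 1 -> 0 <= z <= 1 -> `|g y - g z| <= K * `|y - z|.
Hypothesis kap01 : 0 < kap <= 1.
Hypothesis x01 : 0 <= x0 <= 1.
Implicit Types t : R.

Local Notation z := (traj g kap x0).

Lemma traj_velocity t : 0 < t -> derivable z t 1 ->
  derive1 z t = if z t == 0 then 0 else - (kap * g (z t)).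
Proof.
move=> t0 dz; have zge0 s : 0 <= z s by have /andP[] := traj01 g01 glip kap01 x01 s.
case: ifPn => [/eqP zt|zt].
  by apply: (derive1_eq0_min dz); apply: (@nearW R (nbhs t)) => s; rewrite zt.
have zt0 : 0 < z t by rewrite lt_neqAle eq_sym zt zge0.
have := traj_derive g01 glip kap01 x01 t0 zt0.
by move=> h; rewrite [LHS]derive1E derive_val.
Qed.

Lemma reversed_traj_velocity (S t : R) : t < S -> derivable (fun s => z (S - s)) t 1 ->
  derive1 (fun s => z (S - s)) t = if z (S - t) == 0 then 0 else kap * g (z (S - t)).
Proof.
move=> tS dz; have zge0 s : 0 <= z s by have /andP[] := traj01 g01 glip kap01 x01 s.
case: ifPn => [/eqP zt|zt].
  by apply: (derive1_eq0_min dz); apply: (@nearW R (nbhs t)) => s /=; rewrite zt.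
have zt0 : 0 < z (S - t) by rewrite lt_neqAle eq_sym zt zge0.
have tS0 : 0 < S - t by rewrite subr_gt0.
have dzt := traj_derive g01 glip kap01 x01 tS0 zt0.
have dN : is_derive t (1 : R) (fun s : R => S - s) (- 1).
  by rewrite -[-1]add0r; exact: is_deriveB.
have := @is_derive1_comp R z (fun s => S - s) t _ _ dzt dN.
rewrite mulrN1 opprK => h; have -> : (fun s => z (S - s)) = z \o (fun s => S - s) by [].
by rewrite [LHS]derive1E derive_val.
Qed.

End TrajectoryVelocity.

(** * The action of the paths and the explicit potential *)

Section HalfLine.
Context {R : realType}.
Local Notation leb := (@lebesgue_measure R).

Lemma ge0_integral_half_line (f : R -> R) (M : \bar R) : measurable_fun setT f ->
  (forall t, 0 <= f t) ->
  (forall n : nat, (\int[leb]_(t in `](- n%:R)%R, 0%R]) (f t)%:E <= M)%E) ->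
  (\int[leb]_(t in `]-oo, 0%R]) (f t)%:E <= M)%E.
Proof.
move=> mf f0 fM; pose F (n : nat) : set (measurableTypeR R) := `](- n%:R)%R, 0%R]%classic.
have -> : `]-oo, 0%R]%classic = \bigcup_n F n.
  apply/seteqP; split => [t|t [n _]]; rewrite /F/= !in_itv/=; last by move=> /andP[].
  move=> t0; exists (Num.bound (- t)) => //=; rewrite in_itv/= t0 andbT ltrNl.
  by apply: archi_boundP; rewrite oppr_ge0.
have nF : nondecreasing_seq F.
  apply/nondecreasing_seqP => n; rewrite subsetEset => t; rewrite /F/= !in_itv/=.
  by move=> /andP[nt ->]; rewrite andbT (le_lt_trans _ nt)// lerN2 ler_nat.
have mF n : measurable (F n) by exact: measurable_itv.
have mfn n : measurable_fun (F n) (EFin \o f).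
  by apply/measurable_EFinP; exact: measurable_funTS.
have := @ge0_nondecreasing_set_cvg_integral _ _ _ F (EFin \o f) leb nF mF mfn.
move=> h; apply: cvge_le (h _); last by move=> n t _; rewrite lee_fin.
by apply: nearW => n; exact: fM.
Qed.

End HalfLine.

Section TwoStacks.
Context {R : realType}.
Local Notation leb := (@lebesgue_measure R).
Variables (P : 'M[R]_2) (mu : 'rV[R]_2) (lam : 'I_2 -> R) (g : 'I_2 -> R -> R) (K : 'I_2 -> R).
Hypothesis Pstoch : stochastic_mx P.
Hypothesis Pirr : irreducible_mx P.
Hypothesis muP : invariant_probability P mu.
Hypothesis lam01 : forall i, 0 < lam i < 1.
Hypothesis g01 : forall (j : 'I_2) z, 0 <= z <= 1 -> 0 <= g j z < 1.
Hypothesis glip : forall j y z, 0 <= y <= 1 -> 0 <= z <= 1 -> `|g j y - g j z| <= K j * `|y - z|.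
Hypothesis gpos : forall j z, 0 < z <= 1 -> 0 < g j z.
Implicit Types (s t a b : R) (l : 'I_2) (x y v : 'rV[R]_2) (phi psi : R -> 'rV[R]_2).

Local Notation kap := (kappa mu lam).

Let kap01 l : 0 < kap l <= 1.
Proof. exact: kappa_gt0 Pstoch Pirr muP lam01 l. Qed.

Definition total_potential x := \sum_l potential (g l) (x 0 l).

Local Notation W := total_potential.
Local Notation L := (lagrangian P lam g).
Local Notation Lref := (lagrangian_ref P lam g).

Lemma explicit_potentialE x : square x -> explicit_potential g x = W x.
Proof.
move=> sx; rewrite /W sum_I2 /explicit_potential.
suff h l : 2 * (\int[leb]_(y in `[0, x 0 l]) artanh (g l y)) = potential (g l) (x 0 l).
  by rewrite !h.
have [M rM] := slope_ext_bounded (g01 l) (glip l).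
have mr := slope_ext_measurable (g01 l) (glip l).
have -> : \int[leb]_(y in `[0, x 0 l]) artanh (g l y) =
    \int[leb]_(y in `[0, x 0 l]) (2^-1 * slope_ext (g l) y).
  apply: eq_Rintegral => y /set_mem/=; rewrite in_itv/= => /andP[y0 yx].
  have /andP[_ x1] := sx l.
  by rewrite slope_ext_id ?y0 ?(le_trans yx x1)// mulrA mulVf ?mul1r.
rewrite RintegralZl//; last exact: bounded_integrable_itv mr rM.
by rewrite mulrA divff ?mul1r.
Qed.

Lemma total_potential_ge0 x : 0 <= W x.
Proof. by apply: sumr_ge0 => l _; exact: potential_ge0 (g01 l) _. Qed.

Lemma total_potential0 : W 0 = 0.
Proof. by rewrite /W sum_I2 !mxE !potential0 addr0. Qed.

Lemma total_potential_small (e : R) : 0 < e ->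
  exists2 d : R, 0 < d & forall x, (forall l, `|x 0 l| < d) -> W x < e.
Proof.
move=> e0.
have [M0 h0] := potential_lipschitz (g01 0) (glip 0).
have [M1 h1] := potential_lipschitz (g01 1) (glip 1).
pose M := `|M0| + `|M1| + 1.
have M0' := normr_ge0 M0; have M1' := normr_ge0 M1.
have Mp : 0 < M by rewrite ltr_wpDl// addr_ge0.
exists (e / M); first by rewrite divr_gt0.
move=> x xd; rewrite /W sum_I2.
have le l (N : R) : (forall y z : R, `|potential (g l) z - potential (g l) y| <= N * `|z - y|) ->
    potential (g l) (x 0 l) <= `|N| * (e / M).
  move=> h; have := h 0 (x 0 l); rewrite potential0 !subr0 => {}h.
  apply: le_trans (ler_norm _) _; apply: le_trans h _.
  apply: (@le_trans _ _ (`|N| * `|x 0 l|)); first by rewrite ler_wpM2r// ler_norm.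
  by rewrite ler_wpM2l// ltW.
apply: le_lt_trans (lerD (le 0 M0 h0) (le 1 M1 h1)) _.
rewrite -mulrDl mulrA ltr_pdivrMr// mulrC ltr_pM2l// /M.
by rewrite ltrDl.
Qed.

Lemma potential_paths a b phi : a <= b ->
  (forall l, rabs_continuous a b (fun t => phi t 0 l)) ->
  (forall t, a <= t <= b -> square (phi t)) ->
  exists h : R -> R, [/\ leb.-integrable setT (EFin \o h),
    W (phi b) - W (phi a) = \int[leb]_(t in `]a, b]) h t &
    {ae leb, forall t, a < t < b -> (forall l, derivable (fun s => phi s 0 l) t 1) /\
       h t = \sum_l slope g l (phi t 0 l) * derive1 (fun s => phi s 0 l) t}].
Proof.
move=> ab cphi sphi.
have s01 l t : a <= t <= b -> 0 <= phi t 0 l <= 1 by move=> /sphi; exact.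
have [h0 [i0 e0 d0]] := potential_path (g01 0) (glip 0) ab (cphi 0) (s01 0).
have [h1 [i1 e1 d1]] := potential_path (g01 1) (glip 1) ab (cphi 1) (s01 1).
exists (h0 \+ h1); split.
- exact: (integrableD measurableT i0 i1).
- rewrite RintegralD//; [|exact: integrable_itv i0|exact: integrable_itv i1].
  by rewrite -e0 -e1 /W !sum_I2; ring.
apply: ae_sub (ae_and d0 d1) => t [{}d0 {}d1] tab.
have [D0 E0] := d0 tab; have [D1 E1] := d1 tab; split.
  by move=> l; have [->|->] := I2P l.
have tab' : a <= t <= b by have /andP[h2 h3] := tab; rewrite !ltW.
by rewrite sum_I2 /= E0 E1 !slope_ext_id ?s01.
Qed.

Lemma near_potential_small phi a (e : R) : 0 < e -> phi t @[t --> -oo] --> (0 : 'rV[R]_2) ->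
  exists2 b : R, b <= a & W (phi b) < e.
Proof.
move=> e0 phi0; have [d d0 hd] := total_potential_small e0.
have : \forall t \near -oo, ball (0 : 'rV[R]_2) d (phi t) by move/cvg_ballP : phi0; exact.
move=> [A [Ar hA]]; exists (Num.min a (A - 1)); first by rewrite ge_min lexx.
apply: hd => l; have [] := hA (Num.min a (A - 1)).
  by rewrite gt_min ltrBlDr ltrDl ltr01 orbT.
by move=> _ /(_ 0 l); rewrite /ball/= mxE sub0r normrN.
Qed.

Let Lref_ge0 psi : (forall t, t <= 0 -> square (psi t)) ->
  forall t, `]-oo, 0]%classic t -> (0 <= Lref (psi t) (derive1 psi t))%E.
Proof.
move=> spsi t; rewrite /= in_itv/= => t0.
exact: (lagrangian_ref_ge0 Pstoch Pirr muP lam01 g01 _ (spsi t t0)).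
Qed.

(** The function m is the gap between the Lagrangian and its linear minorant, which along
the path is the derivative of the potential. The lower bound is integrated over ]b, 0],
where the potential is small at time b, and b tends to minus infinity. *)
Lemma action_ref_gap psi x a l : path_from0 x psi ->
  (forall b, b <= 0 -> abs_continuous b 0 psi) -> a <= 0 ->
  exists m : R -> R, [/\ leb.-integrable `]a, 0] (EFin \o m), forall t, 0 <= m t,
    ((W x + \int[leb]_(t in `]a, 0]) m t)%:E <=
      \int[leb]_(t in `]-oo, 0%R]) Lref (psi t) (derive1 psi t))%E &
    {ae leb, forall t, a < t < 0 -> m t = 0 ->
       (psi t 0 l = 0 /\ derive1 (fun s => psi s 0 l) t = 0) \/
       derive1 (fun s => psi s 0 l) t = kap l * g l (psi t 0 l)}].
Proof.
move=> [cpsi spsi psi0 psix] acpsi a0.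
have [c c0 cgap] := lagrangian_ref_ge Pstoch Pirr muP lam01 g01.
have acl b k : b <= 0 -> rabs_continuous b 0 (fun t => psi t 0 k).
  by move=> b0; exact: abs_continuous_coordinate (acpsi b b0).
have s01 t k : t <= 0 -> 0 <= psi t 0 k <= 1 by move=> t0; exact: spsi.
have [h [ih _ hD]] := rabs_continuous_FTC a0 (acl a l a0).
have mh : measurable_fun setT h by move/measurable_int : ih => /measurable_EFinP.
pose u t := psi (clamp a 0 t) 0 l.
have cu : continuous u by exact: (rabs_continuous_clamp a0 (acl a l a0)).
have mu_ : measurable_fun setT u by exact: continuous_measurable_fun.
have uE t : a <= t <= 0 -> u t = psi t 0 l by move=> ta; rewrite /u clamp_id.
pose D t := kap l * gext (g l) (u t) - h t.
have mD : measurable_fun setT D.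
  apply: measurable_funB => //; apply: measurable_funM => //.
  apply: (measurableT_comp (f := gext (g l))) => //.
  by apply: continuous_measurable_fun; exact: gext_continuous (glip l).
pose m t := if (u t == 0) && (h t == 0) then 0 else c * theta (D t).
have m0 t : 0 <= m t.
  by rewrite /m; case: ifP => // _; rewrite mulr_ge0 ?theta_ge0// ltW.
have mtheta : measurable_fun setT (@theta R).
  apply: continuous_measurable_fun => y; apply: cvgM; first exact: exprn_continuous.
  apply: cvgV; first by rewrite gt_eqF// ltr_pwDl.
  by apply: cvgD; [exact: cvg_cst|exact: norm_continuous].
have mm : measurable_fun setT m.
  apply: measurable_fun_ifT => //.
    by apply: measurable_and; apply: measurable_fun_eqr.
  by apply: measurable_funM => //; exact: (measurableT_comp mtheta mD).
have mI b c' : measurable (`]b, c']%classic : set (measurableTypeR R)) by exact: measurable_itv.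
have thetale (y : R) : theta y <= `|y|.
  rewrite /theta ler_pdivrMr ?ltr_pwDl// mulrDr mulr1 -(real_normK (num_real y)) expr2.
  by rewrite lerDr.
have im : leb.-integrable `]a, 0] (EFin \o m).
  apply: (@le_integrable _ _ _ leb _ (mI a 0) _ (EFin \o (fun t => c * (1 + `|h t|)))).
  - by apply/measurable_EFinP; exact: measurable_funTS.
  - move=> t _ /=; have E : 0 <= c * (1 + `|h t|) by rewrite mulr_ge0 ?(ltW c0)// addr_ge0.
    rewrite lee_fin (ger0_norm (m0 t)) (ger0_norm E) /m; case: ifP => _ //.
    rewrite ler_wpM2l ?(ltW c0)//; apply: le_trans (thetale _) _.
    rewrite /D; apply: le_trans (ler_normB _ _) _; rewrite lerD2r.
    have /andP[k0 k1] := kap01 l; have /andP[G0 G1] := gext01 (g01 l) (u t).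
    by rewrite ger0_norm ?mulr_ge0 ?(ltW k0)// mulr_ile1 ?(ltW k0) ?(ltW G1).
  apply: (@integrableZl _ _ _ leb _ (mI a 0) c (EFin \o (fun t => 1 + `|h t|))).
  apply: (@integrableD _ _ _ leb _ (mI a 0) (cst 1%:E) (EFin \o (fun t => `|h t|))).
    have := @bounded_integrable_itv R `|1| a 0 false false (cst 1) (measurable_cst _).
    by apply.
  have := integrable_abse (@integrable_itv _ (EFin \o h) `]a, 0] ih).
  by [].
exists m; split => //; last first.
  apply: ae_sub hD => t hD ta mt; have [dpsi hE] := hD ta.
  have ta' : a <= t <= 0 by have /andP[? ?] := ta; rewrite !ltW.
  have /andP[_ t0'] := ta'.
  move: mt; rewrite /m uE// hE; case: ifPn => [/andP[/eqP p0 /eqP h0] _|_].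
    by left.
  move/eqP; rewrite mulf_eq0 gt_eqF//= => /eqP/theta_eq0; rewrite /D uE// gext_id ?s01//.
  by move=> /subr0_eq ->; right.
rewrite -psix; apply/lee_addgt0Pr => e e0.
have [b ba We] := near_potential_small a e0 psi0.
have b0 := le_trans ba a0.
have [p [ip pE pD]] := potential_paths b0 (fun k => acl b k b0)
  (fun t tb => spsi t (proj2 (andP tb))).
pose q := p \+ (m \_ `]a, 0]).
have im' : leb.-integrable setT (EFin \o (m \_ `]a, 0]) ).
  have /integrable_mkcond := im; move=> /(_ (mI a 0)).
  by rewrite restrict_EFin.
have iq : leb.-integrable setT (EFin \o q) by exact: (integrableD measurableT ip im').
have qE : \int[leb]_(t in `]b, 0]) q t = W (psi 0) - W (psi b) + \int[leb]_(t in `]a, 0]) m t.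
  rewrite /q RintegralD//; [|exact: integrable_itv ip|exact: integrable_itv im'].
  rewrite -pE; congr (_ + _); rewrite [LHS]Rintegral_mkcond [RHS]Rintegral_mkcond.
  congr fine; apply: eq_integral => t _; congr EFin; rewrite !patchE.
  case: ifPn => // tb; case: ifPn => // ta; exfalso; move/negP : tb; apply.
  move: ta; rewrite !inE/= !in_itv/= => /andP[at_ ->]; rewrite andbT.
  exact: le_lt_trans at_.
have := @Rintegral_le_nonmeasurable R `]b, 0] `]-oo, 0] q
  (fun t => Lref (psi t) (derive1 psi t)) (mI b 0).
rewrite qE => main.
have {main} : ((W (psi 0) - W (psi b) + \int[leb]_(t in `]a, 0]) m t)%:E <=
    \int[leb]_(t in `]-oo, 0%R]) Lref (psi t) (derive1 psi t))%E.
  apply: main.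
  - by move=> t /=; rewrite !in_itv/= => /andP[].
  - exact: Lref_ge0.
  - exact: integrable_itv iq.
  apply: ae_sub (ae_and (ae_neq (0 : R)) (ae_and pD hD)) => t [tn0 [{}pD {}hD]].
  rewrite /= in_itv/= => /andP[bt t0].
  have tb0 : b < t < 0 by rewrite bt lt_neqAle tn0 t0.
  have [dpsi pt] := pD tb0.
  have dc := derive1_coordinate _ dpsi.
  apply: le_trans (cgap (psi t) (derive1 psi t) l (spsi t t0)).
  rewrite lee_fin /q /= pt; under [X in _ <= X + _]eq_bigr do rewrite dc.
  rewrite lerD2l patchE; case: ifPn => [|_]; last first.
    by case: ifP => // _; rewrite mulr_ge0 ?theta_ge0// ltW.
  rewrite inE/= in_itv/= => /andP[at_ _].
  have ta0 : a < t < 0 by rewrite at_ lt_neqAle tn0 t0.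
  have [_ hE] := hD ta0.
  have ta0' : a <= t <= 0 by rewrite ltW.
  by rewrite /m /D uE// gext_id ?s01// dc hE.
move=> main.
apply: (@le_trans _ _ ((W (psi 0) - W (psi b) + \int[leb]_(t in `]a, 0]) m t + e)%:E)).
  by rewrite lee_fin; lra.
by rewrite EFinD; exact: leeD2r.
Qed.

(** * The optimal path *)

Lemma action_ref_ge psi (x : 'rV[R]_2) : path_from0 x psi -> ((W x)%:E <= action_ref P lam g psi)%E.
Proof.
move=> psix; rewrite /action_ref; case: asboolP => [acpsi|_]; last by rewrite leey.
have [m [_ m0 h _]] :=
  action_ref_gap 0 psix acpsi (lexx 0).
by apply: le_trans h; rewrite lee_fin lerDl Rintegral_ge0.
Qed.

Section FromPoint.
Variable x : 'rV[R]_2.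
Hypothesis sx : square x.

(** The coordinates are decoupled, since the drift and the reflection along an axis
depend on one coordinate only. *)
Definition descent t : 'rV[R]_2 := \row_l traj (g l) (kap l) (x 0 l) t.

Local Notation climb := (fun t => descent (- t)).

Lemma descent_square t : square (descent t).
Proof. by move=> l; rewrite mxE (traj01 (g01 l) (glip l) (kap01 l) (sx l)). Qed.

Lemma descent_lipschitz l s t : `|descent t 0 l - descent s 0 l| <= `|t - s|.
Proof. by rewrite !mxE (traj_lipschitz (x 0 l) (g01 l) (glip l) (kap01 l)). Qed.

Lemma descent0 : descent 0 = x.
Proof.
by apply/rowP => l; rewrite mxE (traj_le0 (g01 l) (glip l) (kap01 l) (sx l)).
Qed.

Lemma descent_continuous l : continuous (fun t => descent t 0 l).
Proof.
by apply: (lipschitz_continuous (M := 1)) => s t; rewrite mul1r descent_lipschitz.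
Qed.

Lemma climb_lipschitz l s t : `|climb t 0 l - climb s 0 l| <= `|t - s|.
Proof.
apply: le_trans (descent_lipschitz _ _ _) _.
by rewrite -opprD normrN.
Qed.

Lemma climb_continuous l : continuous (fun t => climb t 0 l).
Proof.
by apply: (lipschitz_continuous (M := 1)) => s t; rewrite mul1r climb_lipschitz.
Qed.

Lemma climb_abs_continuous a : abs_continuous a 0 climb.
Proof.
apply: abs_continuous_coordinates => l.
apply: (rabs_continuous_lipschitz (K := 1)) => p q _ pq _.
by rewrite mul1r -[X in _ <= X]ger0_norm ?subr_ge0// climb_lipschitz.
Qed.

Lemma climb_path : path_from0 x climb.
Proof.
split.
- apply: continuous_subspaceT; apply: continuous_row => l; exact: climb_continuous.
- by move=> t _; exact: descent_square.
- apply/cvg_ballP => e e0.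
  have [T0 _ h0] := traj_cvg0 (g01 0) (glip 0) (@gpos 0) (kap01 0) (sx 0) e0.
  have [T1 _ h1] := traj_cvg0 (g01 1) (glip 1) (@gpos 1) (kap01 1) (sx 1) e0.
  exists (- Num.max T0 T1); split; first exact: num_real.
  move=> t; rewrite ltrNr gt_max => /andP[/ltW t0 /ltW t1].
  split=> // i j; rewrite (ord1 i) mxE /ball/= sub0r normrN ger0_norm; last first.
    by have /andP[] := descent_square (- t) j.
  by rewrite mxE; have [->|->] := I2P j; [exact: h0|exact: h1].
- by rewrite oppr0 descent0.
Qed.

Lemma climb_velocity l t : t < 0 -> derivable (fun s => climb s 0 l) t 1 ->
  derive1 (fun s => climb s 0 l) t =
    if climb t 0 l == 0 then 0 else kap l * g l (climb t 0 l).
Proof.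
move=> t0; have E : (fun s => climb s 0 l) = fun s => traj (g l) (kap l) (x 0 l) (0 - s).
  by apply/funext => s; rewrite mxE sub0r.
have Et : climb t 0 l = traj (g l) (kap l) (x 0 l) (0 - t) by rewrite mxE sub0r.
rewrite E Et => dz.
exact: (reversed_traj_velocity (g01 l) (glip l) (kap01 l) (sx l) t0 dz).
Qed.

Let cost t : R := \sum_l slope_ext (g l) (climb t 0 l) *
  (if climb t 0 l == 0 then 0 else kap l * gext (g l) (climb t 0 l)).

Let cost_ge0 t : 0 <= cost t.
Proof.
apply: sumr_ge0 => l _; apply: mulr_ge0; first exact: slope_ext_ge0 (g01 l) _.
case: ifP => // _; have /andP[k0 _] := kap01 l; rewrite mulr_ge0 ?(ltW k0)//.
by have /andP[] := gext01 (g01 l) (climb t 0 l).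
Qed.

Let mcost : measurable_fun setT cost.
Proof.
have mc l : measurable_fun setT (fun t => climb t 0 l).
  by apply: continuous_measurable_fun; exact: climb_continuous.
have ml l : measurable_fun setT (fun t => slope_ext (g l) (climb t 0 l) *
    (if climb t 0 l == 0 then 0 else kap l * gext (g l) (climb t 0 l))).
  apply: measurable_funM.
    exact: (measurableT_comp (slope_ext_measurable (g01 l) (glip l)) (mc l)).
  apply: measurable_fun_ifT => //.
    exact: (@measurable_fun_eqr _ _ _ setT _ (cst 0) (mc l) (measurable_cst _)).
  apply: measurable_funM; first exact: measurable_cst.
  apply: (measurableT_comp _ (mc l)).
  by apply: continuous_measurable_fun; exact: gext_continuous (glip l).
rewrite (_ : cost = (fun t => slope_ext (g 0) (climb t 0 0) *
    (if climb t 0 0 == 0 then 0 else kap 0 * gext (g 0) (climb t 0 0)) +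
    slope_ext (g 1) (climb t 0 1) *
    (if climb t 0 1 == 0 then 0 else kap 1 * gext (g 1) (climb t 0 1)))); last first.
  by apply/funext => t; exact: sum_I2.
exact: measurable_funD (ml 0) (ml 1).
Qed.

Let cost_climb n : (\int[leb]_(t in `](- n%:R)%R, 0%R]) (cost t)%:E <= (W x)%:E)%E.
Proof.
have n0 : - n%:R <= 0 :> R by rewrite oppr_le0.
have acl l : rabs_continuous (- n%:R) 0 (fun t => climb t 0 l).
  exact: abs_continuous_coordinate (climb_abs_continuous _).
have [p [ip pE pD]] := potential_paths n0 acl (fun t _ => descent_square (- t)).
have mI : measurable (`](- n%:R)%R, 0%R]%classic : set (measurableTypeR R)).
  exact: measurable_itv.
have ip' : leb.-integrable `](- n%:R)%R, 0%R] (EFin \o p) by exact: integrable_itv ip.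
rewrite (@ae_eq_integral _ _ _ leb _ (EFin \o p)) //; first last.
- apply: ae_sub (ae_and pD (ae_neq 0)) => t [{}pD tn0] /=; rewrite in_itv/= => /andP[nt t0].
  have {}t0 : t < 0 by rewrite lt_neqAle tn0.
  have [|dc ->] := pD; first by rewrite nt t0.
  congr EFin; apply: eq_bigr => l _; rewrite climb_velocity//.
  have c01 := descent_square (- t) l.
  by rewrite slope_ext_id// gext_id.
- by apply/measurable_EFinP; apply: measurable_funTS; move/measurable_int : ip => /measurable_EFinP.
- by apply/measurable_EFinP; exact: measurable_funTS.
rewrite -[X in (X <= _)%E]fineK; last exact: integrable_fin_num.
rewrite lee_fin -[X in X <= _]pE oppr0 descent0 gerBl.
exact: total_potential_ge0.
Qed.

(** The cost of the reversed trajectory is the derivative of its potential, whose increase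
over any interval ]- n, 0] is at most W x. *)
Lemma action_ref_climb : action_ref P lam g climb = (W x)%:E.
Proof.
apply/eqP; rewrite eq_le (action_ref_ge climb_path) andbT.
rewrite /action_ref asboolT; last by move=> a _; exact: climb_abs_continuous.
have bound := ge0_integral_half_line mcost cost_ge0 cost_climb.
have mI : measurable (`]-oo, 0%R]%classic : set (measurableTypeR R)).
  exact: measurable_itv.
have ic : leb.-integrable `]-oo, 0%R] (EFin \o cost).
  apply/integrableP; split; first by apply/measurable_EFinP; exact: measurable_funTS.
  under eq_integral do rewrite gee0_abs ?lee_fin ?cost_ge0//.
  by apply: le_lt_trans bound _; rewrite ltry.
apply: (@le_trans _ _ (\int[leb]_(t in `]-oo, 0%R]) cost t)%:E); last first.
  by rewrite /Rintegral fineK//; exact: integrable_fin_num.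
apply: nonmeasurable_le_Rintegral => //.
  move=> t _; exact: (lagrangian_ref_ge0 Pstoch Pirr muP lam01 g01 _ (descent_square _)).
have hn (n : nat) : {ae leb, forall t, - n%:R < t < 0 ->
    forall l, derivable (fun s => climb s 0 l) t 1}.
  have n0 : - n%:R <= 0 :> R by rewrite oppr_le0.
  have acl l : rabs_continuous (- n%:R) 0 (fun t => climb t 0 l).
    exact: abs_continuous_coordinate (climb_abs_continuous _).
  have [p [_ _ pD]] := potential_paths n0 acl (fun t _ => descent_square (- t)).
  by apply: ae_sub pD => t {}pD /pD[].
have {}hn := ae_foralln hn.
apply: ae_sub (ae_and hn (ae_neq 0)) => t [{}hn tn0] /=; rewrite in_itv/= => t0.
have {}t0 : t < 0 by rewrite lt_neqAle tn0.
have dc : forall l, derivable (fun s => climb s 0 l) t 1.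
  apply: (hn (Num.bound (- t))); rewrite t0 andbT ltrNl.
  by apply: archi_boundP; rewrite oppr_ge0 ltW.
have vE l := @derive1_coordinate R climb t l dc.
apply: le_trans (lagrangian_ref_le Pstoch Pirr muP lam01 g01 (descent_square (- t)) _ _) _.
- move=> l; rewrite mxE; apply: (traj_lt1 (g01 l) (glip l) (@gpos l) (kap01 l) (sx l)).
  by rewrite oppr_gt0.
- by move=> l; rewrite vE climb_velocity.
rewrite lee_fin /cost le_eqVlt; apply/orP; left; apply/eqP.
apply: eq_bigr => l _; rewrite vE climb_velocity//.
have c01 := descent_square (- t) l.
by rewrite slope_ext_id// gext_id.
Qed.

Lemma min_action_ref :
  ereal_inf [set action_ref P lam g psi | psi in path_from0 x] = (W x)%:E.
Proof.
apply/eqP; rewrite eq_le; apply/andP; split.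
  rewrite -action_ref_climb; apply: ereal_inf_lbound.
  by exists climb => //; exact: climb_path.
by apply: le_ereal_inf_tmp => _ [psi psix <-]; exact: action_ref_ge.
Qed.

Lemma climb_optimal : optimal_path P lam g x climb.
Proof. by split; [exact: climb_path|rewrite min_action_ref action_ref_climb]. Qed.

(** Equality in the lower bound makes the gap zero almost everywhere: each coordinate goes
up at the speed of the drift, or is at rest at 0. *)
Lemma optimal_path_unique psi : optimal_path P lam g x psi ->
  forall t, t <= 0 -> psi t = climb t.
Proof.
move=> [psix]; rewrite min_action_ref => opt a a0; apply/rowP => l.
move: opt; rewrite /action_ref; case: asboolP => // acpsi opt.
have [m [im m0 h mD]] := action_ref_gap l psix acpsi a0.
have mI : measurable (`]a, 0%R]%classic : set (measurableTypeR R)).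
  exact: measurable_itv.
have im0 : \int[leb]_(t in `]a, 0]) m t = 0.
  apply/eqP; rewrite eq_le Rintegral_ge0// andbT.
  by move: h; rewrite opt lee_fin gerDl.
have am0 : {ae leb, forall t, a < t < 0 -> m t = 0}.
  have : (\int[leb]_(t in `]a, 0%R]) `|(m t)%:E| = 0)%E.
    under eq_integral do rewrite gee0_abs ?lee_fin//.
    by rewrite -[LHS]fineK; [congr EFin|exact: integrable_fin_num].
  move/(ae_eq_integral_abs _ mI _) => /(_ (measurable_int _ im)) aem.
  apply: ae_sub aem => t /= aem /andP[at_ /ltW t0].
  by have := aem; rewrite in_itv/= at_ t0 => /(_ isT) [].
have [_ spsi _ psi0] := psix.
apply: (climb_unique (g01 l) (glip l) (kap01 l) a0
  (abs_continuous_coordinate l (acpsi a a0))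
  (abs_continuous_coordinate l (climb_abs_continuous a))).
- by move=> t /andP[_ t0]; exact: spsi.
- by move=> t _; exact: descent_square.
- by apply: ae_sub (ae_and am0 mD) => t [{}am0 {}mD] ta _; apply: mD => //; exact: am0.
- apply: ae_sub (ae_neq 0) => t _ /andP[_ t0] dc; rewrite climb_velocity//.
  by case: ifPn => [/eqP ->|_]; [left|right].
- by rewrite psi0 oppr0 descent0.
Qed.

End FromPoint.

(** * The reflected differential equation *)

Lemma reflection_eq (D : set R) (w w' x : R -> 'rV[R]_2) : (forall t, D t -> w t = w' t) ->
  reflection D w x -> reflection D w' x.
Proof.
move=> ww' [k [h1 h2 h3 h4]]; exists k; split => // t Dt.
by have [sx <-] := h2 t Dt; rewrite ww'.
Qed.

Lemma within_continuous_clamp a b (f : R -> R) : a <= b ->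
  {within `[a, b], continuous f} -> continuous (f \o clamp a b).
Proof.
move=> ab /subspace_continuousP cf t.
have tab s : `[a, b]%classic (clamp a b s) by rewrite /= in_itv/= clamp_itv.
have cc : continuous (clamp a b).
  by apply: (lipschitz_continuous (M := 1)) => p q; rewrite mul1r clamp_dist.
apply: (cvg_comp _ _ _ (cf _ (tab t))) => Q Qt.
have h : \forall s \near t, `[a, b]%classic (clamp a b s) -> Q (clamp a b s) := cc t _ Qt.
change (\forall s \near t, Q (clamp a b s)).
by apply: filterS h => s; apply.
Qed.

Lemma fbarE (y : 'rV[R]_2) l : fbar mu lam g y 0 l = - (kap l * g l (y 0 l)).
Proof. by rewrite mxE. Qed.

Lemma push_velocity_bound (phi : R -> 'rV[R]_2) (c : 'I_2 -> R) l t :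
  (forall k, 0 <= c k) -> `|push_velocity phi c t 0 l| <= c l.
Proof. by move=> c0; rewrite mxE; case: ifP => _; rewrite ?normr0// normrN ger0_norm. Qed.

Lemma push_velocity_measurable (phi : R -> 'rV[R]_2) (c : 'I_2 -> R) l :
  continuous (fun t => phi t 0 l) -> measurable_fun setT (fun t => push_velocity phi c t 0 l).
Proof.
move=> cphi; under eq_fun do rewrite mxE.
apply: measurable_fun_ifT; [|exact: measurable_cst|exact: measurable_cst].
apply: (@measurable_fun_eqr _ _ _ setT _ (cst 0) _ (measurable_cst _)).
exact: continuous_measurable_fun.
Qed.

Section FromPoint.
Variable x : 'rV[R]_2.
Hypothesis sx : square x.

Local Notation descent := (descent x).

Let drift l t : R := - (kap l * gext (g l) (descent t 0 l)).

Let mdrift l : measurable_fun setT (drift l).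
Proof.
apply: measurable_funN; apply: measurable_funM; first exact: measurable_cst.
apply: (measurableT_comp (f := gext (g l))).
  by apply: continuous_measurable_fun; exact: gext_continuous (glip l).
apply: continuous_measurable_fun.
exact: (descent_continuous).
Qed.

Let drift1 l t : `|drift l t| <= 1.
Proof.
rewrite normrN; have /andP[k0 k1] := kap01 l.
have /andP[G0 /ltW G1] := gext01 (g01 l) (descent t 0 l).
by rewrite ger0_norm ?mulr_ge0 ?(ltW k0)// mulr_ile1 ?(ltW k0).
Qed.

(** When the coordinate l vanishes, its drift is exactly compensated by a push at the rate
kap l * g l 0. *)
Lemma descent_reflected_ode : reflected_ode mu lam g x descent.
Proof.
have cd l := @descent_continuous x l.
have sd := descent_square sx.
pose c l := kap l * g l 0.
have c0 l : 0 <= c l.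
  have /andP[k0 _] := kap01 l; have /andP[g0 _] : 0 <= g l 0 < 1 by apply: g01; rewrite lexx ler01.
  by rewrite mulr_ge0 ?(ltW k0).
have mD : measurable (`[0, +oo[%classic : set (measurableTypeR R)) by exact: measurable_itv.
have D0 t : `[0, +oo[%classic t -> 0 <= t by rewrite /= in_itv/= andbT.
apply: reflection_eq (push_reflection cd sd c0 mD D0).
move=> t /=; rewrite in_itv/= andbT => t0; apply/rowP => l; rewrite !mxE.
pose v s := push_velocity descent c s 0 l.
have mv : measurable_fun setT v by exact: push_velocity_measurable.
have vc s : `|v s| <= c l by exact: push_velocity_bound.
have -> : \int[leb]_(s in `[0, t]) fbar mu lam g (descent s) 0 l = prim (drift l) t.
  by apply: eq_Rintegral => s _; rewrite fbarE /drift gext_id//; exact: sd.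
rewrite -/(prim v t).
pose F s := traj (g l) (kap l) (x 0 l) s + prim v s - prim (drift l) s.
suff : F 0 = F t.
  rewrite /F !(prim_le0 _ (lexx 0)) addr0 subr0 (traj_le0 (g01 l) (glip l) (kap01 l) (sx l))//.
  by move=> h; rewrite [X in _ = X + _]h subrK.
have acd : rabs_continuous 0 t (traj (g l) (kap l) (x 0 l)).
  apply: (rabs_continuous_lipschitz (K := 1)) => p q _ pq _; rewrite mul1r.
  rewrite -[X in _ <= X]ger0_norm ?subr_ge0//.
  exact: traj_lipschitz (g01 l) (glip l) (kap01 l) p q.
have acp (f : R -> R) M : measurable_fun setT f -> (forall s, `|f s| <= M) ->
    rabs_continuous 0 t (prim f).
  move=> mf fM; apply: (rabs_continuous_lipschitz (K := M)) => p q _ pq _.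
  by rewrite -[X in _ <= _ * X]ger0_norm ?subr_ge0//; exact: prim_lipschitz.
apply: (rabs_continuous_constant t0).
  apply: rabs_continuousD; first exact: rabs_continuousD acd (acp _ _ mv vc).
  exact: rabs_continuousN (acp _ _ (mdrift l) (@drift1 l)).
have [h [_ _ hD]] := rabs_continuous_FTC t0 acd.
have dv := prim_ae_derive mv vc; have dd := prim_ae_derive (mdrift l) (@drift1 l).
apply: ae_sub (ae_and hD (ae_and dv dd)) => s [{}hD [{}dv {}dd]] st _.
have [dz _] := hD st; have /andP[s0 _] := st.
have dF := is_deriveB (is_deriveD (is_derive1P dz) (dv s0)) (dd s0).
rewrite derive1E [LHS](@derive_val _ _ _ _ _ _ _ dF).
rewrite (traj_velocity (g01 l) (glip l) (kap01 l) (sx l) s0 dz).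
rewrite /v /push_velocity /drift !mxE gext_id; last first.
  by have := sd s l; rewrite mxE.
by case: ifPn => [/eqP ->|_]; rewrite /c; ring.
Qed.

Lemma reflected_coordinate_eq (T : R) (w w' u : R -> R) :
  (forall t, 0 <= t <= T -> w t = w' t) ->
  reflected_coordinate T w u -> reflected_coordinate T w' u.
Proof.
move=> ww' [h1 h2 h3 h4]; split => // s t s0 st tT h.
  by rewrite -!ww' ?s0 ?tT ?(le_trans st) ?(le_trans s0)//; exact: h3.
by rewrite -!ww' ?s0 ?tT ?(le_trans st) ?(le_trans s0)//; exact: h4.
Qed.

(** Almost everywhere, a coordinate of a solution follows the drift, or is at rest at 0;
resting at 1 would require a drift pointing outwards. *)
Lemma reflected_ode_unique chi : reflected_ode mu lam g x chi ->
  forall t, 0 <= t -> descent t = chi t.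
Proof.
move=> [k sk] T T0; apply/rowP => l.
have mD : measurable (`[0, +oo[%classic : set (measurableTypeR R)) by exact: measurable_itv.
have DT t : 0 <= t <= T -> `[0, +oo[%classic t.
  by move=> /andP[t0 _]; rewrite /= in_itv/= t0.
have rc := skorokhod_coordinate l mD DT T0 sk.
have [_ c01 _ _] := rc.
have [[cchi _] wE _ [m [n [_ _ _ kE _]]]] := sk.
have D0 : `[0, +oo[%classic (0 : R) by rewrite /= in_itv/= lexx.
have chi0 : chi 0 0 l = x 0 l.
  have [_ /rowP/(_ l)] := wE 0 D0; rewrite !mxE (kE 0 D0 l).
  by rewrite set_itv1 Rintegral_set1 set_itvoc0 Rintegral_set0 !addr0.
have cchil : {within `[0, T], continuous (fun t => chi t 0 l)}.
  by have [] := rc.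
pose u t := chi (clamp 0 T t) 0 l.
pose d t : R := - (kap l * gext (g l) (u t)).
have cu : continuous u.
  exact: (within_continuous_clamp T0 cchil).
have uE t : 0 <= t <= T -> u t = chi t 0 l by move=> tT; rewrite /u clamp_id.
have cd : continuous d.
  move=> t; apply: cvgN; apply: cvgM; first exact: cvg_cst.
  by apply: continuous_comp; [exact: cu|exact: gext_continuous (glip l) _].
have md : measurable_fun setT d by exact: continuous_measurable_fun.
have d1 t : `|d t| <= 1.
  rewrite normrN; have /andP[k0 k1] := kap01 l.
  have /andP[G0 /ltW G1] := gext01 (g01 l) (u t).
  by rewrite ger0_norm ?mulr_ge0 ?(ltW k0)// mulr_ile1 ?(ltW k0).
have {}rc : reflected_coordinate T (fun t => x 0 l + prim d t) (fun t => chi t 0 l).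
  apply: reflected_coordinate_eq rc => t /andP[t0 tT]; rewrite !mxE; congr (_ + _).
  apply: eq_Rintegral => s /set_mem/=; rewrite in_itv/= => /andP[s0 st].
  have sT : 0 <= s <= T by rewrite s0 (le_trans st).
  by rewrite fbarE /d uE// gext_id// c01.
have acw : rabs_continuous 0 T (fun t => x 0 l + prim d t).
  apply: (rabs_continuous_lipschitz (K := 1)) => p q _ pq _.
  rewrite opprD addrACA subrr add0r -[X in _ <= _ * X]ger0_norm ?subr_ge0//.
  exact: prim_lipschitz.
have acc := reflected_rabs_continuous rc acw.
have acd : rabs_continuous 0 T (fun t => descent t 0 l).
  apply: (rabs_continuous_lipschitz (K := 1)) => p q _ pq _; rewrite mul1r.
  rewrite -[X in _ <= X]ger0_norm ?subr_ge0//.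
  exact: (descent_lipschitz).
apply: (descent_unique (g01 l) (glip l) (kap01 l) T0 acd acc) => //.
- by move=> t _; exact: (descent_square sx).
- apply: ae_sub (ae_neq 0) => t _ /andP[t0 _] dz.
  have E : (fun t => descent t 0 l) = traj (g l) (kap l) (x 0 l).
    by apply/funext => s; rewrite mxE.
  have Et : descent t 0 l = traj (g l) (kap l) (x 0 l) t by rewrite mxE.
  rewrite E in dz *; rewrite Et.
  rewrite (traj_velocity (g01 l) (glip l) (kap01 l) (sx l) t0 dz).
  by case: ifPn => [/eqP ->|_]; [left|right].
- apply: ae_sub (ae_neq 0) => t _ tT dc.
  have tT' : 0 <= t <= T by have /andP[? ?] := tT; rewrite !ltW.
  have /andP[t0 _] := tT.
  have dp := prim_derive md d1 t0 (cd t).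
  have dw : is_derive t (1 : R) (fun s => x 0 l + prim d s) (d t).
    rewrite -[d t]add0r; exact: is_deriveD.
  have := reflected_derive rc tT dc (@ex_derive _ _ _ _ _ _ _ dw).
  have -> : derive1 (fun s => x 0 l + prim d s) t = d t by rewrite derive1E derive_val.
  have /andP[ch0 ch1] := c01 t tT'.
  move=> [h1 h2 h3 h4].
  have [ce|cn0] := eqVneq (chi t 0 l) 0; first by left; rewrite (h3 ce); split.
  right; have cp : 0 < chi t 0 l by rewrite lt_neqAle eq_sym cn0.
  have := h1 cp; rewrite /d uE// (gext_id _ (c01 t tT')).
  have [c1|cn1] := eqVneq (chi t 0 l) 1.
    rewrite (h4 c1) c1 oppr_ge0; have /andP[k0 _] := kap01 l.
    by rewrite pmulr_rle0// leNgt gpos// ltr01 lexx.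
  have := h2 (_ : chi t 0 l < 1); rewrite lt_neqAle cn1 => /(_ ch1).
  rewrite /d uE// (gext_id _ (c01 t tT')) => h5 h6.
  by apply/eqP; rewrite eq_le h5 h6.
- by rewrite chi0 (descent0 sx).
Qed.

End FromPoint.

(** * The quasi-potential *)

Let slope_ge0 l (z : R) : 0 <= z <= 1 -> 0 <= slope g l z.
Proof. by move=> z01; have := slope_ext_ge0 (g01 l) z; rewrite slope_ext_id. Qed.

(** The momentum is the gradient of the potential, with zero in place of the coordinates
that vanish. Indeed the reflected path moves away from an axis no faster than the free one,
and at almost every time spent on the axis its velocity along that coordinate is zero. *)
Lemma action0_ge (T : R) phi : 0 < T -> (forall t, 0 <= t <= T -> square (phi t)) ->
  ((W (phi T))%:E <= action0 P lam g T phi)%E.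
Proof.
move=> T0 sphi; apply: le_ereal_inf_tmp => _ [phi0 [psi [acpsi [k sk] ->]]].
have mD : measurable (`[0, T]%classic : set (measurableTypeR R)) by exact: measurable_itv.
have mI : measurable (`]0, T]%classic : set (measurableTypeR R)) by exact: measurable_itv.
have DT t : 0 <= t <= T -> `[0, T]%classic t by rewrite /= in_itv.
have rc l := skorokhod_coordinate l mD DT (ltW T0) sk.
have acl l : rabs_continuous 0 T (fun t => psi t 0 l) by exact: abs_continuous_coordinate.
have acphi l := reflected_rabs_continuous (rc l) (acl l).
have [p [ip pE pD]] := potential_paths (ltW T0) acphi sphi.
have -> : W (phi T) = \int[leb]_(t in `]0, T]) p t.
  by rewrite -pE phi0 total_potential0 subr0.
have [q0 [_ _ psi0]] := rabs_continuous_FTC (ltW T0) (acl 0).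
have [q1 [_ _ psi1]] := rabs_continuous_FTC (ltW T0) (acl 1).
apply: Rintegral_le_nonmeasurable => //.
- by move=> t /=; rewrite !in_itv/= => /andP[/ltW -> ->].
- move=> t /=; rewrite in_itv/= => tT.
  exact: (lagrangian_ge0 Pstoch Pirr muP lam01 g01 _ (sphi t tT)).
- exact: integrable_itv ip.
apply: ae_sub (ae_and (ae_neq T) (ae_and pD (ae_and psi0 psi1))).
move=> t [tnT [{}pD [{}psi0 {}psi1]]] /=; rewrite in_itv/= => /andP[t0 tT].
have tT' : 0 < t < T by rewrite t0 lt_neqAle tnT tT.
have [dphi ->] := pD tT'.
have dpsi l : derivable (fun s => psi s 0 l) t 1.
  by have [->|->] := I2P l; [have [] := psi0 tT'|have [] := psi1 tT'].
have tT2 : 0 <= t <= T by rewrite ltW.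
have st := sphi t tT2.
pose al : 'rV[R]_2 := \row_l (if phi t 0 l == 0 then 0 else slope g l (phi t 0 l)).
apply: le_trans (lagrangian_ge P lam g (phi t) (derive1 psi t) al).
rewrite (hamiltonian_slope Pstoch Pirr muP lam01 g01 st); last first.
  by move=> l; rewrite mxE; case: ifP => _; [left|right].
rewrite subr0 lee_fin dotpE sum_I2 !(derive1_coordinate _ dpsi) !mxE.
have le l : slope g l (phi t 0 l) * derive1 (fun s => phi s 0 l) t <=
    (if phi t 0 l == 0 then 0 else slope g l (phi t 0 l)) * derive1 (fun s => psi s 0 l) t.
  have [h1 _ h3 _] := reflected_derive (rc l) tT' (dphi l) (dpsi l).
  case: ifPn => [/eqP/h3 ->|pn0]; first by rewrite mulr0 mul0r.
  have /andP[p0 _] := st l.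
  by rewrite ler_wpM2l ?slope_ge0 ?st// h1// lt_neqAle eq_sym pn0.
exact: lerD (le 0) (le 1).
Qed.

Lemma drift_bounded : exists2 M : R, 0 <= M < 1 & forall l z, 0 <= z <= 1 -> g l z <= M.
Proof.
have h l : exists2 M : R, 0 <= M < 1 & forall z, 0 <= z <= 1 -> g l z <= M.
  have [|c c01 cM] := @EVT_max R (gext (g l)) 0 1 ler01.
    by apply: continuous_subspaceT; exact: gext_continuous (glip l).
  exists (gext (g l) c); first exact: gext01 (g01 l) c.
  by move=> z z01; rewrite -(gext_id _ z01) cM// in_itv.
have [M0 /andP[M00 M01] h0] := h 0; have [M1 /andP[M10 M11] h1] := h 1.
exists (Num.max M0 M1); first by rewrite le_max M00 gt_max M01.
by move=> l z z01; rewrite le_max; have [->|->] := I2P l; rewrite ?h0 ?h1 ?orbT.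
Qed.

Lemma derive1_near_eq (f h : R -> R) t : derivable f t 1 ->
  (\forall s \near t, f s = h s) -> derivable h t 1 /\ derive1 h t = derive1 f t.
Proof.
move=> df fh; split; first by apply: near_eq_derivable df.
by rewrite !derive1E; apply/esym; apply: near_eq_derive.
Qed.

Section NearOptimal.
Variables (x : 'rV[R]_2) (eta T M : R).
Hypothesis sx : square x.
Hypothesis eta0 : 0 < eta.
Hypothesis T0 : 0 <= T.
Hypothesis M01 : 0 <= M < 1.
Hypothesis gM : forall l z, 0 <= z <= 1 -> g l z <= M.

Local Notation z l := (traj (g l) (kap l) (x 0 l)).
Local Notation y l := (traj (g l) (kap l) (x 0 l) T).
Hypothesis yeta : forall l, y l <= kap l * eta.

Let S := T + eta.

(** A straight line from 0 to a point of the optimal path, run through in the short time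
eta, and then the rest of the optimal path. The two summands are each constant during one
of these two stages. *)
Definition near_optimal t : 'rV[R]_2 :=
  \row_l (y l * (clamp 0 eta t / eta) + (z l (S - Num.max t eta) - y l)).

Local Notation phi := near_optimal.

Let z01 l t : 0 <= z l t <= 1.
Proof. exact: traj01 (g01 l) (glip l) (kap01 l) (sx l) t. Qed.

Let stage1 l t : t <= eta -> phi t 0 l = y l * (clamp 0 eta t / eta).
Proof. by move=> te; rewrite mxE max_r// /S addrK subrr addr0. Qed.

Let stage2 l t : eta <= t -> phi t 0 l = z l (S - t).
Proof.
move=> te; rewrite mxE max_l// /clamp min_r// max_r ?(ltW eta0)//.
by rewrite divff ?gt_eqF// mulr1 addrC subrK.
Qed.

Let phi_square t : square (phi t).
Proof.
move=> l; have [te|/ltW te] := leP t eta; last by rewrite stage2.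
rewrite stage1//; have /andP[y0 y1] := z01 l T.
have /andP[c0 c1] := @clamp_itv R 0 eta t (ltW eta0).
have q0 : 0 <= clamp 0 eta t / eta by rewrite divr_ge0 ?(ltW eta0).
by rewrite mulr_ge0//= mulr_ile1// ler_pdivrMr// mul1r.
Qed.

Let phi_lipschitz l s t : `|phi t 0 l - phi s 0 l| <= 2 * `|t - s|.
Proof.
rewrite !mxE; set a := clamp 0 eta t; set b := clamp 0 eta s.
set A := z l (S - Num.max t eta); set B := z l (S - Num.max s eta).
have -> : y l * (a / eta) + (A - y l) - (y l * (b / eta) + (B - y l)) =
    y l / eta * (a - b) + (A - B) by ring.
rewrite (_ : 2 * `|t - s| = `|t - s| + `|t - s|); last by ring.
apply: le_trans (ler_normD _ _) _; apply: lerD.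
  rewrite normrM; have /andP[y0 _] := z01 l T; have /andP[k0 k1] := kap01 l.
  have h : 0 <= y l / eta <= 1.
    rewrite divr_ge0 ?(ltW eta0)//= ler_pdivrMr// mul1r (le_trans (yeta l))//.
    by rewrite ler_piMl// ltW.
  have /andP[h0 h1] := h.
  rewrite (ger0_norm h0); apply: le_trans (clamp_dist t s (ltW eta0)).
  by rewrite ler_piMl.
apply: le_trans (traj_lipschitz (x 0 l) (g01 l) (glip l) (kap01 l) _ _) _.
rewrite opprD addrACA subrr add0r -opprD normrN.
rewrite /Num.max; case: ifPn => h1; case: ifPn => h2; rewrite ?subrr ?normr0//.
- by rewrite -leNgt in h2; rewrite ler_norml; apply/andP; split; have := normr_ge0 (t - s);
    have := ler_norm (t - s); have := ler_norm (- (t - s)); rewrite normrN; lra.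
- by rewrite -leNgt in h1; rewrite ler_norml; apply/andP; split; have := normr_ge0 (t - s);
    have := ler_norm (t - s); have := ler_norm (- (t - s)); rewrite normrN; lra.
Qed.

Let phi_continuous l : continuous (fun t => phi t 0 l).
Proof. by apply: (lipschitz_continuous (M := 2)) => s t; exact: phi_lipschitz. Qed.

Let phi0 : phi 0 = 0.
Proof.
apply/rowP => l; rewrite stage1 ?(ltW eta0)// mxE clamp_id ?lexx ?(ltW eta0)//.
by rewrite mul0r mulr0.
Qed.

Let phiS : phi S = x.
Proof.
apply/rowP => l; rewrite stage2 ?lerDr// subrr.
by rewrite (traj_le0 (g01 l) (glip l) (kap01 l) (sx l)).
Qed.

Let c l := kap l * g l 0.

Let g00 l : 0 <= g l 0 < 1.
Proof. by apply: g01; rewrite lexx ler01. Qed.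

Let c0 l : 0 <= c l.
Proof.
have /andP[k0 _] := kap01 l; have /andP[h _] := g00 l.
by rewrite mulr_ge0// ltW.
Qed.

Let psi t := phi t + displacement (push_velocity phi c) t.

Let psi_coord l : (fun t => psi t 0 l) =
  fun t => phi t 0 l + prim (fun s => push_velocity phi c s 0 l) t.
Proof. by apply/funext => t; rewrite [LHS]mxE [X in _ + X]mxE. Qed.

Let mpush l : measurable_fun setT (fun s => push_velocity phi c s 0 l).
Proof. exact: push_velocity_measurable. Qed.

Let pushc l s : `|push_velocity phi c s 0 l| <= c l.
Proof. exact: push_velocity_bound. Qed.

Let S0 : 0 < S.
Proof. by rewrite ltr_wpDl. Qed.

Let ac_phi l : rabs_continuous 0 S (fun t => phi t 0 l).
Proof.
apply: (rabs_continuous_lipschitz (K := 2)) => p q _ pq _.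
by rewrite -[X in _ <= _ * X]ger0_norm ?subr_ge0.
Qed.

Let ac_psi : abs_continuous 0 S psi.
Proof.
apply: abs_continuous_coordinates => l; rewrite psi_coord.
apply: rabs_continuousD (ac_phi l) _.
apply: (rabs_continuous_lipschitz (K := c l)) => p q _ pq _.
by rewrite -[X in _ <= _ * X]ger0_norm ?subr_ge0//; exact: prim_lipschitz.
Qed.

Let C := - ln ((1 - M) / 2).

Let C0 : 0 <= C.
Proof. by have /andP[M0 M1] := M01; rewrite oppr_ge0 ln_le0//; lra. Qed.

Let psi_velocity : {ae leb, forall t, 0 < t < S ->
  (forall l, derivable (fun s => phi s 0 l) t 1) /\
  forall l, derive1 psi t 0 l = derive1 (fun s => phi s 0 l) t + push_velocity phi c t 0 l}.
Proof.
have [h0 [_ _ d0]] := rabs_continuous_FTC (ltW S0) (ac_phi 0).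
have [h1 [_ _ d1]] := rabs_continuous_FTC (ltW S0) (ac_phi 1).
have e0 := prim_ae_derive (mpush 0) (pushc 0); have e1 := prim_ae_derive (mpush 1) (pushc 1).
apply: ae_sub (ae_and (ae_and d0 d1) (ae_and e0 e1)) => t [[{}d0 {}d1] [{}e0 {}e1]] tS.
have /andP[t0 _] := tS.
have dphi l : derivable (fun s => phi s 0 l) t 1.
  by have [->|->] := I2P l; [have [] := d0 tS|have [] := d1 tS].
have dpush l : is_derive t (1 : R) (prim (fun s => push_velocity phi c s 0 l))
    (push_velocity phi c t 0 l).
  by have [->|->] := I2P l; [exact: e0|exact: e1].
split=> // l.
have dpsi k : is_derive t (1 : R) (fun s => psi s 0 k)
    (derive1 (fun s => phi s 0 k) t + push_velocity phi c t 0 k).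
  by rewrite psi_coord; exact: is_deriveD (is_derive1P (dphi k)) (dpush k).
rewrite derive1_coordinate; last by move=> k; exact: (@ex_derive _ _ _ _ _ _ _ (dpsi k)).
by rewrite derive1E; exact: (@derive_val _ _ _ _ _ _ _ (dpsi l)).
Qed.

Let stage1_velocity l t : 0 < t < eta -> derivable (fun s => phi s 0 l) t 1 ->
  derive1 (fun s => phi s 0 l) t = y l / eta.
Proof.
move=> te dphi.
have [|_ <-] := derive1_near_eq (h := fun s => y l / eta * s) dphi.
  apply: filterS (near_itvoo te) => s /andP[/ltW s0 /ltW se].
  by rewrite stage1// clamp_id ?s0//; ring.
have dlin : is_derive t (1 : R) (fun s => y l / eta * s) (y l / eta).
  have := is_deriveZ (y l / eta) (is_derive_id t (1 : R)).
  by rewrite /GRing.scale/= mulr1.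
by rewrite derive1E derive_val.
Qed.

Let stage2_velocity l t : eta < t < S -> derivable (fun s => phi s 0 l) t 1 ->
  derive1 (fun s => phi s 0 l) t = if phi t 0 l == 0 then 0 else kap l * g l (phi t 0 l).
Proof.
move=> te dphi; have /andP[te' tS] := te.
have [|dz <-] := derive1_near_eq (h := fun s => z l (S - s)) dphi.
  by apply: filterS (near_itvoo te) => s /andP[/ltW s0 _]; rewrite stage2.
rewrite stage2 ?ltW//.
exact: (reversed_traj_velocity (g01 l) (glip l) (kap01 l) (sx l) tS dz).
Qed.

Let stage1_lagrangian t : 0 < t < eta ->
  (forall l, derivable (fun s => phi s 0 l) t 1) ->
  (forall l, derive1 psi t 0 l = derive1 (fun s => phi s 0 l) t + push_velocity phi c t 0 l) ->
  (L (phi t) (derive1 psi t) <= C%:E)%E.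
Proof.
move=> te dphi dpsi; have /andP[M0 M1] := M01; have /andP[t0 /ltW te'] := te.
apply: (lagrangian_le_cst Pstoch Pirr muP lam01 g01 (phi_square t) M1).
  by move=> l; exact: gM (phi_square t l).
move=> l; rewrite dpsi stage1_velocity// mxE.
have /andP[k0 k1] := kap01 l; have /andP[y0 _] := z01 l T.
rewrite stage1// clamp_id ?(ltW t0)//.
have [yE|yn] := eqVneq (y l) 0.
  rewrite yE !mul0r eqxx add0r normrN ger0_norm// /c.
  by have /andP[_ /ltW h] := g00 l; rewrite ler_piMr// ltW.
rewrite ifF; last by rewrite !mulf_eq0 (negbTE yn) invr_eq0 !gt_eqF.
rewrite addr0 ger0_norm ?divr_ge0 ?(ltW eta0)//.
by rewrite ler_pdivrMr.
Qed.

Let stage2_lagrangian t : eta < t < S ->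
  (forall l, derivable (fun s => phi s 0 l) t 1) ->
  (forall l, derive1 psi t 0 l = derive1 (fun s => phi s 0 l) t + push_velocity phi c t 0 l) ->
  (L (phi t) (derive1 psi t) <=
     (\sum_l slope g l (phi t 0 l) * derive1 (fun s => phi s 0 l) t)%:E)%E.
Proof.
move=> te dphi dpsi.
have vE l : derive1 psi t 0 l =
    if phi t 0 l == 0 then - (kap l * g l 0) else kap l * g l (phi t 0 l).
  rewrite dpsi stage2_velocity// [X in _ + X]mxE.
  by case: ifP => _; rewrite ?add0r ?addr0.
apply: le_trans (lagrangian_le_slope Pstoch Pirr muP lam01 g01 (phi_square t) _) _.
  by move=> l; rewrite vE; case: ifPn => [/eqP ->|_]; [right|left].
rewrite lee_fin le_eqVlt; apply/orP; left; apply/eqP; apply: eq_bigr => l _.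
rewrite vE stage2_velocity//; have /andP[k0 _] := kap01 l.
case: ifPn => [/eqP pz|_]; first by rewrite max_r// oppr_le0; exact: c0.
have /andP[G0 _] := g01 l (phi_square t l).
by rewrite max_l// mulr_ge0// ltW.
Qed.

(** During the first stage the cost is bounded by C. Afterwards the free velocity is that
of the optimal path, except on the axes, where it is the drift, which is free. *)
Lemma quasi_potential_near_optimal :
  (quasi_potential P lam g x <= (W x + C * eta)%:E)%E.
Proof.
have mD : measurable (`[0, S]%classic : set (measurableTypeR R)) by exact: measurable_itv.
have mI b : measurable (`]0, b]%classic : set (measurableTypeR R)) by exact: measurable_itv.
apply: (@le_trans _ _ (action0 P lam g S phi)).
  apply: ereal_inf_lbound; exists S, phi; split => //.
  by apply: continuous_subspaceT; exact: continuous_row.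
apply: (@le_trans _ _ (\int[leb]_(t in `[0%R, S]) L (phi t) (derive1 psi t))%E).
  apply: ereal_inf_lbound; split; first exact: phi0.
  exists psi; split => //.
  apply: (push_reflection phi_continuous phi_square c0 mD).
  by move=> t /=; rewrite in_itv/= => /andP[].
have [p [ip pE pD]] := potential_paths (ltW S0) ac_phi (fun t _ => phi_square t).
pose i := (cst C) \_ (`]0, eta]%classic : set R).
have ii : leb.-integrable setT (EFin \o i).
  have h : leb.-integrable `]0, eta] (EFin \o cst C).
    have := @bounded_integrable_itv R `|C| 0 eta false false (cst C) (measurable_cst _).
    by apply.
  have /integrable_mkcond := h; move=> /(_ (mI eta)).
  by rewrite restrict_EFin.
have iE : \int[leb]_(t in `]0, S]) i t = C * eta.
  rewrite -[X in C * X]subr0 -(Rintegral_itv_cst C (ltW eta0)).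
  rewrite [LHS]Rintegral_mkcond [RHS]Rintegral_mkcond; congr fine.
  apply: eq_integral => t _; congr EFin; rewrite /i !patchE.
  case: ifPn => // tS; case: ifPn => // te; exfalso; move/negP : tS; apply.
  move: te; rewrite !inE/= !in_itv/= => /andP[-> te]/=.
  by rewrite (le_trans te)// lerDr.
have iq : leb.-integrable setT (EFin \o (i \+ p)) by exact: (integrableD measurableT ii ip).
have -> : W x + C * eta = \int[leb]_(t in `[0, S]) (i \+ p) t.
  rewrite -Rintegral_itv_obnd_cbnd; last exact: integrable_itv iq.
  rewrite RintegralD//; [|exact: integrable_itv ii|exact: integrable_itv ip].
  rewrite iE -[X in _ = _ + X]pE phi0 phiS total_potential0 subr0.
  by rewrite addrC.
apply: nonmeasurable_le_Rintegral => //.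
- move=> t _; exact: (lagrangian_ge0 Pstoch Pirr muP lam01 g01 _ (phi_square t)).
- exact: integrable_itv iq.
apply: ae_sub (ae_and (ae_and (ae_neq 0) (ae_neq S)) (ae_and (ae_neq eta) (ae_and pD psi_velocity))).
move=> t [[tn0 tnS] [tne [{}pD vD]]] /=; rewrite in_itv/= => /andP[t0 tS].
have tS' : 0 < t < S by rewrite !lt_neqAle eq_sym tn0 t0 tnS tS.
have [dphi ->] := pD tS'; have [_ dpsi] := vD tS'; have /andP[tp tS2] := tS'.
have [te|et] := ltP t eta.
  apply: le_trans (stage1_lagrangian _ dphi dpsi) _; first by rewrite tp.
  rewrite lee_fin /i patchE mem_set; last by rewrite /= in_itv/= tp ltW.
  rewrite lerDl; apply: sumr_ge0 => l _.
  rewrite mulr_ge0 ?slope_ge0 ?phi_square// stage1_velocity ?tp//.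
  by have /andP[y0 _] := z01 l T; rewrite divr_ge0// ltW.
have {}et : eta < t by rewrite lt_neqAle eq_sym tne.
apply: le_trans (stage2_lagrangian _ dphi dpsi) _; first by rewrite et.
rewrite lee_fin lerDr /i patchE; case: ifP => //.
Qed.

End NearOptimal.

Lemma quasi_potentialE (x : 'rV[R]_2) : square x -> (W x)%:E = quasi_potential P lam g x.
Proof.
move=> sx; apply/eqP; rewrite eq_le; apply/andP; split.
  apply: le_ereal_inf_tmp => _ [T [phi [T0 _ sphi [_ <-] ->]]].
  exact: action0_ge.
have [M M01 gM] := drift_bounded.
set C := - ln ((1 - M) / 2).
have C0 : 0 <= C by have /andP[M0 M1] := M01; rewrite oppr_ge0 ln_le0//; lra.
apply/lee_addgt0Pr => e e0.
pose eta := e / (C + 1).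
have C1 : 0 < C + 1 by rewrite ltr_wpDl.
have eta0 : 0 < eta by rewrite divr_gt0.
have ke l : 0 < kap l * eta by have /andP[k0 _] := kap01 l; rewrite mulr_gt0.
have [T0 T00 h0] := traj_cvg0 (g01 0) (glip 0) (@gpos 0) (kap01 0) (sx 0) (ke 0).
have [T1 T10 h1] := traj_cvg0 (g01 1) (glip 1) (@gpos 1) (kap01 1) (sx 1) (ke 1).
pose T := Num.max T0 T1.
have TT : 0 <= T by rewrite le_max (ltW T00).
have := quasi_potential_near_optimal sx eta0 TT M01 gM.
rewrite -/C => /(_ _)/le_trans; apply.
  move=> l; apply: ltW; have [->|->] := I2P l.
    by apply: h0; rewrite le_max lexx.
  by apply: h1; rewrite le_max lexx orbT.
rewrite -EFinD lee_fin lerD2l /eta mulrCA ler_piMr ?(ltW e0)//.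
by rewrite ler_pdivrMr// mul1r lerDl.
Qed.

End TwoStacks.

Lemma lipschitz_itvP (R : realType) (f : R -> R) : [lipschitz f z | z in `[0, 1]] ->
  exists K : R, forall y z, 0 <= y <= 1 -> 0 <= z <= 1 -> `|f y - f z| <= K * `|y - z|.
Proof.
move=> [K [_ hK]]; exists (K + 1) => y z y01 z01.
have K1 : K < K + 1 by rewrite ltrDl.
have := hK (K + 1) K1 (y, z) => /=; apply; split; by rewrite /= in_itv.
Qed.

Theorem theorem5p1 (R : realType) (P : 'M[R]_2) (mu : 'rV[R]_2)
    (lam : 'I_2 -> R) (g : 'I_2 -> R -> R)
    (Pstoch : stochastic_mx P) (Pirr : irreducible_mx P)
    (muP : invariant_probability P mu)
    (lam01 : forall i, 0 < lam i < 1)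
    (g01 : forall j z, 0 <= z <= 1 -> 0 <= g j z < 1)
    (glip : forall j, [lipschitz g j z | z in `[0, 1]])
    (gpos : forall j z, 0 < z <= 1 -> 0 < g j z) :
  (forall x, square x ->
     (explicit_potential g x)%:E = quasi_potential P lam g x) /\
  (forall x, square x -> x != 0 ->
     exists phi : R -> 'rV[R]_2,
       [/\ optimal_path P lam g x phi,
           forall psi, optimal_path P lam g x psi ->
             forall t, t <= 0 -> psi t = phi t,
           reflected_ode mu lam g x (fun t => phi (- t)) &
           forall chi, reflected_ode mu lam g x chi ->
             forall t, t <= 0 -> phi t = chi (- t)]).

Proof.
have [K glip'] : exists K : 'I_2 -> R, forall l y z, 0 <= y <= 1 -> 0 <= z <= 1 ->
    `|g l y - g l z| <= K l * `|y - z|.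
  have [K0 h0] := lipschitz_itvP (glip 0); have [K1 h1] := lipschitz_itvP (glip 1).
  by exists (fun l => if l == 0 then K0 else K1) => l; have [->|->] := I2P l.
split=> [x sx|x sx _].
  rewrite (explicit_potentialE g01 glip' sx).
  exact: (quasi_potentialE Pstoch Pirr muP lam01 g01 glip' gpos).
exists (fun t => descent mu lam g x (- t)); split.
- exact: (climb_optimal Pstoch Pirr muP lam01 g01 glip' gpos sx).
- move=> psi; exact: (optimal_path_unique Pstoch Pirr muP lam01 g01 glip' gpos sx).
- under eq_fun do rewrite opprK.
  exact: (descent_reflected_ode Pstoch Pirr muP lam01 g01 glip' sx).
- move=> chi ode t t0.
  apply: (reflected_ode_unique Pstoch Pirr muP lam01 g01 glip' gpos sx ode).
  by rewrite oppr_ge0.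
Qed.
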